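(* Let $\mathcal{K}_t=\mathcal{J}_t\backslash\mathcal{J}_{t-}$ and $X_t=\mathbb{E}[X\,|\,\mathcal{F}_t]$. The jump size of $(X_t)$ at time $t\in[0,1)$ is $$X_t-X_{t-}=g(Z)-X_{t-},$$ where the conditionally normal random variable $Z$ is given by $$Z=\sum_{i\in\mathcal{K}_t}\frac{\xi^{(i)}_t}{\sigma_i^2(1-t)},$$ and the function $g:\mathbb{R}\to\mathbb{R}$, for $t\in[0,1)$, is given by $$g(z)=\frac{\int_{\mathbb{X}}x\exp(xz)\prod_{i\notin\mathcal{K}_t}h\big(x,\xi^{(i)}(\tau^{(i)}_t),\tau^{(i)}_t,\sigma_i\big)\prod_{i\in\mathcal{K}_t}\exp\left(\frac{-tx^2}{2\sigma_i^2(1-t)}\right)\nu(\mathrm{d}x)}{\int_{\mathbb{X}}\exp(xz)\prod_{i\notin\mathcal{K}_t}h\big(x,\xi^{(i)}(\tau^{(i)}_t),\tau^{(i)}_t,\sigma_i\big)\prod_{i\in\mathcal{K}_t}\exp\left(\frac{-tx^2}{2\sigma_i^2(1-t)}\right)\nu(\mathrm{d}x)}.$$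
   Context: Let $(\Omega,\mathcal{G},(\mathcal{G}_t)_{t\ge0},\mathbb{P})$ be a filtered probability space; all filtrations are right-continuous and complete. $X\in\mathcal{L}^2(\Omega,\mathcal{G},\mathbb{P})$ has law $\nu$ and state space $(\mathbb{X},\mathcal{B}(\mathbb{X}))$, $\mathbb{X}\subseteq\mathbb{R}$. For $t\in[0,1]$ and $i=1,\ldots,n$, $\xi^{(i)}_t=tX+\sigma_i\beta^{(i)}_t$, with $\sigma_i>0$ and $(\beta^{(i)}_t)_{0\le t\le1}$ standard Brownian bridges (centred Gaussian, covariance $\min(s,t)-st$); $X,\beta^{(1)},\ldots,\beta^{(n)}$ are mutually independent. Write $\xi^{(i)}(u)=\xi^{(i)}_u$. Modulation: $(\boldsymbol{\tilde J}_t)_{t\in[0,1]}$ is a c\`adl\`ag $\{0,1\}^n$-valued jump process, independent of $(\boldsymbol{\xi}_t)$ (and $X$), whose $i$th coordinate switches at finitely many times generated by a random point field $\zeta$ on $[0,1]^n$. With $\otimes$ the coordinatewise product, $\mathcal{F}_t=\sigma\big((\boldsymbol{\tilde J}_u\otimes\boldsymbol{\xi}_u)_{u\le t},(\boldsymbol{\tilde J}_u)_{u\le t},X\mathbf{1}_{\{t=1\}}\big)$. Let $\mathcal{J}_t=\{i:\tilde J^{(i)}_t=1\}$ and $\tau^{(i)}_t=0\vee\sup\{u\in[0,t]:\tilde J^{(i)}_u=1\}$ ($\sup\emptyset=-\infty$). The function $h$ is $h(x,y,t,\sigma)=\exp\{(xy-tx^2/2)/(\sigma^2(1-t))\}$.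 ''Conditionally normal'' means that the conditional law of $Z$ given $X$ and $\mathcal{F}_{t-}$ (with $\mathcal{K}_t$ known) is Gaussian. *)

(* Defs.v *)
From HB Require Import structures.
From mathcomp Require Import all_boot all_order all_algebra.
From mathcomp Require Import all_classical all_reals all_analysis.
Set Implicit Arguments.
Unset Strict Implicit.
Unset Printing Implicit Defensive.
Import Order.TTheory GRing.Theory Num.Theory.
Import numFieldNormedType.Exports.
Local Open Scope classical_set_scope.
Local Open Scope ring_scope.

Section paths.
Context {R : realType}.

Definition cadlag {U : ptopologicalType} (f : R -> U) : Prop :=
  (forall t, 0 <= t < 1 -> f u @[u --> t^'+] --> f t) /\
  (forall t, 0 < t <= 1 -> cvg (f u @[u --> t^'-])).

(* Time starts at 0, so the left limit at 0 is the value there: f(0-) = f(0). *)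
Definition left_limit {U : ptopologicalType} (f : R -> U) (t : R) : U :=
  if 0 < t then lim (f u @[u --> t^'-]) else f t.

End paths.

Section sigma_algebras.
Context {d : measure_display} {T : measurableType d} {R : realType}.
Variable P : probability T R.

Definition sigma_rv {d' : measure_display} {U : measurableType d'} (f : T -> U)
  : set (set T) := preimage_set_system setT f measurable.

Definition sigma_process {d' : measure_display} {U : measurableType d'}
    (I : set R) (f : R -> T -> U) : set (set T) :=
  <<s \bigcup_(u in I) sigma_rv (f u) >>.

Definition independent (F1 F2 : set (set T)) : Prop :=
  forall A B, F1 A -> F2 B -> P (A `&` B) = (P A * P B)%E.

Definition mutually_independent {I : finType} (F : I -> set (set T)) : Prop :=
  forall (S : {set I}) (A : I -> set T), (forall i, i \in S -> F i (A i)) ->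
    P (\bigcap_(i in [set` S]) A i) = (\prod_(i in S) P (A i))%E.

Definition filtration (I : set R) (F : R -> set (set T)) : Prop :=
  (forall t, I t -> sigma_algebra setT (F t) /\ F t `<=` measurable) /\
  (forall s t, I s -> I t -> s <= t -> F s `<=` F t).

Definition right_continuous_filtration (I : set R) (F : R -> set (set T)) : Prop :=
  forall t, I t -> (exists2 s, I s & t < s) ->
    \bigcap_(s in [set s | I s /\ t < s]) F s = F t.

(* All subsets of P-null events, so that P itself is complete as soon as
   there is a complete filtration of measurable events. *)
Definition null_sets : set (set T) := [set N | P.-negligible N].

Definition complete_filtration (I : set R) (F : R -> set (set T)) : Prop :=
  forall t, I t -> null_sets `<=` F t.

(* Y is a version of the conditional expectation of X given the sub-sigma-algebra F. *)
Definition is_cond_expectation (F : set (set T)) (X Y : T -> R) : Prop :=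
  [/\ forall B, measurable B -> F (Y @^-1` B),
      P.-integrable setT (EFin \o Y) &
      forall A, F A -> (\int[P]_(w in A) (Y w)%:E = \int[P]_(w in A) (X w)%:E)%E].

End sigma_algebras.

Section gaussian.
Context {d : measure_display} {T : measurableType d} {R : realType}.
Variable P : probability T R.

(* The normal law with mean m and variance v; the case v = 0 is separate
   because normal_prob m 0 is not the Dirac mass. *)
Definition gaussian_law (m v : R) (B : set R) : \bar R :=
  if v == 0 then \d_m B else normal_prob m (Num.sqrt v) B.

Definition gaussian_process (I : set R) (b : R -> T -> R) : Prop :=
  forall (k : nat) (t a : 'I_k -> R), (forall j, I (t j)) ->
    exists m v : R, 0 <= v /\
      forall B, measurable B ->
        P ((fun w => \sum_(j < k) a j * b (t j) w) @^-1` B) = gaussian_law m v B.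

Definition brownian_bridge (b : R -> {RV P >-> R}) : Prop :=
  [/\ gaussian_process `[0, 1] b,
      forall t, 0 <= t <= 1 -> ('E_P[b t] = 0)%E,
      forall s t, 0 <= s <= 1 -> 0 <= t <= 1 ->
        covariance P (b s) (b t) = (Num.min s t - s * t)%:E &
      {ae P, forall w, {within `[0, 1], continuous (fun t => b t w)}}].

(* The conditional law of Z given H is N(M, V), M and V being H-measurable. *)
Definition cond_gaussian (H : set (set T)) (Z M V : T -> R) : Prop :=
  [/\ forall B, measurable B -> H (M @^-1` B),
      forall B, measurable B -> H (V @^-1` B),
      forall w, 0 <= V w &
      forall B, measurable B ->
        is_cond_expectation P H (\1_(Z @^-1` B))
          (fun w => fine (gaussian_law (M w) (V w) B))].

End gaussian.

Section modulated_information.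
Context {d : measure_display} {T : measurableType d} {R : realType}.
Variable P : probability T R.
Variable n : nat.

(* A random point field on [0,1]^n, as a random N-valued measure. *)
Definition point_field (zeta : R.-ker T ~> (n.-tuple R)) : Prop :=
  (forall w B, measurable B -> exists k : nat, zeta w B = k%:R%:E) /\
  (forall w, zeta w (~` [set p | forall i, 0 <= tnth p i <= 1]) = 0%E).

(* The i-th coordinate may switch at time u only if some point of the field has
   i-th coordinate u; as zeta w is finite, there are finitely many switches. *)
Definition modulator (zeta : R.-ker T ~> (n.-tuple R))
    (J : 'I_n -> R -> {RV P >-> bool}) : Prop :=
  forall w i, cadlag (fun u => J i u w) /\
    forall u, 0 < u <= 1 -> J i u w != left_limit (fun v => J i v w) u ->
      zeta w [set p | tnth p i = u] != 0%E.

Definition information (X : T -> R) (sigma : 'I_n -> R)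
    (beta : 'I_n -> R -> T -> R) (i : 'I_n) (t : R) (w : T) : R :=
  t * X w + sigma i * beta i t w.

Variables (X : T -> R) (J : 'I_n -> R -> T -> bool) (xi : 'I_n -> R -> T -> R).

Definition modulated_filtration (t : R) : set (set T) :=
  <<s (\bigcup_(i in [set: 'I_n])
         (sigma_process `[0, t] (fun u w => (J i u w)%:R * xi i u w) `|`
          sigma_process `[0, t] (J i)))
      `|` sigma_rv (fun w => X w * (t == 1)%:R)
      `|` null_sets P >>.

(* F_(t-), with F_(0-) = F_0. *)
Definition left_sigma (F : R -> set (set T)) (t : R) : set (set T) :=
  if 0 < t then <<s \bigcup_(s in `[0, t[) F s >> else F t.

Definition active (t : R) (w : T) : {set 'I_n} := [set i | J i t w]%SET.

Definition active_left (t : R) (w : T) : {set 'I_n} :=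
  [set i | left_limit (fun u => J i u w) t]%SET.

Definition activated (t : R) (w : T) : {set 'I_n} :=
  active t w :\: active_left t w.

(* sup set0 = 0 in the library, which the maximum with 0 absorbs. *)
Definition last_active (i : 'I_n) (t : R) (w : T) : R :=
  Num.max 0 (sup [set u | 0 <= u <= t /\ J i u w]).

Definition hfun (x y t s : R) : R :=
  expR ((x * y - t * x ^+ 2 / 2) / (s ^+ 2 * (1 - t))).

Variable sigma : 'I_n -> R.

Definition jump_Z (t : R) (w : T) : R :=
  \sum_(i in activated t w) xi i t w / (sigma i ^+ 2 * (1 - t)).

Definition jump_weight (t : R) (w : T) (z x : R) : R :=
  expR (x * z) *
  (\prod_(i | i \notin activated t w)
     hfun x (xi i (last_active i t w) w) (last_active i t w) (sigma i)) *
  (\prod_(i in activated t w)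
     expR (- t * x ^+ 2 / (2 * sigma i ^+ 2 * (1 - t)))).

Variables (nu : {measure set R -> \bar R}) (XX : set R).

Definition jump_num (t : R) (w : T) (z : R) : R :=
  \int[nu]_(x in XX) (x * jump_weight t w z x).

Definition jump_den (t : R) (w : T) (z : R) : R :=
  \int[nu]_(x in XX) jump_weight t w z x.

Definition jump_g (t : R) (w : T) (z : R) : R :=
  jump_num t w z / jump_den t w z.

Definition jump_g_defined (t : R) (w : T) (z : R) : Prop :=
  [/\ nu.-integrable XX (fun x => (x * jump_weight t w z x)%:E),
      nu.-integrable XX (fun x => (jump_weight t w z x)%:E) &
      0 < jump_den t w z].

(* The information given which Z is conditionally normal: X, F_(t-) and the
   set K_t of activated coordinates. *)
Definition pre_jump_sigma (t : R) : set (set T) :=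
  <<s left_sigma modulated_filtration t
      `|` sigma_rv X
      `|` [set A | exists i, A = [set w | i \in activated t w]] >>.

End modulated_information.

(* Main.v *)
Require Import Defs.
From mathcomp Require Import all_boot all_order all_algebra.
From mathcomp Require Import all_classical all_reals all_analysis.
From mathcomp Require Import measurable_realfun ring lra.
Import Order.TTheory GRing.Theory Num.Theory.
Import numFieldNormedType.Exports.
Local Open Scope classical_set_scope.
Local Open Scope ring_scope.
Set Implicit Arguments.
Unset Strict Implicit.
Unset Printing Implicit Defensive.

(** Conditionally on the modulator the problem is Gaussian. Let r_i be the latest
    time at which coordinate i was seen. Then
      S = \sum_i xi_i(r_i) / (sigma_i^2 (1 - r_i)) = c X + noise,
      c = \sum_i r_i / (sigma_i^2 (1 - r_i)),
    where the noise is N (0, c), and for u <= r_i the covariance of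
    sigma_i beta_i(u) with this noise is u, the coefficient of X in xi_i(u). So
    every combination of past observations is a multiple of S plus a Gaussian
    variable independent of (X, S): S is sufficient, and by Bayes' formula the
    conditional mean of X is the mean of x under the weight exp(x S - c x^2 / 2)
    [posterior_rectangles]. At a time t when some coordinates switch on, those
    have r_i = t, and splitting S and c into activated and other coordinates
    turns this weight into the one that defines g, taken at z = Z
    [jump_weightE].

    These statements are proved through Fourier transforms of weighted laws
    [fourier_uniqueness]. The only input about the bridges is that adding
    independent centred Gaussian noise of variance v to k X multiplies the
    Fourier transform by exp(- v / 2) [lincomb_cos].

    The modulator is independent of X and of the information, hence may be frozen
    as long as finitely many times are involved [mixture_cylinder]. Along finer
    and finer grids the latest active time on the grid converges to the true one,
    by right-continuity of the modulator, the information converges by continuity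
    of the bridges, and the posterior mean converges [posterior_cvg]. Dynkin's
    lemma then reaches all of F_t, and truncation reaches the unbounded variable X
    [cond_expectation_estimate]. For a fixed t this gives X_t = g(Z) almost
    surely. It holds for all t at once since it holds at rational times and both
    sides are right-continuous [estimate_all_times].

    For the law of Z, the value xi_i(t) of an activated coordinate is predicted by
    X and xi_i(r_i), where r_i < t is now the latest active time before t. The
    error is Gaussian and uncorrelated with X and with everything seen before t,
    and its variance is positive since r_i < t [jump_stat_rectangles]. Passing to
    the limit as above yields the conditional Fourier transform of Z, hence its
    conditional law [cond_gaussian_jump]. *)

(** * Bounded weights, Fubini and equality of weighted laws *)

Section bounded_functions.
Context {d : measure_display} {T : measurableType d} {R : realType}.
Implicit Types (f g Q : T -> R).

Definition bounded_measurable f :=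
  measurable_fun setT f /\ exists M : R, forall x, `|f x| <= M.

Lemma bounded_measurable_cst (c : R) : bounded_measurable (fun=> c).
Proof. by split; [exact: measurable_cst|exists `|c|]. Qed.

Lemma bounded_measurableD f g : bounded_measurable f -> bounded_measurable g ->
  bounded_measurable (fun x => f x + g x).
Proof.
move=> [mf [M hM]] [mg [N hN]]; split; first exact: measurable_funD.
by exists (M + N) => x; rewrite (le_trans (ler_normD _ _))// lerD.
Qed.

Lemma bounded_measurableM f g : bounded_measurable f -> bounded_measurable g ->
  bounded_measurable (fun x => f x * g x).
Proof.
move=> [mf [M hM]] [mg [N hN]]; split; first exact: measurable_funM.
by exists (M * N) => x; rewrite normrM ler_pM.
Qed.

Lemma bounded_measurableN f : bounded_measurable f ->
  bounded_measurable (fun x => - f x).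
Proof.
move=> [mf [M hM]]; split; first exact: measurable_funN.
by exists M => x; rewrite normrN.
Qed.

Lemma bounded_measurableB f g : bounded_measurable f -> bounded_measurable g ->
  bounded_measurable (fun x => f x - g x).
Proof.
by move=> hf hg; apply: bounded_measurableD => //; exact: bounded_measurableN.
Qed.

Lemma bounded_measurable_cos f : measurable_fun setT f ->
  bounded_measurable (fun x => cos (f x)).
Proof.
move=> mf; split.
  apply: (measurableT_comp _ mf).
  by apply: continuous_measurable_fun; exact: continuous_cos.
by exists 1 => x; rewrite ler_norml cos_geN1 cos_le1.
Qed.

Lemma bounded_measurable_sin f : measurable_fun setT f ->
  bounded_measurable (fun x => sin (f x)).
Proof.
move=> mf; split.
  apply: (measurableT_comp _ mf).
  by apply: continuous_measurable_fun; exact: continuous_sin.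
by exists 1 => x; rewrite ler_norml sin_geN1 sin_le1.
Qed.

Lemma normr_indic_le1 (A : set T) (x : T) : `|\1_A x : R| <= 1.
Proof. by rewrite indicE; case: (_ \in _); rewrite ?normr1 ?normr0. Qed.

Lemma bounded_measurable_indic (A : set T) : measurable A ->
  bounded_measurable (\1_A).
Proof.
move=> mA; split; first exact: measurable_indic.
by exists 1; exact: normr_indic_le1.
Qed.

Lemma bounded_measurable_expRN f : measurable_fun setT f -> (forall x, 0 <= f x) ->
  bounded_measurable (fun x => expR (- f x)).
Proof.
move=> mf f0; split; first by apply: measurableT_comp => //; exact: measurable_funN.
by exists 1 => x; rewrite gtr0_norm ?expR_gt0// -expR0 ler_expR oppr_le0.
Qed.

Lemma bounded_measurable_prod (I : Type) (s : seq I) (f : I -> T -> R) :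
  (forall i, bounded_measurable (f i)) ->
  bounded_measurable (fun x => \prod_(i <- s) f i x).
Proof.
move=> hf; elim: s => [|i s IH].
  under eq_fun do rewrite big_nil; exact: bounded_measurable_cst.
by under eq_fun do rewrite big_cons; exact: bounded_measurableM.
Qed.

Lemma integrable_mul_bounded (m : {measure set T -> \bar R}) Q f :
  m.-integrable setT (EFin \o Q) -> bounded_measurable f ->
  m.-integrable setT (EFin \o (fun x => Q x * f x)).
Proof.
move=> iQ [mf [M hM]].
have bf : [bounded f x | x in setT].
  exists M; split; first exact: num_real.
  by move=> N MN x _ /=; rewrite (le_trans (hM x))// ltW.
by have := @integrableMl _ _ _ _ _ measurableT _ _ iQ mf bf.
Qed.

Lemma bounded_integrable (m : {finite_measure set T -> \bar R}) f :
  bounded_measurable f -> m.-integrable setT (EFin \o f).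
Proof.
move=> hf; have := @integrable_mul_bounded m (fun=> 1) f _ hf.
rewrite (_ : (fun x => 1 * f x) = f); last by apply/funext => x; rewrite mul1r.
by apply; exact: finite_measure_integrable_cst.
Qed.

Section integrable_EFin.
Variables (m : {measure set T -> \bar R}) (f g : T -> R) (c : R).
Hypotheses (hf : m.-integrable setT (EFin \o f))
  (hg : m.-integrable setT (EFin \o g)).

Lemma integrable_EFin_measurable : measurable_fun setT f.
Proof. by apply/measurable_EFinP; case/integrableP: hf. Qed.

Lemma integrable_EFinD : m.-integrable setT (EFin \o (fun x => f x + g x)).
Proof. exact: (integrableD measurableT hf hg). Qed.

Lemma integrable_EFinB : m.-integrable setT (EFin \o (fun x => f x - g x)).
Proof. exact: (integrableB measurableT hf hg). Qed.

Lemma integrable_EFinZ : m.-integrable setT (EFin \o (fun x => c * f x)).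
Proof. exact: (integrableZl measurableT c hf). Qed.

Lemma Rintegral_indic (A : set T) : measurable A ->
  \int[m]_x \1_A x = fine (m A).
Proof. by move=> mA; rewrite /Rintegral integral_indic// setIT. Qed.

End integrable_EFin.

Lemma dominated_cvg_Rintegral (m : {measure set T -> \bar R})
    (f_ : nat -> T -> R) f g :
  (forall n, measurable_fun setT (f_ n)) -> measurable_fun setT f ->
  {ae m, forall x, f_ ^~ x @ \oo --> f x} ->
  m.-integrable setT (EFin \o g) -> (forall n x, `|f_ n x| <= g x) ->
  m.-integrable setT (EFin \o f) /\
  \int[m]_x f_ n x @[n --> \oo] --> \int[m]_x f x.
Proof.
move=> mf_ mf cf ig fg.
have [] := @dominated_convergence _ _ _ m setT measurableT
  (fun n => EFin \o f_ n) (EFin \o f) (EFin \o g) _ _ _ ig _.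
- by move=> n; exact/measurable_EFinP.
- exact/measurable_EFinP.
- apply: filterS cf => x cx _; apply: cvg_EFin => //; exact: nearW.
- by apply: aeW => x n _; rewrite /= lee_fin.
move=> iif _ cvi; split => //.
rewrite /Rintegral; apply: fine_cvg; rewrite fineK//.
exact: (@integrable_fin_num _ _ _ _ _ measurableT).
Qed.

(** Dominated convergence in the form used throughout: a fixed integrable weight
    against uniformly bounded functions converging almost everywhere. *)
Lemma weighted_bounded_cvg (m : {measure set T -> \bar R}) Q
    (f_ : nat -> T -> R) f (M : R) :
  m.-integrable setT (EFin \o Q) ->
  (forall n, measurable_fun setT (f_ n)) -> measurable_fun setT f ->
  (forall n x, `|f_ n x| <= M) ->
  {ae m, forall x, f_ ^~ x @ \oo --> f x} ->
  \int[m]_x (Q x * f_ n x) @[n --> \oo] --> \int[m]_x (Q x * f x).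
Proof.
move=> iQ mf_ mf fM cf.
have mQ : measurable_fun setT Q by apply/measurable_EFinP; case/integrableP: iQ.
apply: (proj2 (@dominated_cvg_Rintegral m (fun n x => Q x * f_ n x)
  (fun x => Q x * f x) (fun x => M * `|Q x|) _ _ _ _ _)).
- by move=> n; exact: measurable_funM.
- exact: measurable_funM.
- by apply: filterS cf => x cx; apply: cvgMl_tmp.
- exact: (integrableZl measurableT M (integrable_norm iQ)).
- by move=> n x; rewrite normrM mulrC ler_wpM2r.
Qed.

Lemma eq_Rintegral_fun (m : {measure set T -> \bar R}) f g :
  (forall x, f x = g x) -> \int[m]_x f x = \int[m]_x g x.
Proof. by move=> fg; congr Rintegral; apply/funext. Qed.

Lemma Rintegral_mul_indic (m : {measure set T -> \bar R}) f (A : set T) :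
  \int[m]_x (f x * \1_A x) = \int[m]_(x in A) f x.
Proof.
rewrite [RHS]Rintegral_mkcond; apply: eq_Rintegral_fun => x.
by rewrite patchE indicE; case: (_ \in _); rewrite ?mulr1 ?mulr0.
Qed.

Lemma Rintegral_eq0_ae (m : {measure set T -> \bar R}) f :
  m.-integrable setT (EFin \o f) -> (forall x, 0 <= f x) -> \int[m]_x f x = 0 ->
  {ae m, forall x, f x = 0}.
Proof.
move=> intf f0 z; have fin := integrable_fin_num measurableT intf.
have : (\int[m]_x `|(f x)%:E| = 0)%E.
  rewrite (eq_integral (fun x => (f x)%:E)); last first.
    by move=> x _; rewrite gee0_abs// lee_fin.
  by rewrite -(fineK fin); congr EFin; exact: z.
move/(ae_eq_integral_abs m measurableT (measurable_int m intf)).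
by apply: filterS => x /(_ I) [].
Qed.

Lemma Rintegral_sum_seq (m : {measure set T -> \bar R}) (I : Type) (s : seq I)
    (f : I -> T -> R) : (forall i, m.-integrable setT (EFin \o f i)) ->
  m.-integrable setT (EFin \o (fun x => \sum_(i <- s) f i x)) /\
  \int[m]_x (\sum_(i <- s) f i x) = \sum_(i <- s) \int[m]_x f i x.
Proof.
move=> hf; elim: s => [|i s [IH1 IH2]].
  split.
    rewrite (_ : _ \o _ = cst 0%E); first exact: integrable0.
    by apply/funext => x /=; rewrite big_nil.
  by rewrite big_nil; under eq_Rintegral_fun do rewrite big_nil; rewrite Rintegral_cst// mul0r.
split.
  rewrite (_ : _ \o _ = (fun x => (f i x)%:E + (\sum_(j <- s) f j x)%R%:E)%E).
    exact: (integrableD measurableT (hf i) IH1).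
  by apply/funext => x /=; rewrite big_cons EFinD.
by rewrite big_cons -IH2 -RintegralD//; apply: eq_Rintegral_fun => x; rewrite big_cons.
Qed.

End bounded_functions.

Lemma measurable_funV {d : measure_display} {T : measurableType d} {R : realType}
  (f : T -> R) : measurable_fun setT f -> measurable_fun setT (fun x => (f x)^-1).
Proof.
move=> mf.
rewrite (_ : (fun x => _) = fun x => if f x == 0 then 0 else
  if 0 < f x then expR (- ln (f x)) else - expR (- ln (- f x))).
  apply: measurable_fun_ifT => //; first exact: measurable_fun_eqr.
  apply: measurable_fun_ifT => //; first exact: measurable_fun_ltr.
    apply: measurableT_comp => //; apply: measurable_funN.
    exact: measurableT_comp (@measurable_ln R) mf.
  apply: measurable_funN; apply: measurableT_comp => //; apply: measurable_funN.
  exact: measurableT_comp (@measurable_ln R) (measurable_funN mf).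
apply/funext => x; case: eqP => [->|/eqP f0]; first by rewrite invr0.
case: ifPn => [fp|]; first by rewrite expRN lnK.
rewrite -leNgt => fle; have fn : f x < 0 by rewrite lt_neqAle f0.
by rewrite expRN lnK ?posrE ?oppr_gt0// invrN opprK.
Qed.

Lemma bounded_measurable_comp {d d' : measure_display} {T : measurableType d}
    {U : measurableType d'} {R : realType} (V : U -> T) (f : T -> R) :
  measurable_fun setT V -> bounded_measurable f ->
  bounded_measurable (fun x => f (V x)).
Proof.
move=> mV [mf [M hM]]; split; first exact: measurableT_comp mf mV.
by exists M.
Qed.

Lemma measurable_Rintegral_section {d1 d2 : measure_display}
    {T1 : measurableType d1} {T2 : measurableType d2} {R : realType}
    (m : {sigma_finite_measure set T2 -> \bar R}) (F : T1 * T2 -> R) :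
  measurable_fun setT F -> measurable_fun setT (fun x => \int[m]_y F (x, y)).
Proof.
move=> mF; apply: (@measurableT_comp _ _ _ _ _ _ fine _ (fun x => \int[m]_y (F (x, y))%:E)%E) => //.
rewrite (_ : (fun x => _) = (fun x => fubini_F m (fun z => maxe (F z)%:E 0) x -
  fubini_F m (fun z => maxe (- (F z)%:E) 0) x)%E); last first.
  apply/funext => x; rewrite integralE /fubini_F funepos.unlock funeneg.unlock.
  by [].
have mEF : measurable_fun setT (fun z => (F z)%:E) by exact/measurable_EFinP.
apply: emeasurable_funB; apply: measurable_fun_fubini_tonelli_F.
- exact: measurable_maxe.
- by move=> z; rewrite le_max lexx orbT.
- by apply: measurable_maxe => //; exact: measurableT_comp.
- by move=> z; rewrite le_max lexx orbT.
Qed.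

Section fubini_real.
Context {d1 d2 : measure_display} {T1 : measurableType d1}
  {T2 : measurableType d2} {R : realType}.
Variables (m1 : {sigma_finite_measure set T1 -> \bar R})
  (m2 : {sigma_finite_measure set T2 -> \bar R}).

Lemma Rintegral_fubini (F : T1 * T2 -> R) :
  measurable_fun setT F ->
  (forall x, m2.-integrable setT (EFin \o (fun y => F (x, y)))) ->
  (forall y, m1.-integrable setT (EFin \o (fun x => F (x, y)))) ->
  (\int[m1]_x \int[m2]_y `|(F (x, y))%:E| < +oo)%E ->
  \int[m1]_x \int[m2]_y F (x, y) = \int[m2]_y \int[m1]_x F (x, y).
Proof.
move=> mF i2 i1 ltF.
have iF : (m1 \x m2)%E.-integrable setT (EFin \o F).
  by apply/integrable12ltyP => //; exact/measurable_EFinP.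
have := Fubini iF; rewrite /Rintegral => eqF; congr fine.
rewrite (eq_integral (fun x => \int[m2]_y (EFin \o F) (x, y))%E); last first.
  move=> x _; rewrite fineK//.
  exact: (@integrable_fin_num _ _ _ _ _ measurableT _ (i2 x)).
rewrite eqF; apply: eq_integral => y _; rewrite fineK//.
exact: (@integrable_fin_num _ _ _ _ _ measurableT _ (i1 y)).
Qed.

Lemma Rintegral_fubini_bounded (Q : T1 -> R) (p : T2 -> R) (phi : T1 * T2 -> R) :
  m1.-integrable setT (EFin \o Q) -> m2.-integrable setT (EFin \o p) ->
  bounded_measurable phi ->
  \int[m1]_x (Q x * \int[m2]_y (p y * phi (x, y))) =
  \int[m2]_y (p y * \int[m1]_x (Q x * phi (x, y))).
Proof.
move=> iQ ip [mphi [M hM]].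
have mQ : measurable_fun setT Q by apply/measurable_EFinP; case/integrableP: iQ.
have mp : measurable_fun setT p by apply/measurable_EFinP; case/integrableP: ip.
have b1 x : bounded_measurable (fun y => phi (x, y)).
  by apply: bounded_measurable_comp; [exact: measurable_pair1|split => //; exists M].
have b2 y : bounded_measurable (fun x => phi (x, y)).
  by apply: bounded_measurable_comp; [exact: measurable_pair2|split => //; exists M].
have i1 x := integrable_mul_bounded ip (b1 x).
have i2 y := integrable_mul_bounded iQ (b2 y).
transitivity (\int[m1]_x \int[m2]_y (Q x * (p y * phi (x, y)))).
  by apply: eq_Rintegral_fun => x; rewrite RintegralZl.
rewrite (@Rintegral_fubini (fun z => Q z.1 * (p z.2 * phi z))).
- apply: eq_Rintegral_fun => y; rewrite -RintegralZl//.
  by apply: eq_Rintegral_fun => x /=; rewrite mulrCA.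
- apply: measurable_funM; first exact: measurableT_comp mQ measurable_fst.
  by apply: measurable_funM => //; exact: measurableT_comp mp measurable_snd.
- move=> x /=.
  rewrite (_ : _ \o _ = (fun y => ((Q x)%:E * (p y * phi (x, y))%:E)%E)) //.
  exact: (integrableZl measurableT (Q x) (i1 x)).
- move=> y /=.
  rewrite (_ : _ \o _ = (fun x => ((p y)%:E * (Q x * phi (x, y))%:E)%E)).
    exact: (integrableZl measurableT (p y) (i2 y)).
  by apply/funext => x /=; rewrite mulrCA.
- apply: (@le_lt_trans _ _ (\int[m1]_x (`|Q x|%:E * (`|M|%:E * \int[m2]_y `|p y|%:E)))%E).
    apply: ge0_le_integral => //=.
    + by move=> x _; exact: integral_ge0.
    + apply: (@measurable_fun_fubini_tonelli_F _ _ _ _ _ m2 (fun z => `|(Q z.1 * (p z.2 * phi z))%:E|%E)) => //.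
      apply/measurableT_comp => //; apply/measurable_EFinP/measurable_funM.
        exact: measurableT_comp mQ measurable_fst.
      by apply: measurable_funM => //; exact: measurableT_comp mp measurable_snd.
    + apply: emeasurable_funM => //; apply/measurable_EFinP; exact: measurableT_comp.
    + move=> x _; rewrite -ge0_integralZl//; last first.
        by apply/measurable_EFinP; exact: measurableT_comp.
      rewrite -ge0_integralZl//; last first.
        by apply: emeasurable_funM => //; apply/measurable_EFinP; exact: measurableT_comp.
      apply: ge0_le_integral => //=.
      * apply/measurable_EFinP; apply: measurableT_comp => //.
        apply: measurable_funM => //; apply: measurable_funM => //.
        exact: (b1 x).1.
      * apply/measurable_EFinP/measurable_funM => //; apply: measurable_funM => //; exact: measurableT_comp.
      * move=> y _; rewrite lee_fin !normrM ler_wpM2l// mulrC ler_wpM2r//.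
        by rewrite (le_trans (hM _))// ler_norm.
  have [/integrableP[_ fQ] /integrableP[_ fp]] := (iQ, ip).
  rewrite ge0_integralZr//.
  + apply: lte_mul_pinfty => //; first exact: integral_ge0.
      rewrite ge0_fin_numE//; exact: integral_ge0.
    apply: lte_mul_pinfty => //.
  + by apply/measurable_EFinP; exact: measurableT_comp.
  + by rewrite mule_ge0//; exact: integral_ge0.
Qed.

End fubini_real.

(** The signed image laws of V1 under Q1 . m1 and of V2 under Q2 . m2. Allowing
    the weights to be signed lets conditional statements, where Q is an indicator
    or a difference of two estimates, be treated like equalities of laws. *)
Section two_laws.
Context {d1 d2 d3 : measure_display} {T1 : measurableType d1}
  {T2 : measurableType d2} {U : measurableType d3} {R : realType}.
Variables (m1 : {sigma_finite_measure set T1 -> \bar R})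
  (m2 : {sigma_finite_measure set T2 -> \bar R}).
Variables (V1 : T1 -> U) (V2 : T2 -> U) (Q1 : T1 -> R) (Q2 : T2 -> R).
Hypotheses (mV1 : measurable_fun setT V1) (mV2 : measurable_fun setT V2)
  (iQ1 : m1.-integrable setT (EFin \o Q1))
  (iQ2 : m2.-integrable setT (EFin \o Q2)).

Let good (B : set U) := measurable B /\
  \int[m1]_x (Q1 x * \1_B (V1 x)) = \int[m2]_x (Q2 x * \1_B (V2 x)).

Lemma weighted_laws_eq_dynkin (C : set (set U)) :
  setI_closed C -> C `<=` measurable ->
  \int[m1]_x Q1 x = \int[m2]_x Q2 x ->
  (forall B, C B ->
    \int[m1]_x (Q1 x * \1_B (V1 x)) = \int[m2]_x (Q2 x * \1_B (V2 x))) ->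
  forall B, <<s C >> B ->
    \int[m1]_x (Q1 x * \1_B (V1 x)) = \int[m2]_x (Q2 x * \1_B (V2 x)).
Proof.
move=> CI Cm eqQ eqC.
have b1 B : measurable B -> bounded_measurable (fun x => \1_B (V1 x) : R).
  by move=> mB; apply: bounded_measurable_comp => //; exact: bounded_measurable_indic.
have b2 B : measurable B -> bounded_measurable (fun x => \1_B (V2 x) : R).
  by move=> mB; apply: bounded_measurable_comp => //; exact: bounded_measurable_indic.
have i1 B (mB : measurable B) := integrable_mul_bounded iQ1 (b1 _ mB).
have i2 B (mB : measurable B) := integrable_mul_bounded iQ2 (b2 _ mB).
suff : <<d C >> `<=` good.
  by rewrite setI_closed_g_dynkin_g_sigma_algebra// => h B /h [].
apply: smallest_sub; last by move=> B CB; split; [exact: Cm|exact: eqC].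
split.
- split => //; under eq_Rintegral_fun do rewrite indicE in_setT mulr1.
  by rewrite eqQ; apply: eq_Rintegral_fun => x; rewrite indicE in_setT mulr1.
- move=> B [mB eqB]; split; first exact: measurableC.
  have e1 (x : T1) : Q1 x * \1_(~` B) (V1 x) = Q1 x - Q1 x * \1_B (V1 x).
    by rewrite !indicE in_setC; case: (_ \in _); rewrite /= ?mulr0 ?mulr1 ?subrr ?subr0.
  have e2 (x : T2) : Q2 x * \1_(~` B) (V2 x) = Q2 x - Q2 x * \1_B (V2 x).
    by rewrite !indicE in_setC; case: (_ \in _); rewrite /= ?mulr0 ?mulr1 ?subrr ?subr0.
  rewrite (eq_Rintegral_fun _ e1) (eq_Rintegral_fun _ e2).
  by rewrite !RintegralB ?eqQ ?eqB//; [exact: i2|exact: i1].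
- move=> F tF gF; have mF n : measurable (F n) by case: (gF n).
  split; first exact: bigcup_measurable.
  have mu n : measurable (\big[setU/set0]_(i < n) F i) by exact: bigsetU_measurable.
  have cvF (x : U) : \1_(\big[setU/set0]_(i < n) F i) x @[n --> \oo] --> (\1_(\bigcup_n F n) x : R).
    have [[k _ Fk]|nF] := pselect ((\bigcup_n F n) x).
      apply: cvg_near_cst; near=> n; rewrite !indicE !mem_set//; first by exists k.
      by rewrite -bigcup_mkord; exists k => //=; near: n; exact: nbhs_infty_gt.
    apply: cvg_near_cst; apply: nearW => n; rewrite !indicE !memNset//.
    by rewrite -bigcup_mkord => -[k _ Fk]; apply: nF; exists k.
  have eqn n : \int[m1]_x (Q1 x * \1_(\big[setU/set0]_(i < n) F i) (V1 x)) =
      \int[m2]_x (Q2 x * \1_(\big[setU/set0]_(i < n) F i) (V2 x)).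
    elim: n => [|n IH].
      under eq_Rintegral_fun do rewrite big_ord0 indic0 mulr0.
      rewrite Rintegral_cst// mul0r.
      under eq_Rintegral_fun do rewrite big_ord0 indic0 mulr0.
      by rewrite Rintegral_cst// mul0r.
    have e (x : U) : \1_(\big[setU/set0]_(i < n.+1) F i) x =
        \1_(\big[setU/set0]_(i < n) F i) x + \1_(F n) x :> R.
      rewrite big_ord_recr/= !indicE in_setU.
      have [xn|xn] := boolP (x \in F n); last by rewrite orbF addr0.
      rewrite orbT memNset ?add0r//; rewrite -bigcup_mkord => -[k /= kn Fk].
      have := tF k n I I (ex_intro _ x (conj Fk (set_mem xn))).
      by move=> E; rewrite E ltnn in kn.
    under eq_Rintegral_fun do rewrite e mulrDr.
    rewrite RintegralD//; [|exact: i1|exact: i1].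
    under [RHS]eq_Rintegral_fun do rewrite e mulrDr.
    rewrite RintegralD//; [|exact: i2|exact: i2].
    by rewrite IH; case: (gF n) => _ ->.
  have c1 := @weighted_bounded_cvg _ _ _ m1 Q1
    (fun n x => \1_(\big[setU/set0]_(i < n) F i) (V1 x))
    (fun x => \1_(\bigcup_n F n) (V1 x)) 1 iQ1 (fun n => (b1 _ (mu n)).1)
    (b1 _ (bigcup_measurable (fun k _ => mF k))).1 (fun n x => normr_indic_le1 _ (V1 x))
    (aeW _ (fun x => cvF (V1 x))).
  have c2 := @weighted_bounded_cvg _ _ _ m2 Q2
    (fun n x => \1_(\big[setU/set0]_(i < n) F i) (V2 x))
    (fun x => \1_(\bigcup_n F n) (V2 x)) 1 iQ2 (fun n => (b2 _ (mu n)).1)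
    (b2 _ (bigcup_measurable (fun k _ => mF k))).1 (fun n x => normr_indic_le1 _ (V2 x))
    (aeW _ (fun x => cvF (V2 x))).
  apply: (cvg_unique _ c1) => //.
  by rewrite (_ : (fun n => _) = (fun n => \int[m2]_x (Q2 x * \1_(\big[setU/set0]_(i < n) F i) (V2 x))))//; apply/funext => n.
Unshelve. all: by end_near. Qed.

(** Layer cake: a function with values in [0, 1] is the integral over u in [0, 1]
    of the indicators of its superlevel sets, and Fubini applies. *)
Lemma weighted_laws_eq_bounded :
  (forall B, measurable B ->
    \int[m1]_x (Q1 x * \1_B (V1 x)) = \int[m2]_x (Q2 x * \1_B (V2 x))) ->
  forall phi : U -> R, bounded_measurable phi ->
    \int[m1]_x (Q1 x * phi (V1 x)) = \int[m2]_x (Q2 x * phi (V2 x)).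
Proof.
move=> eqB phi bphi; have [mphi [M0 hM0]] := bphi.
pose M := `|M0| + 1; have M_gt0 : 0 < M by rewrite ltr_wpDl.
have hM x : `|phi x| <= M.
  by rewrite (le_trans (hM0 x))// (le_trans (ler_norm _))// lerDl.
pose chi x := (phi x + M) / (M + M).
have chi01 x : 0 <= chi x <= 1.
  have := hM x; rewrite ler_norml => /andP[h1 h2].
  by rewrite divr_ge0 ?ler_pdivrMr ?mul1r ?lerD2r//; lra.
have mchi : measurable_fun setT chi.
  by apply: measurable_funM => //; exact: measurable_funD.
have phiE x : phi x = (M + M) * chi x - M.
  by rewrite /chi mulrC divfK ?addrK// gt_eqF// addr_gt0.
pose p : R -> R := \1_`[0, 1].
have ip : (@lebesgue_measure R).-integrable setT (EFin \o p).
  exact: integrable_indic_itv.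
have layer (c : R) : 0 <= c <= 1 ->
    \int[@lebesgue_measure R]_u (p u * (u < c)%R%:R) = c.
  move=> /andP[c0 c1].
  transitivity (\int[@lebesgue_measure R]_u \1_`[0, c[ u).
    apply: eq_Rintegral_fun => u; rewrite /p !indicE.
    rewrite !mem_setE !in_itv/=; case: (ltP u c) => uc; last by rewrite andbF mulr0.
    by rewrite (le_trans (ltW uc) c1) !andbT mulr1.
  rewrite Rintegral_indic//.
  rewrite [X in fine X]lebesgue_measure_itv/= lte_fin.
  move: c0; rewrite le_eqVlt => /predU1P[<-|->]; first by rewrite ltxx.
  by rewrite /= subr0.
have mu1 d (T : measurableType d) (V : T -> U) : measurable_fun setT V ->
    bounded_measurable (fun z : T * R => (z.2 < chi (V z.1))%R%:R : R).
  move=> mV; split; last by exists 1 => z; case: (_ < _); rewrite ?normr1 ?normr0.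
  rewrite (_ : (fun _ => _) = (fun z : T * R => if z.2 < chi (V z.1) then 1 else 0)).
    apply: measurable_fun_ifT => //; apply: measurable_fun_ltr => //.
    by apply: measurableT_comp mchi _; exact: measurableT_comp mV measurable_fst.
  by apply/funext => z; case: (_ < _).
have eqchi : \int[m1]_x (Q1 x * chi (V1 x)) = \int[m2]_x (Q2 x * chi (V2 x)).
  under eq_Rintegral_fun do rewrite -[chi _]layer//.
  under [RHS]eq_Rintegral_fun do rewrite -[chi _]layer//.
  rewrite (Rintegral_fubini_bounded iQ1 ip (mu1 _ _ _ mV1)).
  rewrite (Rintegral_fubini_bounded iQ2 ip (mu1 _ _ _ mV2)).
  apply: eq_Rintegral_fun => u; congr *%R.
  have /eqB : measurable [set v | u < chi v].
    rewrite -[X in measurable X]setTI.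
    have : measurable_fun setT (fun v => u < chi v) by exact: measurable_fun_ltr.
    by move=> /(_ measurableT [set true]); exact.
  have e v : \1_[set v | u < chi v] v = (u < chi v)%R%:R :> R.
    by rewrite indicE; congr (nat_of_bool _)%:R; apply/idP/idP; rewrite inE.
  under eq_Rintegral_fun do rewrite e.
  by move=> ->; under eq_Rintegral_fun do rewrite e.
have bchi : bounded_measurable chi.
  by split => //; exists 1 => x; rewrite ger0_norm; case/andP: (chi01 x).
have i1 := integrable_mul_bounded iQ1 (bounded_measurable_comp mV1 bchi).
have i2 := integrable_mul_bounded iQ2 (bounded_measurable_comp mV2 bchi).
have e1 (x : T1) : Q1 x * phi (V1 x) = (M + M) * (Q1 x * chi (V1 x)) - M * Q1 x.
  by rewrite phiE; ring.
have e2 (x : T2) : Q2 x * phi (V2 x) = (M + M) * (Q2 x * chi (V2 x)) - M * Q2 x.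
  by rewrite phiE; ring.
rewrite (eq_Rintegral_fun _ e1) (eq_Rintegral_fun _ e2).
have eqQ : \int[m1]_x Q1 x = \int[m2]_x Q2 x.
  have := eqB setT measurableT.
  under eq_Rintegral_fun do rewrite indicE in_setT mulr1.
  by move=> ->; apply: eq_Rintegral_fun => x; rewrite indicE in_setT mulr1.
rewrite !RintegralB ?RintegralZl ?eqchi ?eqQ//.
- exact: (integrableZl measurableT (M + M) i2).
- exact: (integrableZl measurableT M iQ2).
- exact: (integrableZl measurableT (M + M) i1).
- exact: (integrableZl measurableT M iQ1).
Qed.

(** Truncation on the sets where phi is bounded, and dominated convergence. *)
Lemma weighted_laws_eq_integrable (phi : U -> R) :
  (forall B, measurable B ->
    \int[m1]_x (Q1 x * \1_B (V1 x)) = \int[m2]_x (Q2 x * \1_B (V2 x))) ->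
  measurable_fun setT phi ->
  m1.-integrable setT (EFin \o (fun x => Q1 x * phi (V1 x))) ->
  m2.-integrable setT (EFin \o (fun x => Q2 x * phi (V2 x))) ->
  \int[m1]_x (Q1 x * phi (V1 x)) = \int[m2]_x (Q2 x * phi (V2 x)).
Proof.
move=> eqB mphi i1 i2.
pose A n : set U := [set v | `|phi v| <= n%:R].
have mA n : measurable (A n).
  have : measurable_fun setT (fun v => `|phi v| <= n%:R).
    by apply: measurable_fun_ler => //; exact: measurableT_comp.
  by move=> /(_ measurableT [set true]); rewrite setTI; exact.
pose f n v := phi v * \1_(A n) v.
have bf n : bounded_measurable (f n).
  split; first by apply: measurable_funM => //; exact: measurable_indic.
  exists n%:R => v; rewrite /f indicE.
  have [/set_mem vA|_] := boolP (v \in A n); first by rewrite mulr1.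
  by rewrite mulr0 normr0.
have cvA v : \1_(A n) v @[n --> \oo] --> (1 : R).
  apply: cvg_near_cst; near=> n; rewrite indicE mem_set//= /A/=.
  by near: n; exact: nbhs_infty_ger.
have b1 n : bounded_measurable (fun x => \1_(A n) (V1 x) : R).
  by apply: bounded_measurable_comp => //; exact: bounded_measurable_indic.
have b2 n : bounded_measurable (fun x => \1_(A n) (V2 x) : R).
  by apply: bounded_measurable_comp => //; exact: bounded_measurable_indic.
have c1 := weighted_bounded_cvg i1 (fun n => (b1 n).1) (measurable_cst (1 : R))
  (fun n x => normr_indic_le1 _ (V1 x)) (aeW _ (fun x => cvA (V1 x))).
have c2 := weighted_bounded_cvg i2 (fun n => (b2 n).1) (measurable_cst (1 : R))
  (fun n x => normr_indic_le1 _ (V2 x)) (aeW _ (fun x => cvA (V2 x))).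
transitivity (\int[m1]_x (Q1 x * phi (V1 x) * 1)).
  by apply: eq_Rintegral_fun => x; rewrite mulr1.
transitivity (\int[m2]_x (Q2 x * phi (V2 x) * 1)); last first.
  by apply: eq_Rintegral_fun => x; rewrite mulr1.
apply: (cvg_unique _ c1) => //.
rewrite (_ : (fun n => _) = (fun n => \int[m2]_x (Q2 x * phi (V2 x) * \1_(A n) (V2 x))))//.
apply/funext => n; have := weighted_laws_eq_bounded eqB (bf n).
rewrite /f; under eq_Rintegral_fun do rewrite mulrA.
by move=> ->; apply: eq_Rintegral_fun => x; rewrite mulrA.
Unshelve. all: by end_near. Qed.

End two_laws.

(** * Gaussian integrals *)

Section gaussian_integrals.
Context {R : realType}.
Local Notation leb := (@lebesgue_measure R).

(** Fundamental theorem of calculus on [-n, n]; the decay of F kills the boundary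
    terms. *)
Lemma Rintegral_derivative_eq0 (F f : R -> R) (C : R) :
  (forall x, is_derive (x : R) (1 : R) F (f x)) -> continuous f ->
  leb.-integrable setT (EFin \o f) ->
  (forall x, `|x| * `|F x| <= C) ->
  \int[leb]_x f x = 0.
Proof.
move=> dF cf intf FC.
have C0 : 0 <= C by rewrite (le_trans _ (FC 0))// normr0 mul0r.
have cF x : {for x, continuous F}.
  by apply: differentiable_continuous; apply/derivable1_diffP; case: (dF x).
have c1 := @weighted_bounded_cvg _ _ _ leb f
  (fun n x => \1_`[- (n.+1%:R : R), n.+1%:R] x) (fun=> 1) 1 intf
  (fun n => measurable_indic (measurable_itv _)) (measurable_cst _)
  (fun n x => normr_indic_le1 _ x).
have {c1}c1 : \int[leb]_x (f x * \1_`[- (n.+1%:R : R), n.+1%:R] x) @[n --> \oo] --> \int[leb]_x f x.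
  have -> : \int[leb]_x f x = \int[leb]_x (f x * 1).
    by apply: eq_Rintegral_fun => x; rewrite mulr1.
  apply: c1; apply: aeW => x; apply: cvg_near_cst.
  near=> n; rewrite indicE mem_set//= in_itv/= -ler_norml.
  rewrite (@le_trans _ _ n%:R) ?ler_nat//.
  by near: n; exact: nbhs_infty_ger.
have e n : \int[leb]_x (f x * \1_`[- (n.+1%:R : R), n.+1%:R] x) = F n.+1%:R - F (- n.+1%:R).
  rewrite Rintegral_mul_indic /Rintegral (@continuous_FTC2 _ f F)//.
  - by rewrite gtrN// ltr0n.
  - exact: continuous_subspaceT.
  - split.
    + by move=> x _; case: (dF x).
    + exact: cvg_at_right_filter (cF _).
    + exact: cvg_at_left_filter (cF _).
  - by move=> x _; rewrite derive1E; case: (dF x).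
have c2 : F n.+1%:R - F (- n.+1%:R) @[n --> \oo] --> (0 : R).
  apply/norm_cvg0P; apply: (@squeeze_cvgr _ _ _ _ (fun=> 0) (fun n => (C + C) * n.+1%:R^-1)).
  - near=> n; have n0 : 0 < n.+1%:R :> R by [].
    rewrite normr_ge0/= ler_pdivlMr// (le_trans (ler_wpM2r (ltW n0) (ler_normB _ _)))//.
    rewrite mulrDl lerD//.
      by have := FC n.+1%:R; rewrite ger0_norm ?(ltW n0)// mulrC.
    by have := FC (- n.+1%:R); rewrite normrN (ger0_norm (ltW n0)) mulrC.
  - exact: cvg_cst.
  - rewrite -[X in _ --> X](mulr0 (C + C)); apply: cvgMl_tmp.
    exact: cvg_harmonic.
apply: (cvg_unique _ c1) => //.
by rewrite (_ : (fun n => _) = (fun n => F n.+1%:R - F (- n.+1%:R)))//; apply/funext.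
Unshelve. all: by end_near. Qed.

Lemma expR_quadratic_lb (y v : R) : 0 <= y -> 0 < v ->
  1 + y <= (1 + v) * expR (y / v).
Proof.
move=> y0 v0; apply: (@le_trans _ _ ((1 + v) * (1 + y / v))).
  have -> : (1 + v) * (1 + y / v) = 1 + v + y / v + y by field; rewrite gt_eqF.
  by have : 0 <= y / v by [rewrite divr_ge0// ltW]; lra.
by rewrite ler_wpM2l ?expR_ge1Dx// addr_ge0// ltW.
Qed.

Section normal_density.
Variables (m s : R).
Hypothesis s0 : 0 < s.
Local Notation pdf := (normal_pdf m s).

Let s_neq0 : s != 0. Proof. by rewrite gt_eqF. Qed.

Lemma normal_pdf_expR x :
  pdf x = normal_peak s * expR (- (x - m) ^+ 2 / (s ^+ 2 *+ 2)).
Proof. by rewrite normal_pdfE. Qed.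

Lemma is_derive_normal_pdf (x : R) :
  is_derive (x : R) (1 : R) pdf (- ((x - m) / s ^+ 2) * pdf x).
Proof.
rewrite normal_pdfE// /normal_fun.
apply: is_derive_eq.
rewrite /GRing.scale/= -[s ^+ 2 *+ 2]mulr_natr; move: (expR _) (normal_peak s) => e p.
by field.
Qed.

Lemma normal_pdf_quadratic_ub : exists C, forall x,
  (1 + (x - m) ^+ 2) * pdf x <= C.
Proof.
exists (normal_peak s * (1 + s ^+ 2 *+ 2)) => x.
rewrite normal_pdf_expR mulrCA ler_wpM2l ?normal_peak_ge0//.
set y := (x - m) ^+ 2; set v := s ^+ 2 *+ 2.
have v0 : 0 < v by rewrite pmulrn_lgt0// exprn_gt0.
have y0 : 0 <= y by exact: sqr_ge0.
by rewrite mulNr expRN ler_pdivrMr ?expR_gt0// expR_quadratic_lb.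
Qed.

(** Half of the exponent absorbs the quadratic factor, the other half is the
    density of twice the variance. *)
Lemma integrable_normal_pdf_quadratic :
  leb.-integrable setT (EFin \o (fun x => (1 + (x - m) ^+ 2) * pdf x)).
Proof.
pose r := s * Num.sqrt 2.
have r0 : 0 < r by rewrite mulr_gt0// sqrtr_gt0.
have r2 : r ^+ 2 = s ^+ 2 * 2 by rewrite exprMn sqr_sqrtr.
pose K := normal_peak s / normal_peak r * (1 + r ^+ 2 *+ 2).
apply: (@le_integrable _ _ _ leb _ measurableT _ (fun x => (K * normal_pdf m r x)%:E)).
- apply/measurable_EFinP/measurable_funM; last exact: measurable_normal_pdf.
  by apply: measurable_funD => //; apply: measurable_funX; exact: measurable_funD.
- move=> x _ /=; rewrite lee_fin !ger0_norm; last 2 first.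
  + rewrite mulr_ge0 ?normal_pdf_ge0// mulr_ge0 ?divr_ge0 ?normal_peak_ge0//.
    by rewrite addr_ge0// mulrn_wge0// sqr_ge0.
  + by rewrite mulr_ge0 ?normal_pdf_ge0// addr_ge0// sqr_ge0.
  rewrite normal_pdf_expR normal_pdfE ?gt_eqF// /normal_fun /K.
  set y := (x - m) ^+ 2; set v := r ^+ 2 *+ 2.
  have y0 : 0 <= y by exact: sqr_ge0.
  have v0 : 0 < v by rewrite pmulrn_lgt0// exprn_gt0.
  have -> : - y / (s ^+ 2 *+ 2) = - (y / v) + - (y / v).
    rewrite /v -[s ^+ 2 *+ 2]mulr_natr -[r ^+ 2 *+ 2]mulr_natr r2.
    by move: y {y0} => y; field.
  rewrite mulNr expRD; set E := expR (- (y / v)).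
  have hE : (1 + y) * E <= 1 + v.
    by rewrite /E expRN ler_pdivrMr ?expR_gt0// expR_quadratic_lb.
  have -> : normal_peak s / normal_peak r * (1 + v) * (normal_peak r * E) =
      (1 + v) * (normal_peak s * E).
    field; rewrite gt_eqF// normal_peak_gt0// gt_eqF//.
  have -> : (1 + y) * (normal_peak s * (E * E)) = ((1 + y) * E) * (normal_peak s * E).
    by ring.
  by rewrite ler_wpM2r// mulr_ge0 ?normal_peak_ge0 ?expR_ge0.
- exact: (integrableZl measurableT K (integrable_normal_pdf m r)).
Qed.

Lemma integrable_normal_pdf_poly (g : R -> R) (C : R) : measurable_fun setT g ->
  (forall x, `|g x| <= C * (1 + (x - m) ^+ 2)) ->
  leb.-integrable setT (EFin \o (fun x => g x * pdf x)).
Proof.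
move=> mg gC.
apply: (@le_integrable _ _ _ leb _ measurableT _
    (fun x => C%:E * ((1 + (x - m) ^+ 2) * pdf x)%:E)%E).
- by apply/measurable_EFinP/measurable_funM => //; exact: measurable_normal_pdf.
- move=> x _ /=; rewrite lee_fin normrM (ger0_norm (normal_pdf_ge0 _ _ _)).
  apply: le_trans (ler_norm _).
  by rewrite mulrA ler_wpM2r// normal_pdf_ge0.
- exact: (integrableZl measurableT C integrable_normal_pdf_quadratic).
Qed.

Lemma Rintegral_normal_pdf : \int[leb]_x pdf x = 1.
Proof. by rewrite /Rintegral integral_normal_pdf. Qed.

(** Integration by parts: the derivative of the density is - (x - m) / s^2 times
    the density. *)
Lemma normal_pdf_stein (g g' : R -> R) (C : R) :
  (forall x, is_derive (x : R) (1 : R) g (g' x)) -> continuous g' ->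
  (forall x, `|g x| <= C * (1 + `|x - m|)) ->
  (forall x, `|g' x| <= C * (1 + (x - m) ^+ 2)) ->
  \int[leb]_x ((x - m) * g x * pdf x) = s ^+ 2 * \int[leb]_x (g' x * pdf x).
Proof.
move=> dg cg' gC g'C.
have C0 : 0 <= C.
  have := gC m; rewrite subrr normr0 addr0 mulr1; exact: le_trans.
have cg x : {for x, continuous g}.
  by apply: differentiable_continuous; apply/derivable1_diffP; case: (dg x).
have i1 : leb.-integrable setT (EFin \o (fun x => (x - m) * g x * pdf x)).
  apply: (@integrable_normal_pdf_poly _ (C * 2)).
    apply: measurable_funM; first exact: measurable_funD.
    exact: continuous_measurable_fun.
  move=> x; rewrite normrM (le_trans (ler_wpM2l _ (gC x)))// mulrCA -mulrA.
  rewrite ler_wpM2l// -(real_normK (num_real (x - m))).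
  have := normr_ge0 (x - m); set u := `|_|; have := sqr_ge0 (u - 1); nra.
have i2 : leb.-integrable setT (EFin \o (fun x => g' x * pdf x)).
  apply: (@integrable_normal_pdf_poly _ C) => //; exact: continuous_measurable_fun.
have i3 := integrable_EFinZ (s ^+ 2) i2.
apply/eqP; rewrite -subr_eq0; apply/eqP.
rewrite -RintegralZl// -RintegralB//.
have [B hB] := normal_pdf_quadratic_ub.
apply: (@Rintegral_derivative_eq0 (fun x => - s ^+ 2 * (g x * pdf x))
   (fun x => (x - m) * g x * pdf x - s ^+ 2 * (g' x * pdf x))
   (s ^+ 2 * (C * (3 * (1 + `|m|) * B)))).
- move=> x; have dgx := dg x; have dpx := is_derive_normal_pdf x.
  apply: is_derive_eq.
  by rewrite /GRing.scale/=; field.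
- move=> x; apply: cvgB.
    apply: cvgM; last exact: continuous_normal_pdf.
    by apply: cvgM; [apply: cvgB; [exact: cvg_id|exact: cvg_cst]|exact: cg].
  by apply: cvgMl_tmp; apply: cvgM; [exact: cg'|exact: continuous_normal_pdf].
- exact: integrable_EFinB.
- move=> x; rewrite !normrM normrN (ger0_norm (normal_pdf_ge0 _ _ _)) (ger0_norm (sqr_ge0 s)).
  rewrite mulrCA ler_wpM2l ?sqr_ge0//.
  apply: (@le_trans _ _ (C * (`|x| * (1 + `|x - m|)) * pdf x)).
    have -> : C * (`|x| * (1 + `|x - m|)) * pdf x =
        `|x| * (C * (1 + `|x - m|) * pdf x) by ring.
    by rewrite ler_wpM2l// ler_wpM2r ?normal_pdf_ge0.
  rewrite -mulrA ler_wpM2l//.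
  apply: (@le_trans _ _ (3 * (1 + `|m|) * ((1 + (x - m) ^+ 2) * pdf x))); last first.
    by rewrite ler_wpM2l// mulr_ge0// addr_ge0.
  rewrite mulrA ler_wpM2r ?normal_pdf_ge0//.
  have : `|x| <= `|x - m| + `|m| by rewrite -{1}(subrK m x) ler_normD.
  rewrite -(real_normK (num_real (x - m))).
  have := normr_ge0 (x - m); have := normr_ge0 m; have := normr_ge0 x.
  set u := `|x - m|; set a := `|m|; set b := `|x| => b0 a0 u0 bua.
  apply: (@le_trans _ _ ((u + a) * (1 + u))); first by rewrite ler_wpM2r// addr_ge0.
  have h1 := sqr_ge0 (u - 1); have h2 := mulr_ge0 a0 h1.
  have h3 := mulr_ge0 a0 (sqr_ge0 u); have h4 := mulr_ge0 a0 u0.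
  by have h5 := sqr_ge0 u; lra.
Qed.

Lemma normal_pdf_mean : \int[leb]_x ((x - m) * pdf x) = 0.
Proof.
have d1 (x : R) : is_derive (x : R) (1 : R) (fun=> 1 : R) 0 by exact: is_derive_cst.
have c0 : continuous (fun _ : R => 0 : R) by move=> x; apply: cvg_cst.
have h1 (x : R) : `|1 : R| <= 1 * (1 + `|x - m|) by rewrite normr1 mul1r lerDl.
have h2 (x : R) : `|0 : R| <= 1 * (1 + (x - m) ^+ 2).
  by rewrite normr0 mul1r addr_ge0// sqr_ge0.
have := normal_pdf_stein d1 c0 h1 h2.
have -> : \int[leb]_x (0 * pdf x) = 0.
  by under eq_Rintegral do rewrite mul0r; rewrite Rintegral_cst// mul0r.
by rewrite mulr0 => <-; apply: eq_Rintegral => x _; rewrite mulr1.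
Qed.

Lemma normal_pdf_variance : \int[leb]_x ((x - m) ^+ 2 * pdf x) = s ^+ 2.
Proof.
have d1 (x : R) : is_derive (x : R) (1 : R) (fun x : R => x - m : R) 1.
  by apply: is_derive_eq; rewrite subr0.
have c0 : continuous (fun _ : R => 1 : R) by move=> x; apply: cvg_cst.
have h1 (x : R) : `|x - m| <= 1 * (1 + `|x - m|) by rewrite mul1r lerDr.
have h2 (x : R) : `|1 : R| <= 1 * (1 + (x - m) ^+ 2).
  by rewrite normr1 mul1r lerDl sqr_ge0.
have := normal_pdf_stein d1 c0 h1 h2.
have -> : \int[leb]_x (1 * pdf x) = 1.
  by rewrite -[RHS]Rintegral_normal_pdf; apply: eq_Rintegral => x _; rewrite mul1r.
by rewrite mulr1 => <-; apply: eq_Rintegral => x _; rewrite expr2.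
Qed.

Lemma bounded_measurable_cos_phase d (T : measurableType d) (V : T -> R) (t th : R) :
  measurable_fun setT V -> bounded_measurable (fun x => cos (t * V x + th)).
Proof.
move=> mV; apply: bounded_measurable_cos.
by apply: measurable_funD => //; exact: measurable_funM.
Qed.

(** After centring, the integral is a function F of t which, by differentiation
    under the integral and integration by parts, satisfies F' = - s^2 t F. *)
Lemma normal_pdf_cos (t th : R) :
  \int[leb]_x (cos (t * x + th) * pdf x) =
  cos (t * m + th) * expR (- (t ^+ 2 * s ^+ 2 / 2)).
Proof.
pose a := t * m + th.
pose f (u x : R) := cos (u * (x - m) + a) * pdf x.
pose F u := \int[leb]_x f u x.
pose G (x : R) := `|x - m| * pdf x.
have mxm : measurable_fun setT (fun x : R => x - m) by exact: measurable_funD.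
have bcos u : bounded_measurable (fun x : R => cos (u * (x - m) + a)).
  exact: bounded_measurable_cos_phase.
have ifu u : leb.-integrable setT (EFin \o f u).
  apply: (@integrable_normal_pdf_poly _ 1); first exact: (bcos u).1.
  move=> x; rewrite mul1r (@le_trans _ _ 1)//; last by rewrite lerDl sqr_ge0.
  by rewrite ler_norml cos_geN1 cos_le1.
have iG : leb.-integrable setT (EFin \o G).
  apply: (@integrable_normal_pdf_poly _ 1); first exact: measurableT_comp.
  move=> x; rewrite normr_id mul1r -(real_normK (num_real (x - m))).
  by have := sqr_ge0 (`|x - m| - 1); set w := `|_|; nra.
have df u x : is_derive (u : R) (1 : R) (f ^~ x)
    (- ((x - m) * sin (u * (x - m) + a) * pdf x)).
  rewrite /f; apply: is_derive_eq.
  by rewrite /GRing.scale/=; ring.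
have dfE u x : partial1of2 f u x = - ((x - m) * sin (u * (x - m) + a) * pdf x).
  by rewrite partial1of2E; case: (df u x).
have Gub u x : `|partial1of2 f u x| <= G x.
  rewrite dfE normrN !normrM (ger0_norm (normal_pdf_ge0 _ _ _)).
  rewrite ler_wpM2r ?normal_pdf_ge0// ler_piMr//.
  by rewrite ler_norml sin_geN1 sin_le1.
have dF u : is_derive (u : R) (1 : R) F (- (s ^+ 2 * u * F u)).
  have uu : `]u - 1, u + 1[%classic u by rewrite /= in_itv/= ltrBlDr ltrDl ltr01.
  have G0 x : 0 <= G x by rewrite mulr_ge0 ?normal_pdf_ge0.
  have df1 v y : `]u - 1, u + 1[%classic v -> setT y -> derivable (f ^~ y) v 1.
    by move=> _ _; case: (df v y).
  apply: DeriveDef.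
    exact: (derivable_under_integral measurableT uu (fun v _ => ifu v) df1 G0 iG (fun v y _ _ => Gub v y)).
  rewrite -derive1E.
  rewrite (differentiation_under_integral measurableT uu (fun v _ => ifu v) df1 G0 iG (fun v y _ _ => Gub v y)).
  transitivity (\int[leb]_x - ((x - m) * sin (u * (x - m) + a) * pdf x)).
    by apply: eq_Rintegral => x _; exact: dfE.
  have d1 (x : R) : is_derive (x : R) (1 : R) (fun x => sin (u * (x - m) + a))
      (u * cos (u * (x - m) + a)).
    by apply: is_derive_eq; rewrite /GRing.scale/=; ring.
  have c1 : continuous (fun x : R => u * cos (u * (x - m) + a)).
    move=> x; apply: cvgMl_tmp.
    apply: (@continuous_comp _ _ _ (fun x : R => u * (x - m) + a)); last exact: continuous_cos.
    apply: cvgD; last exact: cvg_cst.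
    by apply: cvgMl_tmp; apply: cvgB; [exact: cvg_id|exact: cvg_cst].
  have h1 x : `|sin (u * (x - m) + a)| <= (1 + `|u|) * (1 + `|x - m|).
    rewrite (@le_trans _ _ 1)//; first by rewrite ler_norml sin_geN1 sin_le1.
    by rewrite -[leLHS]mulr1 ler_pM// lerDl.
  have h2 x : `|u * cos (u * (x - m) + a)| <= (1 + `|u|) * (1 + (x - m) ^+ 2).
    rewrite (@le_trans _ _ (`|u| * 1))//.
      by rewrite normrM ler_wpM2l// ler_norml cos_geN1 cos_le1.
    by rewrite ler_pM// ?lerDr// lerDl sqr_ge0.
  have e : \int[leb]_x ((x - m) * sin (u * (x - m) + a) * pdf x) = s ^+ 2 * u * F u.
    rewrite (normal_pdf_stein d1 c1 h1 h2) -mulrA; congr (_ * _).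
    rewrite /F -RintegralZl//; by apply: eq_Rintegral => x _; rewrite mulrA.
  rewrite -e -[RHS]mulN1r -RintegralZl//.
    by apply: eq_Rintegral => x _; rewrite mulN1r.
  apply: (@le_integrable _ _ _ leb _ measurableT _ (EFin \o G)) => //.
    apply/measurable_EFinP/measurable_funM; last exact: measurable_normal_pdf.
    apply: measurable_funM => //; apply: (@bounded_measurable_sin _ R R _ _).1.
    by apply: measurable_funD => //; exact: measurable_funM.
  move=> x _; rewrite /= lee_fin; apply: le_trans (ler_norm _).
  by rewrite -normrN -dfE.
pose H u := F u * expR (s ^+ 2 * u ^+ 2 / 2).
have dH (u : R) : is_derive (u : R) (1 : R) H 0.
  have dFu := dF u; rewrite /H; apply: is_derive_eq.
  by rewrite /GRing.scale/=; field.
have := is_derive_0_is_cst t 0 dH.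
rewrite /H expr0n/= mulr0 mul0r expR0 mulr1.
have -> : F 0 = cos a.
  rewrite /F /f; under eq_Rintegral do rewrite mul0r add0r.
  by rewrite RintegralZl ?Rintegral_normal_pdf ?mulr1//; exact: integrable_normal_pdf.
have -> : s ^+ 2 * t ^+ 2 / 2 = t ^+ 2 * s ^+ 2 / 2 by ring.
move=> <-; rewrite expRN mulfK ?gt_eqF ?expR_gt0//.
apply: eq_Rintegral => x _; rewrite /f /a; congr (cos _ * _); ring.
Qed.

End normal_density.

(** The mean of |y - v| is at most e, which follows from the variance by
    |y - v| <= (e^2 + (y - v)^2) / (2 e). *)
Lemma normal_pdf_lipschitz (f : R -> R) (L M v e : R) : 0 < e ->
  measurable_fun setT f -> (forall y, `|f y| <= M) ->
  (forall y z, `|f y - f z| <= L * `|y - z|) ->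
  `|\int[leb]_y (f y * normal_pdf v e y) - f v| <= L * e.
Proof.
move=> e0 mf fM fL.
have L0 : 0 <= L by have := fL 1 0; rewrite subr0 normr1 mulr1; exact: le_trans.
have M0 : 0 <= M by exact: le_trans (normr_ge0 _) (fM 0).
have ip := integrable_normal_pdf v e.
have mpoly : measurable_fun setT (fun y : R => y - v) by exact: measurable_funD.
have if_ : leb.-integrable setT (EFin \o (fun y => f y * normal_pdf v e y)).
  apply: (integrable_normal_pdf_poly e0 (C := M)) => // y.
  by rewrite (le_trans (fM y))// -[leLHS]mulr1 ler_wpM2l// lerDl sqr_ge0.
have iq : leb.-integrable setT (EFin \o (fun y => (y - v) ^+ 2 * normal_pdf v e y)).
  apply: (integrable_normal_pdf_poly e0 (C := 1)) => [|y].
    exact: measurable_funX.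
  by rewrite mul1r ger0_norm ?sqr_ge0// lerDr.
have id : leb.-integrable setT (EFin \o (fun y => (f y - f v) * normal_pdf v e y)).
  apply: (integrable_normal_pdf_poly e0 (C := M + M)) => [|y].
    by apply: measurable_funB.
  rewrite (le_trans (ler_normB _ _))// (@le_trans _ _ (M + M)) ?lerD//.
  by rewrite -[leLHS]mulr1 ler_wpM2l ?addr_ge0// lerDl sqr_ge0.
have -> : \int[leb]_y (f y * normal_pdf v e y) - f v =
    \int[leb]_y ((f y - f v) * normal_pdf v e y).
  have {1}-> : f v = f v * \int[leb]_y (normal_pdf v e y).
    by rewrite Rintegral_normal_pdf mulr1.
  rewrite -RintegralZl// -RintegralB//; last exact: integrable_EFinZ.
  by apply: eq_Rintegral => y _; rewrite mulrBl.
apply: (le_trans (le_normr_Rintegral _ id)) => //.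
pose h y := L * (e / 2 * normal_pdf v e y + (2 * e)^-1 * ((y - v) ^+ 2 * normal_pdf v e y)).
have i1 := integrable_EFinZ (e / 2) ip.
have i2 := integrable_EFinZ (2 * e)^-1 iq.
have ih : leb.-integrable setT (EFin \o h).
  apply: integrable_EFinZ; exact: integrable_EFinD.
apply: (@le_trans _ _ (\int[leb]_y h y)).
  apply: le_Rintegral => //; first exact: integrable_norm.
  move=> y _; rewrite normrM (ger0_norm (normal_pdf_ge0 _ _ _)) /h.
  rewrite [X in _ <= _ * X](_ : _ = (e / 2 + (2 * e)^-1 * (y - v) ^+ 2) * normal_pdf v e y); last by ring.
  rewrite mulrA ler_wpM2r ?normal_pdf_ge0// (le_trans (fL _ _))// ler_wpM2l//.
  rewrite -(real_normK (num_real (y - v))); set w := `|_|.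
  have -> : e / 2 + (2 * e)^-1 * w ^+ 2 = (e ^+ 2 + w ^+ 2) / (2 * e).
    by field; rewrite gt_eqF.
  rewrite ler_pdivlMr ?mulr_gt0//.
  by have := sqr_ge0 (e - w); nra.
rewrite RintegralZl//; last exact: integrable_EFinD.
rewrite RintegralD// !RintegralZl// normal_pdf_variance// Rintegral_normal_pdf//.
by rewrite ler_wpM2l// (_ : e / 2 * 1 + (2 * e)^-1 * e ^+ 2 = e)//; field; rewrite gt_eqF.
Qed.

End gaussian_integrals.

(** * Uniqueness of Fourier transforms *)

Section fourier_uniqueness.
Context {d1 d2 : measure_display} {T1 : measurableType d1}
  {T2 : measurableType d2} {R : realType}.
Variables (m1 : {sigma_finite_measure set T1 -> \bar R})
  (m2 : {sigma_finite_measure set T2 -> \bar R}).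
Variables (V1 : T1 -> R) (V2 : T2 -> R) (Q1 : T1 -> R) (Q2 : T2 -> R).
Hypotheses (mV1 : measurable_fun setT V1) (mV2 : measurable_fun setT V2)
  (iQ1 : m1.-integrable setT (EFin \o Q1))
  (iQ2 : m2.-integrable setT (EFin \o Q2)).
Hypothesis eq_fourier : forall t th : R,
  \int[m1]_x (Q1 x * cos (t * V1 x + th)) = \int[m2]_x (Q2 x * cos (t * V2 x + th)).
Local Notation leb := (@lebesgue_measure R).

(** The Gaussian bump exp(-u^2/2) is a superposition of cosines, being itself the
    Fourier transform of the standard normal law. *)
Let bumpE (e v y : R) : 0 < e -> normal_pdf v e y =
  normal_peak e * \int[leb]_g (normal_pdf 0 1 g * cos (g / e * v + - (g / e * y))).
Proof.
move=> e0; rewrite normal_pdf_expR//; congr (_ * _).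
transitivity (\int[leb]_g (cos ((v - y) / e * g + 0) * normal_pdf 0 1 g)); last first.
  apply: eq_Rintegral => g _; rewrite mulrC; congr (_ * cos _); rewrite addr0; ring.
rewrite normal_pdf_cos// mulr0 addr0 cos0 mul1r; congr expR.
by rewrite -[_ *+ 2]mulr_natr; field; rewrite gt_eqF.
Qed.

Let bump_fourier d (T : measurableType d) (m : {sigma_finite_measure set T -> \bar R})
    (V Q : T -> R) (e y : R) : measurable_fun setT V ->
    m.-integrable setT (EFin \o Q) -> 0 < e ->
  \int[m]_x (Q x * normal_pdf (V x) e y) =
  normal_peak e * \int[leb]_g (normal_pdf 0 1 g *
    \int[m]_x (Q x * cos (g / e * V x + - (g / e * y)))).
Proof.
move=> mV iQ e0; have ip := integrable_normal_pdf (0 : R) 1.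
have pk0 : normal_peak e != 0 by rewrite gt_eqF// normal_peak_gt0// gt_eqF.
have bV : bounded_measurable (fun x => normal_pdf (V x) e y).
  split; last first.
    exists (normal_peak e) => x; rewrite ger0_norm ?normal_pdf_ge0//.
    by rewrite normal_pdf_ub// gt_eqF.
  rewrite (_ : (fun x => _) = (fun x => normal_pdf y e (V x))).
    exact: measurableT_comp (measurable_normal_pdf y e) mV.
  by apply/funext => x; rewrite !normal_pdf_expR// -sqrrN opprB.
have bphi : bounded_measurable (fun z : T * R => cos (z.2 / e * V z.1 + - (z.2 / e * y))).
  apply: bounded_measurable_cos.
  have m2e : measurable_fun setT (fun z : T * R => z.2 / e) by exact: measurable_funM.
  apply: measurable_funD.
    by apply: measurable_funM => //; exact: measurableT_comp mV measurable_fst.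
  by apply: measurable_funN; exact: measurable_funM.
rewrite -(Rintegral_fubini_bounded iQ ip bphi).
transitivity (\int[m]_x (normal_peak e * (Q x * ((normal_peak e)^-1 * normal_pdf (V x) e y)))).
  by apply: eq_Rintegral => x _; rewrite mulrCA mulVKf.
rewrite RintegralZl//; last first.
  apply: integrable_mul_bounded => //.
  by apply: bounded_measurableM => //; exact: bounded_measurable_cst.
by congr (_ * _); apply: eq_Rintegral => x _; rewrite bumpE// mulKf.
Qed.

Let bump_eq (e y : R) : 0 < e ->
  \int[m1]_x (Q1 x * normal_pdf (V1 x) e y) = \int[m2]_x (Q2 x * normal_pdf (V2 x) e y).
Proof.
move=> e0; rewrite !bump_fourier//.
by congr (_ * _); apply: eq_Rintegral => g _; rewrite eq_fourier.
Qed.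

(** Averaging the bumps centred at y with weights f y almost restores f when the
    bumps are narrow. *)
Let smoothing_error d (T : measurableType d) (m : {sigma_finite_measure set T -> \bar R})
    (V Q : T -> R) (f : R -> R) (L M e : R) : measurable_fun setT V ->
    m.-integrable setT (EFin \o Q) -> 0 < e ->
  leb.-integrable setT (EFin \o f) -> (forall y, `|f y| <= M) ->
  (forall y z, `|f y - f z| <= L * `|y - z|) ->
  `|\int[leb]_y (f y * \int[m]_x (Q x * normal_pdf (V x) e y)) -
    \int[m]_x (Q x * f (V x))| <= L * e * \int[m]_x `|Q x|.
Proof.
move=> mV iQ e0 if_ fM fL.
have mf := integrable_EFin_measurable if_.
have bf : bounded_measurable (fun x => f (V x)).
  by apply: bounded_measurable_comp => //; split => //; exists M.
have bpdf : bounded_measurable (fun z : T * R => normal_pdf (V z.1) e z.2).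
  split; last first.
    exists (normal_peak e) => x; rewrite ger0_norm ?normal_pdf_ge0//.
    by rewrite normal_pdf_ub// gt_eqF.
  rewrite (_ : (fun x => _) = (fun z : T * R => normal_pdf 0 e (z.2 - V z.1))).
    apply: measurableT_comp (measurable_normal_pdf 0 e) _.
    apply: measurable_funB => //; exact: measurableT_comp mV measurable_fst.
  by apply/funext => x; rewrite !normal_pdf_expR// subr0.
rewrite -(Rintegral_fubini_bounded iQ if_ bpdf).
have hL x : `|\int[leb]_y (f y * normal_pdf (V x) e y) - f (V x)| <= L * e.
  exact: normal_pdf_lipschitz fM fL.
have bI : bounded_measurable (fun x => \int[leb]_y (f y * normal_pdf (V x) e y)).
  split; last first.
    exists (L * e + M) => x.
    rewrite -[X in `|X|](subrK (f (V x))) (le_trans (ler_normD _ _))// lerD//.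
  have mF : measurable_fun setT (fun z : T * R => f z.2 * normal_pdf (V z.1) e z.2).
    by apply: measurable_funM bpdf.1; exact: measurableT_comp mf measurable_snd.
  exact: (measurable_Rintegral_section leb mF).
rewrite -RintegralB//; last 2 first.
- exact: integrable_mul_bounded.
- exact: integrable_mul_bounded.
apply: (le_trans (le_normr_Rintegral _ _)) => //.
  by apply: integrable_EFinB; exact: integrable_mul_bounded.
rewrite -RintegralZl//; last exact: integrable_norm.
apply: le_Rintegral => //.
- apply: integrable_norm; apply: integrable_EFinB; exact: integrable_mul_bounded.
- by apply: integrable_EFinZ; exact: integrable_norm.
- by move=> x _; rewrite -mulrBr normrM mulrC ler_wpM2r//=.
Qed.

Lemma fourier_uniqueness_lipschitz (f : R -> R) (L M : R) :
  leb.-integrable setT (EFin \o f) -> (forall y, `|f y| <= M) ->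
  (forall y z, `|f y - f z| <= L * `|y - z|) ->
  \int[m1]_x (Q1 x * f (V1 x)) = \int[m2]_x (Q2 x * f (V2 x)).
Proof.
move=> if_ fM fL.
have L0 : 0 <= L by have := fL 1 0; rewrite subr0 normr1 mulr1; exact: le_trans.
pose C := L * (\int[m1]_x `|Q1 x| + \int[m2]_x `|Q2 x|).
have C0 : 0 <= C by rewrite mulr_ge0// addr_ge0//; apply: Rintegral_ge0.
apply/eqP; rewrite -subr_eq0 -normr_le0; apply/ler_addgt0Pl => e e0.
pose r := e / (C + 1); have r0 : 0 < r by rewrite divr_gt0// ltr_wpDl.
have h1 := smoothing_error mV1 iQ1 r0 if_ fM fL.
have h2 := smoothing_error mV2 iQ2 r0 if_ fM fL.
have E : \int[leb]_y (f y * \int[m1]_x (Q1 x * normal_pdf (V1 x) r y)) =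
    \int[leb]_y (f y * \int[m2]_x (Q2 x * normal_pdf (V2 x) r y)).
  by apply: eq_Rintegral => y _; rewrite bump_eq.
rewrite addr0; apply: (@le_trans _ _ (C * r)).
  rewrite E in h1; move: h1 h2; rewrite /C; move: (\int[leb]_y _) => I.
  rewrite distrC => h1 h2.
  rewrite -(subrK I (\int[m1]_x _)) -addrA (le_trans (ler_normD _ _))//.
  by rewrite mulrAC mulrDr lerD.
rewrite /r mulrCA ler_piMr ?(ltW e0)// ler_pdivrMr ?ltr_wpDl// mul1r lerDl//.
Qed.

(** The indicator of an open interval is the limit of Lipschitz trapezoids. *)
Lemma fourier_uniqueness_itv (a b : R) :
  \int[m1]_x (Q1 x * \1_`]a, b[ (V1 x)) = \int[m2]_x (Q2 x * \1_`]a, b[ (V2 x)).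
Proof.
pose f n (y : R) := Num.max 0 (Num.min 1 (n%:R * Num.min (y - a) (b - y))) : R.
have f01 n y : 0 <= f n y <= 1.
  by rewrite /f le_max lexx/= ge_max ler01/= ge_min lexx.
have mf n : measurable_fun setT (f n).
  apply: measurable_maxr => //; apply: measurable_minr => //.
  apply: measurable_funM => //; apply: measurable_minr.
    exact: measurable_funD.
  exact: measurable_funB.
have f0 n y : y \notin `]a, b[ -> f n y = 0.
  rewrite in_itv/= negb_and -!leNgt => h; apply/max_idPl.
  rewrite ge_min; apply/orP; right; rewrite mulr_ge0_le0// ge_min.
  by case/orP: h => h; rewrite ?subr_le0 h ?orbT// .
have lip n y z : `|f n y - f n z| <= n%:R * `|y - z|.
  have cl (u v : R) : `|Num.max 0 (Num.min 1 u) - Num.max 0 (Num.min 1 v)| <= `|u - v|.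
    have h5 := ler_norm (u - v); have h6 := lerNnormlW (lexx `|u - v|).
    apply: (@le_trans _ _ `|Num.min 1 u - Num.min 1 v|).
      move: (Num.min 1 u) (Num.min 1 v) => {h5 h6} {}u {}v.
      have h5 := ler_norm (u - v); have h6 := lerNnormlW (lexx `|u - v|).
      by case: (leP 0 u) => h1; case: (leP 0 v) => h2; rewrite ler_norml; apply/andP; split; lra.
    by case: (leP 1 u) => h1; case: (leP 1 v) => h2; rewrite ler_norml; apply/andP; split; lra.
  apply: (le_trans (cl _ _)); rewrite -mulrBr normrM normr_nat ler_wpM2l//.
  have := ler_norm (y - z); have := lerNnormlW (lexx `|y - z|) => h5 h6.
  rewrite /Num.min; case: ifPn => h1; case: ifPn => h2; move: h1 h2; rewrite -?leNgt => h1 h2;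
  rewrite ler_norml; apply/andP; split; lra.
have fN n y : `|f n y| <= 1.
  by case/andP: (f01 n y) => h1 h2; rewrite ger0_norm.
have if_ n : leb.-integrable setT (EFin \o f n).
  apply: (@le_integrable _ _ _ leb _ measurableT _ (EFin \o \1_`[a, b])).
  - by apply/measurable_EFinP; exact: mf.
  - move=> y _ /=; rewrite lee_fin indicE; have [yab|yab] := boolP (y \in `[a, b]).
      by rewrite mem_set// normr1.
    rewrite f0 ?normr0//; apply: contra yab; rewrite !in_itv/= => /andP[h1 h2].
    by rewrite !ltW.
  - exact: integrable_indic_itv.
have cf y : f ^~ y @ \oo --> (\1_`]a, b[ y : R).
  apply: cvg_near_cst; rewrite indicE.
  have [yab|yab] := boolP (y \in `]a, b[); last first.
    apply: nearW => n; rewrite f0// memNset//=; exact/negP.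
  rewrite mem_set//; near=> n.
  have h0 : 0 < Num.min (y - a) (b - y).
    by move: yab; rewrite in_itv/= lt_min !subr_gt0 => /andP[-> ->].
  rewrite /f (min_idPl _) ?(max_idPr _)//.
  rewrite -ler_pdivrMr// mul1r; near: n; exact: nbhs_infty_ger.
have b1 n : bounded_measurable (f n) by split => //; exists 1.
have c1 := weighted_bounded_cvg iQ1 (fun n => (bounded_measurable_comp mV1 (b1 n)).1)
  (bounded_measurable_comp mV1 (bounded_measurable_indic (measurable_itv `]a, b[))).1
  (fun n x => fN n (V1 x)) (aeW _ (fun x => cf (V1 x))).
have c2 := weighted_bounded_cvg iQ2 (fun n => (bounded_measurable_comp mV2 (b1 n)).1)
  (bounded_measurable_comp mV2 (bounded_measurable_indic (measurable_itv `]a, b[))).1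
  (fun n x => fN n (V2 x)) (aeW _ (fun x => cf (V2 x))).
apply: (cvg_unique _ c1) => //.
rewrite (_ : (fun n => _) = (fun n => \int[m2]_x (Q2 x * f n (V2 x))))//.
apply/funext => n; exact: fourier_uniqueness_lipschitz (if_ n) (fN n) (lip n).
Unshelve. all: by end_near. Qed.

(** Cosines with an arbitrary phase th stand for the complex exponential. *)
Lemma fourier_uniqueness (phi : R -> R) : bounded_measurable phi ->
  \int[m1]_x (Q1 x * phi (V1 x)) = \int[m2]_x (Q2 x * phi (V2 x)).
Proof.
apply: weighted_laws_eq_bounded => // B mB.
refine (@weighted_laws_eq_dynkin _ _ _ _ _ _ R m1 m2 V1 V2 Q1 Q2 mV1 mV2 iQ1 iQ2 (@RGenOpens.G R) _ _ _ _ B _).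
- move=> _ _ [a [b ->]] [c [e ->]]; exists (Num.max a c), (Num.min b e).
  apply/seteqP; split => x /=; rewrite !in_itv/= gt_max lt_min.
    by move=> [/andP[-> ->] /andP[-> ->]].
  by move=> /andP[/andP[-> ->] /andP[-> ->]].
- by move=> _ [a [b ->]].
- have := eq_fourier 0 0.
  under eq_Rintegral do rewrite mul0r addr0 cos0 mulr1.
  by under [X in _ = X -> _]eq_Rintegral do rewrite mul0r addr0 cos0 mulr1.
- by move=> _ [a [b ->]]; exact: fourier_uniqueness_itv.
- change ((@RGenOpens.G R).-sigma.-measurable B).
  by rewrite -RGenOpens.measurableE; exact: mB.
Qed.

End fourier_uniqueness.

(** * Independence and Gaussian laws *)

Section sub_sigma_algebra.
Context {T : pointedType}.

Lemma sigma_measurableP (G : set (set T)) {d'} {U : measurableType d'} (f : T -> U) :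
  (forall B, measurable B -> <<s G >> (f @^-1` B)) <->
  measurable_fun [set: g_sigma_algebraType G] f.
Proof.
split=> h.
  by move=> _ B mB; rewrite setTI; exact: h.
by move=> B mB; have := h measurableT B mB; rewrite setTI.
Qed.

End sub_sigma_algebra.

Section independence.
Context {d : measure_display} {T : measurableType d} {R : realType}.
Variable P : probability T R.

(** Events are replaced by bounded functions one index at a time: with all other
    factors fixed, both sides are weighted laws of f i that agree on events. *)
Lemma mutually_independent_prod (I : finType) (F : I -> set (set T))
    (f : I -> T -> R) :
  mutually_independent P F -> (forall i, F i `<=` measurable) ->
  (forall i, bounded_measurable (f i)) ->
  (forall i B, measurable B -> F i (f i @^-1` B)) ->
  forall (t s : seq I) (A : I -> set T), uniq (s ++ t) ->
  (forall i, i \in s -> F i (A i)) ->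
  \int[P]_w (\prod_(i <- s) \1_(A i) w * \prod_(i <- t) f i w) =
  \prod_(i <- s) fine (P (A i)) * \prod_(i <- t) \int[P]_w f i w.
Proof.
move=> indF Fm bf Ff; elim=> [|i t IH] s A.
  rewrite cats0 => us FA; rewrite big_nil mulr1.
  have mA i : i \in s -> measurable (A i) by move=> /FA /Fm.
  have := indF [set i in s]%SET A.
  have -> : \bigcap_(i in [set` [set i in s]%SET]) A i = \bigcap_(i in [set` s]) A i.
    by apply: eq_bigcapl; split => i /=; rewrite inE.
  have FA' i : i \in [set i in s]%SET -> F i (A i) by rewrite inE => /FA.
  move=> /(_ FA') h.
  transitivity (fine (P (\bigcap_(i in [set` s]) A i))).
    rewrite -Rintegral_indic; last by apply: fin_bigcap_measurable => // i /mA.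
    apply: eq_Rintegral => w _; rewrite big_nil mulr1 indicE.
    have [/set_mem h1|h1] := boolP (w \in _).
      rewrite big_seq big1// => i si; rewrite indicE mem_set//; exact: h1.
    have /existsNP[i /not_implyP[/= si nA]] : ~ (forall i, [set` s] i -> A i w).
      by move: h1; rewrite notin_setE.
    by rewrite (big_rem i)//= indicE memNset// mul0r.
  rewrite h.
  have -> : (\prod_(i in [set i0 in s]%SET) P (A i) = (\prod_(i <- s) fine (P (A i)))%:E)%E.
    rewrite (eq_bigl (fun i => i \in s)); last by move=> i; rewrite inE.
    rewrite -big_uniq// (eq_big_seq (fun i => (fine (P (A i)))%:E)) => [|i si].
      by elim/big_rec2: _ => // i x y _ ->; rewrite EFinM.
    by rewrite fineK// fin_num_measure//; exact: mA.
  by [].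
move=> ust FA.
have [uis us] : i \notin s /\ uniq ((i :: s) ++ t).
  move: ust; rewrite -cat1s uniq_catCA cat1s /= => /andP[h1 h2].
  have := h1; rewrite [in X in X -> _]mem_cat negb_or => /andP[h3 h4]; split; first exact: h3.
  by apply/andP; split; [exact: h1|exact: h2].
pose c := \prod_(j <- s) fine (P (A j)) * \prod_(j <- t) \int[P]_w f j w.
have mA j : j \in s -> measurable (A j) by move=> /FA /Fm.
pose A0 j := if j \in s then A j else set0.
have bQ : bounded_measurable (fun w => \prod_(j <- s) \1_(A j) w * \prod_(j <- t) f j w).
  rewrite (_ : (fun w => _) = (fun w => \prod_(j <- s) \1_(A0 j) w * \prod_(j <- t) f j w)).
    apply: bounded_measurableM; apply: bounded_measurable_prod => // j.
    by apply: bounded_measurable_indic; rewrite /A0; case: ifPn => // /mA.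
  apply/funext => w; congr (_ * _); apply: eq_big_seq => j js.
  by rewrite /A0 js.
have iQ := bounded_integrable P bQ.
have ic := bounded_integrable P (bounded_measurable_cst c).
have e : \int[P]_w ((\prod_(j <- s) \1_(A j) w * \prod_(j <- t) f j w) * f i w) =
    \int[P]_w (c * f i w).
  apply: (weighted_laws_eq_integrable (bf i).1 (bf i).1 iQ ic (phi := idfun)) => //.
  - move=> B mB; pose A' j := if j == i then f i @^-1` B else A j.
    have := IH (i :: s) A' us.
    rewrite !big_cons /A' eqxx.
    have -> : \prod_(j <- s) fine (P (if j == i then f i @^-1` B else A j)) =
        \prod_(j <- s) fine (P (A j)).
      by apply: eq_big_seq => j js; case: eqP => // ji; rewrite -ji js in uis.
    move=> h.
    transitivity (\int[P]_x (\prod_(j <- i :: s) \1_(A' j) x * \prod_(j <- t) f j x)).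
      apply: eq_Rintegral => w _; rewrite big_cons {1}/A' eqxx mulrC mulrA.
      congr (_ * _ * _); apply: eq_big_seq => j js.
      by rewrite /A'; case: eqP => // ji; rewrite -ji js in uis.
    rewrite h; last first.
      move=> j; rewrite inE; case: eqP => [->|] /=; first by move=> _; exact: Ff.
      by move=> _; exact: FA.
    have mfB : measurable (f i @^-1` B) by exact: Fm (Ff _ _ mB).
    rewrite -mulrA mulrC -/c -Rintegral_indic// -RintegralZl//.
    exact: bounded_integrable (bounded_measurable_indic mfB).
  - exact: measurable_id.
  - exact: bounded_integrable (bounded_measurableM bQ (bf i)).
  - exact: bounded_integrable (bounded_measurableM (bounded_measurable_cst c) (bf i)).
transitivity (\int[P]_w (c * f i w)).
  by rewrite -e; apply: eq_Rintegral => w _; rewrite big_cons; ring.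
rewrite RintegralZl//; last exact: bounded_integrable.
by rewrite big_cons /c; ring.
Qed.

End independence.

Lemma Rintegral_cst_probability {d : measure_display} {T : measurableType d}
  {R : realType} (P : probability T R) (c : R) : \int[P]_x c = c.
Proof.
have -> : \int[P]_x c = c * fine (P setT) by exact: Rintegral_cst.
by rewrite probability_setT mulr1.
Qed.

Section gaussian_law_facts.
Context {d : measure_display} {T : measurableType d} {R : realType}.
Variable P : probability T R.
Local Notation leb := (@lebesgue_measure R).
Variables (Y : T -> R) (m v : R).
Hypotheses (mY : measurable_fun setT Y) (v0 : 0 <= v).
Hypothesis lawY : forall B, measurable B -> P (Y @^-1` B) = gaussian_law m v B.

Let i1 : P.-integrable setT (EFin \o (fun=> 1 : R)) :=
  bounded_integrable P (bounded_measurable_cst 1).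

Let mYB B : measurable B -> measurable (Y @^-1` B).
Proof. by move=> mB; rewrite -[X in measurable X]setTI; exact: mY. Qed.

Let P1 B : measurable B -> \int[P]_x (1 * \1_B (Y x)) = fine (P (Y @^-1` B)).
Proof.
move=> mB; rewrite -Rintegral_indic; last exact: mYB.
by apply: eq_Rintegral => x _; rewrite mul1r !indicE.
Qed.

Lemma gaussian_law_expectation0 (phi : R -> R) : v = 0 ->
  measurable_fun setT phi -> P.-integrable setT (EFin \o (fun x => phi (Y x))) ->
  \int[P]_x phi (Y x) = phi m.
Proof.
move=> ve mphi iphi.
transitivity (\int[P]_x (1 * phi (Y x))).
  by apply: eq_Rintegral => x _; rewrite mul1r.
rewrite (weighted_laws_eq_integrable (m2 := P) (V2 := fun=> m) (Q2 := fun=> 1)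
  mY (measurable_cst _) i1 i1)//.
- by rewrite Rintegral_cst_probability mul1r.
- move=> B mB; rewrite P1// lawY// /gaussian_law ve eqxx diracE.
  by rewrite Rintegral_cst_probability mul1r indicE.
- by rewrite (_ : (fun x => _) = (fun x => phi (Y x)))//; apply/funext => x; rewrite mul1r.
- exact: bounded_integrable (bounded_measurable_cst _).
Qed.

Lemma gaussian_law_expectation (phi : R -> R) : 0 < v ->
  measurable_fun setT phi -> P.-integrable setT (EFin \o (fun x => phi (Y x))) ->
  leb.-integrable setT (EFin \o (fun x => phi x * normal_pdf m (Num.sqrt v) x)) ->
  \int[P]_x phi (Y x) = \int[leb]_x (phi x * normal_pdf m (Num.sqrt v) x).
Proof.
move=> ve mphi iphi iphi2.
transitivity (\int[P]_x (1 * phi (Y x))).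
  by apply: eq_Rintegral => x _; rewrite mul1r.
have id : measurable_fun setT (fun x : R => x) by exact: measurable_id.
rewrite (weighted_laws_eq_integrable (m2 := leb) (V2 := fun x => x)
  mY id i1 (integrable_normal_pdf m (Num.sqrt v)))//.
- by apply: eq_Rintegral => x _; rewrite mulrC.
- move=> B mB; rewrite P1// lawY// /gaussian_law gt_eqF// /normal_prob.
  exact: esym (Rintegral_mul_indic leb (normal_pdf m (Num.sqrt v)) B).
- by rewrite (_ : (fun x => _) = (fun x => phi (Y x)))//; apply/funext => x; rewrite mul1r.
- rewrite (_ : (fun x => _) = (fun x => phi x * normal_pdf m (Num.sqrt v) x))//.
  by apply/funext => x; rewrite mulrC.
Qed.

Lemma gaussian_law_cos (t th : R) :
  \int[P]_x cos (t * Y x + th) = cos (t * m + th) * expR (- (t ^+ 2 * v / 2)).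
Proof.
have bc := bounded_measurable_cos_phase t th mY.
have mc : measurable_fun setT (fun x : R => cos (t * x + th)).
  exact: (bounded_measurable_cos_phase t th (@measurable_id _ R setT)).1.
move: v0; rewrite le_eqVlt => /predU1P[/esym ve|ve].
  rewrite (gaussian_law_expectation0 ve mc (bounded_integrable P bc)).
  by rewrite ve mulr0 mul0r oppr0 expR0 mulr1.
have s0 : 0 < Num.sqrt v by rewrite sqrtr_gt0.
rewrite (gaussian_law_expectation ve mc (bounded_integrable P bc)).
  by rewrite normal_pdf_cos// sqr_sqrtr// ltW.
apply: (integrable_normal_pdf_poly s0 (C := 1)) => // x.
rewrite mul1r (@le_trans _ _ 1)//; last by rewrite lerDl sqr_ge0.
by rewrite ler_norml cos_geN1 cos_le1.
Qed.

Lemma gaussian_law_moments :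
  P.-integrable setT (EFin \o Y) -> P.-integrable setT (EFin \o (fun x => (Y x) ^+ 2)) ->
  \int[P]_x Y x = m /\ \int[P]_x (Y x) ^+ 2 = v + m ^+ 2.
Proof.
move=> iY iY2.
have m2 : measurable_fun setT (fun x : R => x ^+ 2) by exact: measurable_funX.
move: v0; rewrite le_eqVlt => /predU1P[/esym ve|ve].
  split; first exact: (gaussian_law_expectation0 (phi := fun x => x) ve (@measurable_id _ R setT) iY).
  by rewrite (gaussian_law_expectation0 (phi := fun x => x ^+ 2) ve m2 iY2) ve add0r.
have s0 : 0 < Num.sqrt v by rewrite sqrtr_gt0.
set pdf := normal_pdf m (Num.sqrt v).
have pb (g : R -> R) : measurable_fun setT g ->
    (forall x, `|g x| <= 1 * (1 + (x - m) ^+ 2)) ->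
    leb.-integrable setT (EFin \o (fun x => g x * pdf x)).
  exact: (integrable_normal_pdf_poly s0 (C := 1)).
have mxm : measurable_fun setT (fun x : R => x - m) by exact: measurable_funD.
have j1 : leb.-integrable setT (EFin \o (fun x => (x - m) * pdf x)).
  apply: pb => // x; rewrite mul1r -(real_normK (num_real (x - m))).
  by have := sqr_ge0 (`|x - m| - 1); set w := `|_|; nra.
have j2 : leb.-integrable setT (EFin \o (fun x => (x - m) ^+ 2 * pdf x)).
  apply: pb => [|x]; first exact: measurable_funX.
  by rewrite mul1r ger0_norm ?sqr_ge0// lerDr.
have j0 : leb.-integrable setT (EFin \o pdf) := integrable_normal_pdf m (Num.sqrt v).
have e0 : \int[leb]_x pdf x = 1 := Rintegral_normal_pdf m (Num.sqrt v).
have e1 := normal_pdf_mean m s0; have e2 := normal_pdf_variance m s0.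
split.
  have f x : x * pdf x = (x - m) * pdf x + m * pdf x by ring.
  rewrite (gaussian_law_expectation (phi := fun x => x) ve)//.
    rewrite (eq_Rintegral_fun leb f) RintegralD//; last exact: integrable_EFinZ.
    by rewrite RintegralZl// e0 e1 add0r mulr1.
  rewrite (_ : (fun x => _) = (fun x => (x - m) * pdf x + m * pdf x)).
    by apply: integrable_EFinD => //; exact: integrable_EFinZ.
  exact/funext.
have f x : x ^+ 2 * pdf x = (x - m) ^+ 2 * pdf x + (2 * m * ((x - m) * pdf x) + m ^+ 2 * pdf x) by ring.
have k1 := integrable_EFinZ (2 * m) j1; have k0 := integrable_EFinZ (m ^+ 2) j0.
have k := integrable_EFinD k1 k0.
rewrite (gaussian_law_expectation (phi := fun x => x ^+ 2) ve)//.
  rewrite (eq_Rintegral_fun leb f) RintegralD// RintegralD// !RintegralZl// e0 e1 e2.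
  by rewrite sqr_sqrtr ?ltW// mulr0 add0r mulr1.
rewrite (_ : (fun x => _) = (fun x => (x - m) ^+ 2 * pdf x + (2 * m * ((x - m) * pdf x) + m ^+ 2 * pdf x))).
  exact: integrable_EFinD.
exact/funext.
Qed.

End gaussian_law_facts.

(** * Fourier transforms of Brownian bridges *)

Section brownian_bridges.
Context {d : measure_display} {T : measurableType d} {R : realType}.
Variable P : probability T R.
Variables (n : nat) (X : {RV P >-> R}) (beta : 'I_n -> R -> {RV P >-> R}).
Hypothesis bridge : forall i, brownian_bridge (beta i).
Hypothesis indep : mutually_independent P
  (fun o : option 'I_n => if o is Some i
     then sigma_process `[0, 1] (fun u => beta i u : T -> R)
     else sigma_rv X).

Lemma measurable_beta i u : measurable_fun setT (beta i u).
Proof. exact: measurable_funPT. Qed.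
Hint Resolve measurable_beta : core.

Lemma integrable_sqr_beta i u : 0 <= u <= 1 ->
  P.-integrable setT (EFin \o (fun w => (beta i u w) ^+ 2)).
Proof.
move=> u01; have [_ E0 /(_ u u u01 u01) + _] := bridge i.
rewrite covariance.unlock E0//= unlock /= => h.
apply/integrableP; split.
  by apply/measurable_EFinP; exact: measurable_funX.
rewrite (eq_integral (fun w => ((beta i u \- cst 0) w * (beta i u \- cst 0) w)%:E)).
  by move: h; rewrite /= => ->; rewrite ltry.
by move=> w _; rewrite /= subr0 -expr2 ger0_norm ?sqr_ge0.
Qed.

Lemma integrable_beta_mul i u j v : 0 <= u <= 1 -> 0 <= v <= 1 ->
  P.-integrable setT (EFin \o (fun w => beta i u w * beta j v w)).
Proof.
move=> u01 v01; have iu := integrable_sqr_beta i u01.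
have iv := integrable_sqr_beta j v01.
apply: (le_integrable measurableT _ _ (integrable_EFinD iu iv)).
  by apply/measurable_EFinP; exact: measurable_funM.
move=> w _ /=; rewrite lee_fin (ger0_norm (addr_ge0 (sqr_ge0 _) (sqr_ge0 _))).
rewrite normrM -(real_normK (num_real (beta i u w))) -(real_normK (num_real (beta j v w))).
by have := sqr_ge0 (`|beta i u w| - `|beta j v w|); nra.
Qed.

Lemma integrable_beta i u : 0 <= u <= 1 -> P.-integrable setT (EFin \o (beta i u : T -> R)).
Proof.
move=> u01; have iu := integrable_sqr_beta i u01.
have i1 := bounded_integrable P (bounded_measurable_cst (1 : R)).
apply: (le_integrable measurableT _ _ (integrable_EFinD i1 iu)).
  exact/measurable_EFinP.
move=> w _ /=; rewrite lee_fin (ger0_norm (addr_ge0 ler01 (sqr_ge0 _))).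
rewrite -(real_normK (num_real (beta i u w))).
by have := sqr_ge0 (`|beta i u w| - 1); nra.
Qed.

Lemma expectation_beta i u : 0 <= u <= 1 -> \int[P]_w beta i u w = 0.
Proof.
move=> u01; have [_ E0 _ _] := bridge i.
by have := E0 u u01; rewrite unlock /Rintegral => ->.
Qed.

Lemma expectation_beta_mul i u v : 0 <= u <= 1 -> 0 <= v <= 1 ->
  \int[P]_w (beta i u w * beta i v w) = Num.min u v - u * v.
Proof.
move=> u01 v01; have [_ E0 /(_ u v u01 v01) + _] := bridge i.
rewrite covariance.unlock !E0//= unlock /= => h.
rewrite /Rintegral -[RHS]/(fine (Num.min u v - u * v)%:E) -h; congr fine.
apply: eq_integral => w _; congr EFin.
by rewrite -[LHS]/(_ w * _ w) -{1}[beta i u w]subr0 -{1}[beta i v w]subr0.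
Qed.

(** Coordinate, time and coefficient. Combinations of bridge values are encoded by
    lists of terms because lists can be concatenated and rescaled. *)
Definition term : Type := ('I_n * R * R)%type.

Definition lincomb (s : seq term) (w : T) : R :=
  \sum_(p <- s) p.2 * beta p.1.1 p.1.2 w.

Definition term_cov (p q : term) : R :=
  p.2 * q.2 * (if p.1.1 == q.1.1 then Num.min p.1.2 q.1.2 - p.1.2 * q.1.2 else 0).

Definition lincomb_cov (s s' : seq term) : R :=
  \sum_(p <- s) \sum_(q <- s') term_cov p q.

Definition times01 (s : seq term) := forall p, p \in s -> 0 <= p.1.2 <= 1.

Lemma measurable_lincomb s : measurable_fun setT (lincomb s).
Proof.
rewrite /lincomb; apply: (@measurable_sum _ _ _ setT _ s) => p.
exact: measurable_funM.
Qed.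

Lemma lincomb_cat s s' w : lincomb (s ++ s') w = lincomb s w + lincomb s' w.
Proof. by rewrite /lincomb big_cat. Qed.

Definition scale_terms (c : R) (s : seq term) : seq term :=
  [seq (p.1, c * p.2) | p <- s].

Lemma lincomb_scale c s w : lincomb (scale_terms c s) w = c * lincomb s w.
Proof.
rewrite /lincomb big_map mulr_sumr; apply: eq_bigr => p _ /=; ring.
Qed.

Lemma lincomb_cov_catl s1 s2 s : lincomb_cov (s1 ++ s2) s = lincomb_cov s1 s + lincomb_cov s2 s.
Proof. by rewrite /lincomb_cov big_cat. Qed.

Lemma lincomb_covC s s' : lincomb_cov s s' = lincomb_cov s' s.
Proof.
rewrite /lincomb_cov exchange_big; apply: eq_bigr => p _; apply: eq_bigr => q _.
by rewrite /term_cov minC eq_sym; congr (_ * _); [ring|case: ifP => // _; ring].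
Qed.

Lemma lincomb_cov_scalel c s s' : lincomb_cov (scale_terms c s) s' = c * lincomb_cov s s'.
Proof.
rewrite /lincomb_cov big_map mulr_sumr; apply: eq_bigr => p _.
rewrite mulr_sumr; apply: eq_bigr => q _; rewrite /term_cov /=; ring.
Qed.

Lemma times01_cat s s' : times01 s -> times01 s' -> times01 (s ++ s').
Proof. by move=> h h' p; rewrite mem_cat => /orP[/h|/h']. Qed.

Lemma times01_scale c s : times01 s -> times01 (scale_terms c s).
Proof. by move=> h _ /mapP[p /h ? ->]. Qed.

(** The Gaussian law of a combination of values of one bridge is identified by
    its first two moments. *)
Lemma lincomb_cos_single i s t th : times01 s -> (forall p, p \in s -> p.1.1 = i) ->
  \int[P]_w cos (t * lincomb s w + th) = cos th * expR (- (t ^+ 2 * lincomb_cov s s / 2)).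
Proof.
move=> s01 si.
have [gp _ _ _] := bridge i.
have lincombE w : lincomb s w = \sum_(j < size s)
    (nth (i, 0, 0) s j).2 * beta i (nth (i, 0, 0) s j).1.2 w.
  rewrite /lincomb (big_nth (i, 0, 0)) big_mkord; apply: eq_bigr => j _.
  by rewrite (si _ (mem_nth _ (ltn_ord j))).
have [m [v [v0 law]]] := gp (size s) (fun j => (nth (i, 0, 0) s j).1.2)
  (fun j => (nth (i, 0, 0) s j).2) (fun j => ltac:(rewrite /= in_itv/=; exact: s01 _ (mem_nth _ (ltn_ord j)))).
have law' B : measurable B -> P (lincomb s @^-1` B) = gaussian_law m v B.
  move=> mB; rewrite -law//; congr (P (_ @^-1` B)); apply/funext => w; exact: lincombE.
have ib p : p \in s -> P.-integrable setT (EFin \o (fun w => p.2 * beta p.1.1 p.1.2 w)).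
  by move=> ps; apply: integrable_EFinZ; apply: integrable_beta; exact: s01.
have ibb p q : p \in s -> q \in s -> P.-integrable setT
    (EFin \o (fun w => (p.2 * beta p.1.1 p.1.2 w) * (q.2 * beta q.1.1 q.1.2 w))).
  move=> ps qs.
  rewrite (_ : (fun w => _) = (fun w => (p.2 * q.2) * (beta p.1.1 p.1.2 w * beta q.1.1 q.1.2 w))).
    by apply: integrable_EFinZ; apply: integrable_beta_mul; exact: s01.
  by apply/funext => w; ring.
have sumE (r : seq term) (f : term -> T -> R) :
    (forall p, p \in r -> P.-integrable setT (EFin \o f p)) ->
    P.-integrable setT (EFin \o (fun w => \sum_(p <- r) f p w)) /\
    \int[P]_w (\sum_(p <- r) f p w) = \sum_(p <- r) \int[P]_w f p w.
  move=> hr; pose f' p := if p \in r then f p else fun=> 0.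
  have := @Rintegral_sum_seq _ _ _ P _ r f' _.
  have e w : \sum_(p <- r) f p w = \sum_(p <- r) f' p w.
    by apply: eq_big_seq => p pr; rewrite /f' pr.
  have -> : (fun w => \sum_(p <- r) f p w) = (fun w => \sum_(p <- r) f' p w) by exact/funext.
  have -> : \sum_(p <- r) \int[P]_w f p w = \sum_(p <- r) \int[P]_w f' p w.
    by apply: eq_big_seq => p pr; rewrite /f' pr.
  apply => p; rewrite /f'; case: ifPn => [/hr//|_].
  exact: bounded_integrable (bounded_measurable_cst _).
have [iY EY] := sumE s (fun p w => p.2 * beta p.1.1 p.1.2 w) ib.
have iq p : p \in s -> P.-integrable setT (EFin \o (fun w => \sum_(q <- s)
    (p.2 * beta p.1.1 p.1.2 w) * (q.2 * beta q.1.1 q.1.2 w))) by move=> ps; exact: (sumE s _ (fun q => ibb p q ps)).1.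
have [iY2 EY2] := sumE s _ iq.
have sqE w : (lincomb s w) ^+ 2 = \sum_(p <- s) \sum_(q <- s)
    (p.2 * beta p.1.1 p.1.2 w) * (q.2 * beta q.1.1 q.1.2 w).
  rewrite expr2 {1}/lincomb mulr_suml; apply: eq_bigr => p _.
  by rewrite /lincomb mulr_sumr.
have iL2 : P.-integrable setT (EFin \o (fun w => (lincomb s w) ^+ 2)).
  by move: iY2; under eq_fun do rewrite -sqE.
have [Em Ev] := gaussian_law_moments (measurable_lincomb s) v0 law' iY iL2.
have m0 : m = 0.
  rewrite -Em /lincomb EY big_seq big1// => p ps.
  by rewrite RintegralZl ?expectation_beta ?mulr0//; [exact: s01|apply: integrable_beta; exact: s01].
have vE : v = lincomb_cov s s.
  move: Ev; rewrite m0 expr0n/= addr0 => <-.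
  rewrite (eq_Rintegral_fun _ sqE) EY2 /lincomb_cov; apply: eq_big_seq => p ps.
  rewrite (sumE s _ (fun q => ibb p q ps)).2; apply: eq_big_seq => q qs.
  rewrite /term_cov (si p ps) (si q qs) eqxx.
  rewrite -(expectation_beta_mul i (s01 _ ps) (s01 _ qs)) -RintegralZl//.
    by apply: eq_Rintegral => w _; ring.
  by apply: integrable_beta_mul; exact: s01.
by rewrite (gaussian_law_cos (measurable_lincomb s) v0 law') m0 vE mulr0 add0r.
Qed.

Let Fo (o : option 'I_n) : set (set T) := if o is Some i
     then sigma_process `[0, 1] (fun u => beta i u : T -> R)
     else sigma_rv X.

Let Fo_measurable o : Fo o `<=` measurable.
Proof.
case: o => [i|] A /=.
  apply: smallest_sub; first exact: sigma_algebra_measurable.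
  move=> B [u _ [C mC <-]]; rewrite setTI -[X in measurable X]setTI; exact: measurable_funPT.
by move=> [C mC <-]; exact: measurable_funPT.
Qed.

Definition coord_terms i (s : seq term) := [seq p <- s | p.1.1 == i].

Lemma lincomb_coordE s w : lincomb s w = \sum_(i < n) lincomb (coord_terms i s) w.
Proof.
rewrite /lincomb; under [RHS]eq_bigr do rewrite big_filter.
rewrite (exchange_big_dep xpredT)//=; apply: eq_bigr => p _.
by rewrite (bigD1 p.1.1)//= big1 ?addr0// => i /andP[/eqP -> ]; rewrite eqxx.
Qed.

Lemma lincomb_cov_coordE s :
  lincomb_cov s s = \sum_(i < n) lincomb_cov (coord_terms i s) (coord_terms i s).
Proof.
rewrite /lincomb_cov.
transitivity (\sum_(i < n) \sum_(p <- s | p.1.1 == i) \sum_(q <- coord_terms i s) term_cov p q); last first.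
  by apply: eq_bigr => i _; rewrite big_filter.
rewrite [RHS](exchange_big_dep xpredT)//=; apply: eq_bigr => p _.
rewrite (big_pred1 p.1.1) => [|i]; last by rewrite /= eq_sym.
rewrite big_filter [RHS]big_mkcond/=; apply: eq_bigr => q _.
by case: eqP => // /eqP; rewrite /term_cov eq_sym => /negbTE ->; rewrite mulr0.
Qed.

Lemma coord_terms_sub i s p : p \in coord_terms i s -> p \in s.
Proof. by rewrite mem_filter => /andP[]. Qed.

Let Fo_lincomb i s B : times01 s -> measurable B ->
  Fo (Some i) (lincomb (coord_terms i s) @^-1` B).
Proof.
move=> s01; move: B; apply/sigma_measurableP.
have : forall p, p \in coord_terms i s -> measurable_fun
   [set: g_sigma_algebraType (\bigcup_(u in `[0, 1]) sigma_rv (beta i u : T -> R))]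
   (fun w => p.2 * beta p.1.1 p.1.2 w).
  move=> p ps; apply: measurable_funM => //.
  move: (ps); rewrite mem_filter => /andP[/eqP -> /s01 p01].
  apply/sigma_measurableP => B mB; apply: sub_sigma_algebra.
  exists p.1.2; first by rewrite /= in_itv.
  by exists B => //; rewrite setTI.
rewrite /lincomb; elim: (coord_terms i s) => [_|p r IH h].
  rewrite (_ : (fun w => _) = fun=> 0); first exact: measurable_cst.
  by apply/funext => w; rewrite big_nil.
rewrite (_ : (fun w => _) = (fun w => p.2 * beta p.1.1 p.1.2 w + \sum_(q <- r) q.2 * beta q.1.1 q.1.2 w)); last first.
  by apply/funext => w; rewrite big_cons.
apply: measurable_funD.
  by apply: h; rewrite inE eqxx.
by apply: IH => q qr; apply: h; rewrite inE qr orbT.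
Qed.

Let cos_shift (a b : R) : cos (a + (b + pi / 2)) = - sin (a + b).
Proof. by rewrite addrA cosDpihalf. Qed.

(** The coordinates are split off one at a time by the addition formula of the
    cosine; the sine of a combination has mean zero. *)
Lemma lincomb_cos_bounded (q : R -> R) s th : bounded_measurable q -> times01 s ->
  \int[P]_w (q (X w) * cos (lincomb s w + th)) =
  (\int[P]_w q (X w)) * (cos th * expR (- (lincomb_cov s s / 2))).
Proof.
move=> bq s01.
pose L i := lincomb (coord_terms i s).
have mL i : measurable_fun setT (L i) by exact: measurable_lincomb.
have bX : bounded_measurable (fun w => q (X w)) by apply: bounded_measurable_comp.
have key (I J : seq 'I_n) (g : 'I_n -> R -> R) (ph : R) : uniq (I ++ J) ->
    (forall i, bounded_measurable (g i)) ->
    \int[P]_w (q (X w) * \prod_(j <- J) g j (L j w) * cos (\sum_(i <- I) L i w + ph)) =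
    (\int[P]_w q (X w)) * \prod_(j <- J) (\int[P]_w g j (L j w)) *
      (cos ph * \prod_(i <- I) expR (- (lincomb_cov (coord_terms i s) (coord_terms i s) / 2))).
  elim: I J g ph => [|i I IH] J g ph uIJ bg.
    rewrite big_nil mulr1.
    transitivity (cos ph * \int[P]_w (q (X w) * \prod_(j <- J) g j (L j w))).
      rewrite -RintegralZl//.
        by apply: eq_Rintegral => w _; rewrite big_nil add0r mulrC.
      apply: bounded_integrable; apply: bounded_measurableM => //.
      apply: bounded_measurable_prod => j; exact: bounded_measurable_comp.
    rewrite mulrC; congr (_ * _).
    pose f (o : option 'I_n) : T -> R := if o is Some j then fun w => g j (L j w) else fun w => q (X w).
    have := @mutually_independent_prod _ _ _ P _ Fo f indep Fo_measurable _ _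
      (None :: map Some J) [::] (fun=> set0) _ _.
    rewrite !big_nil !mul1r big_cons big_map /= => <-.
    - by apply: eq_Rintegral => w _; rewrite big_nil mul1r big_cons big_map.
    - by case=> [j|] /=; [exact: bounded_measurable_comp|].
    - case=> [j|] B mB /=.
      + apply: (@Fo_lincomb j s (g j @^-1` B)) => //.
        by rewrite -[X in measurable X]setTI; exact: (bg j).1.
      + exists (q @^-1` B); last by rewrite setTI.
        by rewrite -[X in measurable X]setTI; exact: bq.1.
    - rewrite /= (map_inj_uniq (@Some_inj _)); move: uIJ => /= ->; rewrite andbT.
      by apply/negP => /mapP[].
    - by [].
  have uIJ' : uniq (I ++ i :: J).
    by move: uIJ; rewrite -[i :: J]cat1s uniq_catCA.
  have iJ : i \notin J.
    by move: uIJ' ; rewrite cat_uniq /= => /and3P[_ _ /andP[]].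
  pose gc (h : R -> R) j := if j == i then h else g j.
  have bgc h : bounded_measurable h -> forall j, bounded_measurable (gc h j).
    by move=> bh j; rewrite /gc; case: ifP.
  have bcos : bounded_measurable (fun x : R => cos x) by exact: bounded_measurable_cos.
  have bsin : bounded_measurable (fun x : R => sin x) by exact: bounded_measurable_sin.
  have gJ h : \prod_(j <- J) \int[P]_w gc h j (L j w) = \prod_(j <- J) \int[P]_w g j (L j w).
    by apply: eq_big_seq => j jJ; rewrite /gc; case: eqP => // ji; rewrite -ji jJ in iJ.
  have gJw h w : \prod_(j <- J) gc h j (L j w) = \prod_(j <- J) g j (L j w).
    by apply: eq_big_seq => j jJ; rewrite /gc; case: eqP => // ji; rewrite -ji jJ in iJ.
  have h1 := IH (i :: J) (gc (fun x => cos x)) ph uIJ' (bgc _ bcos).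
  have h2 := IH (i :: J) (gc (fun x => sin x)) (ph + pi / 2) uIJ' (bgc _ bsin).
  have c01 : times01 (coord_terms i s) by move=> p /coord_terms_sub /s01.
  have ci p : p \in coord_terms i s -> p.1.1 = i by rewrite mem_filter => /andP[/eqP].
  have Ec : \int[P]_w cos (L i w) = expR (- (lincomb_cov (coord_terms i s) (coord_terms i s) / 2)).
    have := lincomb_cos_single 1 0 c01 ci.
    rewrite cos0 expr1n !mul1r => <-.
    by apply: eq_Rintegral => w _; rewrite addr0 mul1r.
  have Es : \int[P]_w sin (L i w) = 0.
    have := lincomb_cos_single 1 (- (pi / 2)) c01 ci.
    rewrite cosN cos_pihalf mul0r => <-.
    apply: eq_Rintegral => w _; rewrite mul1r.
    by rewrite cosBpihalf.
  move: h1 h2; rewrite !big_cons !gJ /gc eqxx Ec Es => h1 h2.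
  transitivity (\int[P]_w (q (X w) * (\prod_(j <- i :: J) gc (fun x => cos x) j (L j w)) * cos (\sum_(i <- I) L i w + ph)
    + q (X w) * (\prod_(j <- i :: J) gc (fun x => sin x) j (L j w)) * cos (\sum_(i <- I) L i w + (ph + pi / 2)))).
    apply: eq_Rintegral => w _; rewrite !big_cons !gJw /gc eqxx.
    rewrite -[L i w + _ + ph]addrA cosD cos_shift; ring.
  have mS : measurable_fun setT (fun w => \sum_(i <- I) L i w).
    exact: measurable_sum.
  have bI h c : (forall j, bounded_measurable (h j)) -> P.-integrable setT (EFin \o (fun w =>
      q (X w) * (\prod_(j <- i :: J) h j (L j w)) * cos (\sum_(i <- I) L i w + c))).
    move=> bh; apply: bounded_integrable; apply: bounded_measurableM.
      apply: bounded_measurableM => //; apply: (bounded_measurable_prod _ (f := fun j w => h j (L j w))) => j.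
      exact: bounded_measurable_comp.
    by apply: bounded_measurable_cos; exact: measurable_funD.
  rewrite RintegralD//; [|exact: bI (bgc _ bcos)|exact: bI (bgc _ bsin)].
  rewrite /gc h1 h2; ring.
have := key (index_enum 'I_n) [::] (fun _ => fun=> 0) th.
rewrite cats0 index_enum_uniq => /(_ isT (fun=> bounded_measurable_cst _)) e.
rewrite lincomb_cov_coordE mulrA; move: e; rewrite [in RHS]big_nil mulr1 mulrA.
set rhs := _ * _ * \prod_(i <- _) _ => e.
transitivity rhs.
  by rewrite -e; apply: eq_Rintegral => w _; rewrite big_nil mulr1 lincomb_coordE.
rewrite /rhs; congr (_ * _ * _).
rewrite mulr_suml -sumrN; elim/big_rec2: _ => [|i x y _ ->]; first by rewrite expR0.
by rewrite expRD.
Qed.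

(** Adding independent centred Gaussian noise only damps the Fourier transform:
    the single fact about the bridges that the sequel relies on. *)
Lemma lincomb_cos (q : R -> R) s k th : bounded_measurable q -> times01 s ->
  \int[P]_w (q (X w) * cos (k * X w + lincomb s w + th)) =
  \int[P]_w (q (X w) * cos (k * X w + th)) * expR (- (lincomb_cov s s / 2)).
Proof.
move=> bq s01.
have bc : bounded_measurable (fun x : R => q x * cos (k * x)).
  apply: bounded_measurableM => //; apply: bounded_measurable_cos; exact: measurable_funM.
have bs : bounded_measurable (fun x : R => q x * sin (k * x)).
  apply: bounded_measurableM => //; apply: bounded_measurable_sin; exact: measurable_funM.
have h1 := lincomb_cos_bounded th bc s01.
have h2 := lincomb_cos_bounded (th + pi / 2) bs s01.
have bl c : bounded_measurable (fun w => cos (lincomb s w + c)).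
  by apply: bounded_measurable_cos; apply: measurable_funD => //; exact: measurable_lincomb.
have bcX : bounded_measurable (fun w => q (X w) * cos (k * X w)) by exact: (bounded_measurable_comp (V := X) _ bc).
have bsX : bounded_measurable (fun w => q (X w) * sin (k * X w)) by exact: (bounded_measurable_comp (V := X) _ bs).
transitivity (\int[P]_w (q (X w) * cos (k * X w) * cos (lincomb s w + th) +
   q (X w) * sin (k * X w) * cos (lincomb s w + (th + pi / 2)))).
  apply: eq_Rintegral => w _; rewrite -addrA [in LHS]cosD cos_shift.
  by ring.
rewrite RintegralD//; [|exact: bounded_integrable (bounded_measurableM _ _)..].
rewrite h1 h2.
rewrite [X in _ = X * _](_ : _ = \int[P]_w (cos th * (q (X w) * cos (k * X w)) +
    - sin th * (q (X w) * sin (k * X w)))); last first.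
  by apply: eq_Rintegral => w _; rewrite cosD; ring.
rewrite RintegralD//; [|apply: integrable_EFinZ; exact: bounded_integrable..].
rewrite !RintegralZl//; [|exact: bounded_integrable..].
rewrite cosDpihalf; ring.
Qed.

End brownian_bridges.

(** * Observation up to deterministic times *)

Lemma cosM_phase {R : realType} (a b : R) :
  cos a * cos b = 2^-1 * cos (a + b) + 2^-1 * cos (a - b).
Proof. by rewrite cosD cosB; field. Qed.

Section fourier_rectangles.
Context {d : measure_display} {T : measurableType d} {R : realType}.
Variable P : probability T R.

(** Indicators are exchanged for cosines one variable at a time. *)
Lemma fourier_rectangles (I : eqType) (V : I -> T -> R) :
  (forall k, measurable_fun setT (V k)) ->
  forall (s : seq I) (Q : T -> R) (B : I -> set R), uniq s ->
  bounded_measurable Q -> (forall k, measurable (B k)) ->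
  (forall (a : I -> R) th,
    \int[P]_w (Q w * cos (\sum_(k <- s) a k * V k w + th)) = 0) ->
  \int[P]_w (Q w * \prod_(k <- s) \1_(B k) (V k w)) = 0.
Proof.
move=> mV; elim=> [|k s IH] Q B us bQ mB h0.
  rewrite -[RHS](h0 (fun=> 0) 0); apply: eq_Rintegral => w _.
  by rewrite !big_nil addr0 cos0.
move: us => /= /andP[ks us].
have bk : bounded_measurable (fun w => \1_(B k) (V k w) : R).
  by apply: bounded_measurable_comp => //; exact: bounded_measurable_indic.
transitivity (\int[P]_w (Q w * \1_(B k) (V k w) * \prod_(j <- s) \1_(B j) (V j w))).
  by apply: eq_Rintegral => w _; rewrite big_cons mulrA.
apply: IH => //; first exact: bounded_measurableM.
move=> a th.
have mS (b : I -> R) c : measurable_fun setT (fun w => \sum_(j <- s) b j * V j w + c).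
  apply: measurable_funD => //; apply: measurable_sum => j; exact: measurable_funM.
have bc : bounded_measurable (fun w => cos (\sum_(j <- s) a j * V j w + th)).
  exact: bounded_measurable_cos.
have b0 : bounded_measurable (fun _ : T => 0 : R) by exact: bounded_measurable_cst.
have bQc := bounded_measurableM bQ bc.
transitivity (\int[P]_w (Q w * cos (\sum_(j <- s) a j * V j w + th) * \1_(B k) (V k w))).
  by apply: eq_Rintegral => w _; rewrite mulrAC.
rewrite (@fourier_uniqueness _ _ _ _ _ P P (V k) (V k) _ (fun=> 0) (mV k) (mV k)
  (bounded_integrable P bQc) (bounded_integrable P b0) _ (\1_(B k)))//; last 2 first.
- move=> t th'.
  rewrite [RHS](_ : _ = 0); last first.
    by under eq_Rintegral do rewrite mul0r; rewrite Rintegral_cst_probability.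
  pose up (e : R) j := if j == k then e else a j.
  have eup e w : \sum_(j <- k :: s) up e j * V j w = e * V k w + \sum_(j <- s) a j * V j w.
    rewrite big_cons /up eqxx; congr (_ + _); apply: eq_big_seq => j js.
    by case: eqP => // jk; rewrite -jk js in ks.
  transitivity (\int[P]_w (2^-1 * (Q w * cos (\sum_(j <- k :: s) up t j * V j w + (th + th'))) +
      2^-1 * (Q w * cos (\sum_(j <- k :: s) up (- t) j * V j w + (th - th'))))).
    apply: eq_Rintegral => w _; rewrite !eup -mulrA cosM_phase.
    rewrite [in RHS](_ : t * V k w + _ + (th + th') = \sum_(j <- s) a j * V j w + th + (t * V k w + th')); last by ring.
    rewrite [in RHS](_ : - t * V k w + _ + (th - th') = \sum_(j <- s) a j * V j w + th - (t * V k w + th')); last by ring.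
    ring.
  have bS e c : bounded_measurable (fun w => Q w * cos (\sum_(j <- k :: s) up e j * V j w + c)).
    apply: bounded_measurableM => //; apply: bounded_measurable_cos.
    apply: measurable_funD => //; apply: measurable_sum => j; exact: measurable_funM.
  rewrite RintegralD//; [|apply: integrable_EFinZ; apply: bounded_integrable; exact: bS..].
  rewrite !RintegralZl//; [|apply: bounded_integrable; exact: bS..].
  by rewrite !h0 !mulr0 addr0.
- exact: bounded_measurable_indic.
by under eq_Rintegral do rewrite mul0r; rewrite Rintegral_cst_probability.
Qed.

End fourier_rectangles.

Section static.
Context {d : measure_display} {T : measurableType d} {R : realType}.
Variable P : probability T R.
Variables (n : nat) (X : {RV P >-> R}) (sigma : 'I_n -> R)
  (beta : 'I_n -> R -> {RV P >-> R}).
Hypothesis sigma_gt0 : forall i, 0 < sigma i.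
Hypothesis bridge : forall i, brownian_bridge (beta i).
Hypothesis indep : mutually_independent P
  (fun o : option 'I_n => if o is Some i
     then sigma_process `[0, 1] (fun u => beta i u : T -> R)
     else sigma_rv X).
Local Notation xi := (information X sigma beta).
Local Notation leb := (@lebesgue_measure R).
Local Notation lin := (lincomb beta).
Local Notation K := (@lincomb_cov R n).

Lemma measurable_information i u : measurable_fun setT (xi i u).
Proof.
by apply: measurable_funD; apply: measurable_funM => //; exact: measurable_funPT.
Qed.

(** Likelihood of the value x of X when a variable of law N (c X, c) takes the
    value s, up to a factor that does not depend on x. *)
Definition weight (c s x : R) : R := expR (x * s - c * x ^+ 2 / 2).

(** For c = 0 nothing has been observed, and s vanishes almost surely. *)
Definition posterior (psi : R -> R) (c s : R) : R :=
  if c == 0 then \int[P]_w psi (X w) else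
  (\int[P]_w (psi (X w) * weight c s (X w))) / \int[P]_w weight c s (X w).

Lemma weight_gt0 c s x : 0 < weight c s x. Proof. exact: expR_gt0. Qed.

Lemma weight_ub c s x : 0 < c -> weight c s x <= expR (s ^+ 2 / (2 * c)).
Proof.
move=> c0; rewrite ler_expR -subr_ge0.
rewrite (_ : _ - _ = (c * x - s) ^+ 2 / (2 * c)); last by field; rewrite gt_eqF.
by rewrite divr_ge0 ?sqr_ge0// mulr_ge0// ltW.
Qed.

Lemma bounded_measurable_weight c s : 0 < c ->
  bounded_measurable (fun w => weight c s (X w)).
Proof.
move=> c0; split; last first.
  exists (expR (s ^+ 2 / (2 * c))) => w; rewrite gtr0_norm ?weight_gt0//.
  exact: weight_ub.
have mX : measurable_fun setT (X : T -> R) by exact: measurable_funPT.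
rewrite /weight; apply: measurableT_comp => //; apply: measurable_funB; first exact: measurable_funM.
by apply: measurable_funM => //; apply: measurable_funM => //; exact: measurable_funX.
Qed.

Lemma Rintegral_gt0 (f : T -> R) : bounded_measurable f -> (forall w, 0 < f w) ->
  0 < \int[P]_w f w.
Proof.
move=> bf f0; have ge0 : 0 <= \int[P]_w f w by apply: Rintegral_ge0 => w _; exact: ltW.
rewrite lt_neqAle ge0 andbT; apply/eqP => E.
have [N [mN PN sub]] := Rintegral_eq0_ae (bounded_integrable P bf) (fun w => ltW (f0 w)) (esym E).
have : P setT = 0%E.
  apply/eqP; rewrite eq_le measure_ge0 andbT -PN le_measure ?inE//.
  by move=> w _; apply: sub => /eqP; rewrite gt_eqF.
by rewrite probability_setT => /eqP; rewrite eqe oner_eq0.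
Qed.

Lemma measurable_posterior {d'} {T' : measurableType d'} (psi : R -> R) (c s : T' -> R) :
  measurable_fun setT psi -> measurable_fun setT c -> measurable_fun setT s ->
  measurable_fun setT (fun w => posterior psi (c w) (s w)).
Proof.
move=> mpsi mc ms.
have mX : measurable_fun setT (fun z : T' * T => X z.2).
  by apply: measurableT_comp measurable_snd; exact: measurable_funPT.
have mw : measurable_fun setT (fun z : T' * T => weight (c z.1) (s z.1) (X z.2)).
  apply: measurableT_comp => //; apply: measurable_funB.
    by apply: measurable_funM => //; exact: measurableT_comp ms measurable_fst.
  apply: measurable_funM => //; apply: measurable_funM => //.
    exact: measurableT_comp mc measurable_fst.
  exact: measurable_funX.
rewrite /posterior; apply: measurable_fun_ifT => //.
  exact: measurable_fun_eqr.
apply: measurable_funM; last first.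
  apply: measurable_funV.
  exact: (measurable_Rintegral_section P mw).
apply: (@measurable_Rintegral_section _ _ _ _ _ P
  (fun z : T' * T => psi (X z.2) * weight (c z.1) (s z.1) (X z.2))).
by apply: measurable_funM => //; exact: measurableT_comp mpsi mX.
Qed.

Lemma posterior_le (psi : R -> R) (M c s : R) : (forall x, `|psi x| <= M) -> measurable_fun setT psi ->
  0 <= c -> `|posterior psi c s| <= M.
Proof.
move=> psiM mpsi c0.
have bX : bounded_measurable (fun w => psi (X w)).
  by apply: bounded_measurable_comp; [exact: measurable_funPT|split => //; exists M].
have bn (f g : T -> R) : bounded_measurable f -> bounded_measurable g ->
    (forall w, `|f w| <= g w) -> `|\int[P]_w f w| <= \int[P]_w g w.
  move=> bf bg fg; apply: (le_trans (le_normr_Rintegral _ (bounded_integrable P bf))) => //.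
  apply: le_Rintegral => //; first by apply: integrable_norm; exact: bounded_integrable.
  exact: bounded_integrable.
rewrite /posterior; case: eqVneq => [_|cn0].
  rewrite -[leRHS](Rintegral_cst_probability P); apply: bn => //.
  exact: bounded_measurable_cst.
have bw := bounded_measurable_weight s (_ : 0 < c).
have {}bw : bounded_measurable (fun w => weight c s (X w)).
  by apply: bw; rewrite lt_neqAle eq_sym cn0.
have D0 : 0 < \int[P]_w weight c s (X w).
  by apply: Rintegral_gt0 => // w; exact: weight_gt0.
rewrite normrM normfV (gtr0_norm D0) ler_pdivrMr//.
rewrite -RintegralZl//; last exact: bounded_integrable.
apply: bn; [exact: bounded_measurableM|exact: (bounded_measurableM (bounded_measurable_cst M) bw)|].
by move=> w; rewrite normrM (gtr0_norm (weight_gt0 _ _ _)) ler_wpM2r// ltW ?weight_gt0.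
Qed.

Lemma bounded_measurable_posterior (psi : R -> R) (c : R) : bounded_measurable psi -> 0 <= c ->
  bounded_measurable (posterior psi c).
Proof.
move=> [mpsi [M hM]] c0; split; last by exists M => s; exact: posterior_le.
exact: (measurable_posterior (c := fun=> c) (s := fun s => s)).
Qed.

Section observation.
Variable r : 'I_n -> R.
Hypothesis r01 : forall i, 0 <= r i < 1.

(** Noise of xi i (r i) has variance sigma i ^ 2 * r i * (1 - r i) and signal
    r i * X: weighting by the signal to noise ratio gives a statistic of law
    N (c X, c) given X, where c is the precision. *)
Definition precision : R := \sum_i r i / (sigma i ^+ 2 * (1 - r i)).

Definition statistic (w : T) : R := \sum_i xi i (r i) w / (sigma i ^+ 2 * (1 - r i)).

Let noise : seq (@term R n) := [seq (i, r i, (sigma i * (1 - r i))^-1) | i <- index_enum 'I_n].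

Let s0 i : sigma i != 0. Proof. by rewrite gt_eqF. Qed.
Let r1 i : 1 - r i != 0. Proof. by rewrite subr_eq0 eq_sym lt_eqF//; case/andP: (r01 i). Qed.

Let noise01 : times01 noise.
Proof. by move=> _ /mapP[i _ ->] /=; have /andP[-> /ltW ->] := r01 i. Qed.

Let statisticE w : statistic w = precision * X w + lin noise w.
Proof.
rewrite /statistic /precision /lincomb big_map mulr_suml -big_split/=.
apply: eq_bigr => i _; rewrite /information; field.
by rewrite s0 r1.
Qed.

Lemma precision_ge0 : 0 <= precision.
Proof.
apply: sumr_ge0 => i _; have /andP[h1 h2] := r01 i.
by rewrite divr_ge0// mulr_ge0 ?sqr_ge0// subr_ge0 ltW.
Qed.

Lemma precision_eq0 : precision = 0 -> forall i, r i = 0.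
Proof.
move=> /eqP; rewrite psumr_eq0 => [/allP h i|i _]; last first.
  have /andP[h1 h2] := r01 i.
  by rewrite divr_ge0// mulr_ge0 ?sqr_ge0// subr_ge0 ltW.
have := h i (mem_index_enum _); rewrite /= mulf_eq0 => /orP[/eqP//|].
by rewrite invr_eq0 mulf_eq0 sqrf_eq0 (negbTE (s0 i)) (negbTE (r1 i)).
Qed.

Let observed (s : seq (@term R n)) := forall p, p \in s -> 0 <= p.1.2 <= r p.1.1.

Let observed01 s : observed s -> times01 s.
Proof.
move=> h p /h /andP[h1 h2]; rewrite h1/= (le_trans h2)// ltW//.
by case/andP: (r01 p.1.1).
Qed.

(** For u <= r, sigma times the bridge value at u has covariance u with the noise
    of the statistic, and u is also the coefficient of X in the information: this makes the statistic sufficient. *)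
Let noise_cov s : observed s -> K s noise = \sum_(p <- s) p.2 * p.1.2 / sigma p.1.1.
Proof.
move=> h; rewrite /lincomb_cov; apply: eq_big_seq => p ps.
rewrite big_map (bigD1 p.1.1)//= big1 => [|i ip]; last first.
  by rewrite /term_cov /= eq_sym (negbTE ip) mulr0.
rewrite /term_cov /= eqxx addr0.
have /andP[h1 h2] := h p ps; rewrite (min_idPl h2); field.
by rewrite s0 r1.
Qed.

Let noise_var : K noise noise = precision.
Proof.
rewrite noise_cov; last by move=> _ /mapP[i _ ->] /=; rewrite lexx; case/andP: (r01 i) => ->.
rewrite big_map; apply: eq_bigr => i _ /=; field.
by rewrite s0 r1.
Qed.

Let bqX (q : R -> R) : bounded_measurable q -> bounded_measurable (fun w => q (X w)).
Proof. by move=> bq; apply: bounded_measurable_comp => //; exact: measurable_funPT. Qed.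

Lemma measurable_statistic : measurable_fun setT statistic.
Proof.
apply: measurable_sum => i; apply: measurable_funM => //; exact: measurable_information.
Qed.

(** Linear combinations uncorrelated with the noise of the statistic behave as
    if independent of the pair formed by X and the statistic. *)
Let residual_independent q phi s th : bounded_measurable q -> bounded_measurable phi ->
  times01 s -> K s noise = 0 ->
  \int[P]_w (q (X w) * phi (statistic w) * cos (lin s w + th)) =
  cos th * expR (- (K s s / 2)) * \int[P]_w (q (X w) * phi (statistic w)).
Proof.
move=> bq bphi s01 ks.
pose e := cos th * expR (- (K s s / 2)).
have bc : bounded_measurable (fun w => cos (lin s w + th)).
  by apply: bounded_measurable_cos; apply: measurable_funD => //; exact: measurable_lincomb.
have mS := measurable_statistic.
have b1 := bounded_measurableM (bqX bq) bc.
have b2 := bounded_measurableM (bounded_measurable_cst e) (bqX bq).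
transitivity (\int[P]_w (q (X w) * cos (lin s w + th) * phi (statistic w))).
  by apply: eq_Rintegral => w _; rewrite mulrAC.
rewrite (@fourier_uniqueness _ _ _ _ _ P P _ statistic _ (fun w => e * q (X w)) mS mS
  (bounded_integrable P b1) (bounded_integrable P b2) _ phi bphi).
  rewrite -RintegralZl//.
    by apply: eq_Rintegral => w _; rewrite mulrA.
  by apply: bounded_integrable; apply: bounded_measurableM; [exact: bqX|exact: bounded_measurable_comp].
move=> t th'.
have half a ph : \int[P]_w (q (X w) * cos (a * statistic w + lin s w + ph)) =
    \int[P]_w (q (X w) * cos (a * precision * X w + ph)) *
    (expR (- (K s s / 2)) * expR (- (a ^+ 2 * precision / 2))).
  have sa01 := times01_cat s01 (times01_scale (c := a) noise01).
  transitivity (\int[P]_w (q (X w) * cos (a * precision * X w + lin (s ++ scale_terms a noise) w + ph))).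
    apply: eq_Rintegral => w _; congr (_ * cos _).
    by rewrite lincomb_cat lincomb_scale statisticE; ring.
  rewrite (lincomb_cos bridge indep)//; congr (_ * _); rewrite -expRD; congr expR.
  rewrite lincomb_cov_catl lincomb_cov_scalel.
  rewrite [K s _]lincomb_covC [K noise (_ ++ _)]lincomb_covC !lincomb_cov_catl !lincomb_cov_scalel.
  rewrite noise_var [K noise s]lincomb_covC ks; ring.
have mSl a : measurable_fun setT (fun w => a * statistic w + lin s w).
  apply: measurable_funD; first exact: measurable_funM.
  exact: measurable_lincomb.
have bh a ph : bounded_measurable (fun w => q (X w) * cos (a * statistic w + lin s w + ph)).
  apply: bounded_measurableM; first exact: bqX.
  by apply: bounded_measurable_cos; exact: measurable_funD.
have bh' a ph : bounded_measurable (fun w => q (X w) * cos (a * X w + ph)).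
  apply: bounded_measurableM; first exact: bqX.
  by apply: bounded_measurable_cos_phase; exact: measurable_funPT.
transitivity (\int[P]_w (2^-1 * (q (X w) * cos (t * statistic w + lin s w + (th + th'))) +
    2^-1 * (q (X w) * cos (- t * statistic w + lin s w + (th - th'))))).
  apply: eq_Rintegral => w _; rewrite -mulrA cosM_phase.
  rewrite [in RHS](_ : t * _ + _ + (th + th') = lin s w + th + (t * statistic w + th')); last by ring.
  rewrite [in RHS](_ : - t * _ + _ + (th - th') = lin s w + th - (t * statistic w + th')); last by ring.
  ring.
rewrite RintegralD//; [|apply: integrable_EFinZ; exact: bounded_integrable..].
rewrite !RintegralZl//; [|exact: bounded_integrable..].
rewrite !half sqrrN.
have h0 := half t th'.
transitivity (e * \int[P]_w (q (X w) * cos (t * precision * X w + th')) * expR (- (t ^+ 2 * precision / 2))).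
  rewrite /e.
  rewrite [in RHS](_ : cos th * _ * _ * _ = (\int[P]_w (cos th * (q (X w) * cos (t * precision * X w + th')))) *
     (expR (- (K s s / 2)) * expR (- (t ^+ 2 * precision / 2)))); last first.
    by rewrite RintegralZl//; [ring|exact: bounded_integrable].
  rewrite !mulrA -mulrDl -mulrDl -!RintegralZl//; [|exact: bounded_integrable..].
  rewrite -RintegralD//; [|apply: integrable_EFinZ; exact: bounded_integrable..].
  congr (_ * _ * _); apply: eq_Rintegral => w _.
  rewrite [in RHS]mulrCA cosM_phase.
  rewrite [in RHS](_ : th + (_ + th') = t * precision * X w + (th + th')); last by ring.
  rewrite [in RHS](_ : th - (_ + th') = - t * precision * X w + (th - th')); last by ring.
  ring.
have := lincomb_cos bridge indep (t * precision) th' bq (times01_scale (c := t) noise01).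
rewrite lincomb_cov_scalel lincomb_covC lincomb_cov_scalel noise_var mulrA -expr2 => E.
rewrite -mulrA -E -RintegralZl//.
  apply: eq_Rintegral => w _; rewrite lincomb_scale statisticE mulrA; congr (_ * cos _).
  ring.
apply: bounded_integrable; apply: bounded_measurableM; first exact: bqX.
apply: bounded_measurable_cos; apply: measurable_funD => //; apply: measurable_funD.
  by apply: measurable_funM => //; exact: measurable_funPT.
exact: measurable_lincomb.
Qed.

Let marginal (q : R -> R) (s : R) : R :=
  \int[P]_w (q (X w) * normal_pdf (precision * X w) (Num.sqrt precision) s).

Let pdf_measurable : 0 < precision ->
  measurable_fun setT (fun z : T * R => normal_pdf (precision * X z.1) (Num.sqrt precision) z.2).
Proof.
move=> c0; have sc0 : 0 < Num.sqrt precision by rewrite sqrtr_gt0.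
rewrite (_ : (fun x => _) = (fun z : T * R => normal_pdf 0 (Num.sqrt precision) (z.2 - precision * X z.1))).
  apply: measurableT_comp (measurable_normal_pdf 0 (Num.sqrt precision)) _.
  apply: measurable_funB => //; apply: measurable_funM => //.
  by apply: (measurableT_comp (measurable_funPT X)); exact: measurable_fst.
by apply/funext => x; rewrite !normal_pdf_expR// subr0.
Qed.

Let pdf_integrable (F : T * R -> R) (M : R) : 0 < precision ->
  measurable_fun setT F -> (forall z, `|F z| <= M) ->
  let G z := F z * normal_pdf (precision * X z.1) (Num.sqrt precision) z.2 in
  [/\ measurable_fun setT G,
    (forall w, leb.-integrable setT (EFin \o (fun s => G (w, s)))),
    (forall s, P.-integrable setT (EFin \o (fun w => G (w, s)))) &
    (\int[P]_w \int[leb]_s `|(G (w, s))%:E| < +oo)%E].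
Proof.
move=> c0 mF FM G; have sc0 : 0 < Num.sqrt precision by rewrite sqrtr_gt0.
have M0 (w : T) (s : R) : 0 <= M by exact: le_trans (normr_ge0 _) (FM (w, s)).
have mG : measurable_fun setT G by apply: measurable_funM => //; exact: pdf_measurable.
have bF1 w : bounded_measurable (fun s => F (w, s)).
  by apply: bounded_measurable_comp; [exact: measurable_pair1|split => //; exists M].
split => //.
- move=> w; rewrite (_ : _ \o _ = EFin \o (fun s => normal_pdf (precision * X w) (Num.sqrt precision) s * F (w, s))).
    exact: (integrable_mul_bounded (integrable_normal_pdf _ _) (bF1 w)).
  by apply/funext => s; rewrite /= /G mulrC.
- move=> s; apply: bounded_integrable; split.
    exact: (measurableT_comp mG (measurable_pair2 s)).
  exists (M * normal_peak (Num.sqrt precision)) => w; rewrite normrM.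
  rewrite ler_pM// ger0_norm ?normal_pdf_ge0// normal_pdf_ub// gt_eqF//.
- apply: (@le_lt_trans _ _ (\int[P]_w M%:E)%E); last first.
    have -> : (\int[P]_w M%:E = M%:E * P setT)%E by exact: integral_cst.
    by rewrite probability_setT mule1 ltry.
  apply: ge0_le_integral => //=.
  + by move=> w _; exact: integral_ge0.
  + apply: (@measurable_fun_fubini_tonelli_F _ _ _ _ _ leb (fun z => `|(G z)%:E|%E)) => //.
    by apply/measurableT_comp => //; exact/measurable_EFinP.
  + move=> w _.
    apply: (@le_trans _ _ (\int[leb]_s (M%:E * (normal_pdf (precision * X w) (Num.sqrt precision) s)%:E))%E).
      apply: ge0_le_integral => //=.
      * apply/measurable_EFinP; apply: measurableT_comp => //.
        exact: (measurableT_comp mG (measurable_pair1 w)).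
      * apply/measurable_EFinP; apply: measurable_funM => //; exact: measurable_normal_pdf.
      * move=> s _; rewrite lee_fin /G normrM (ger0_norm (normal_pdf_ge0 _ _ _)).
        by rewrite ler_wpM2r// normal_pdf_ge0.
    rewrite ge0_integralZl//=.
    * by rewrite integral_normal_pdf mule1.
    * by apply/measurable_EFinP; exact: measurable_normal_pdf.
    * by move=> s _; rewrite lee_fin normal_pdf_ge0.
    * by rewrite lee_fin; exact: M0 0.
Qed.

Let marginal_integrable q : 0 < precision -> bounded_measurable q ->
  leb.-integrable setT (EFin \o marginal q).
Proof.
move=> c0 bq; have [mq [M hM]] := bq.
have mqX : measurable_fun setT (fun z : T * R => q (X z.1)).
  by apply: (measurableT_comp (bqX bq).1); exact: measurable_fst.
have [mG i1 i2 ltG] := pdf_integrable c0 mqX (fun z => hM (X z.1)).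
pose G' (z : R * T) := q (X z.2) * normal_pdf (precision * X z.2) (Num.sqrt precision) z.1.
have mG' : measurable_fun setT G'.
  by have := measurableT_comp mG (@measurable_swap _ _ R T); exact.
have iG := (@integrable21ltyP _ _ _ _ _ leb P _ ((measurable_EFinP _ G').2 mG')).2 ltG.
have := integrable_fubini_F iG.
apply: eq_integrable => // s _; rewrite /fubini_F /= /marginal fineK//.
exact: integrable_fin_num (i2 s).
Qed.

Let statistic_law q phi : 0 < precision -> bounded_measurable q -> bounded_measurable phi ->
  \int[P]_w (q (X w) * phi (statistic w)) = \int[leb]_s (marginal q s * phi s).
Proof.
move=> c0 bq bphi; have sc0 : 0 < Num.sqrt precision by rewrite sqrtr_gt0.
apply: (@fourier_uniqueness _ _ _ _ _ P leb statistic (fun s => s)) => //.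
- exact: measurable_statistic.
- exact: bounded_integrable (bqX bq).
- exact: marginal_integrable.
move=> t th; have [mq [M hM]] := bq.
have := lincomb_cos bridge indep (t * precision) th bq (times01_scale (c := t) noise01).
rewrite lincomb_cov_scalel lincomb_covC lincomb_cov_scalel noise_var mulrA -expr2 => E.
transitivity (\int[P]_w (q (X w) * cos (t * precision * X w + lin (scale_terms t noise) w + th))).
  apply: eq_Rintegral => w _; rewrite lincomb_scale statisticE mulrDr mulrA.
  by congr (_ * cos _); ring.
rewrite E -[RHS]mulr1 -[X in _ = X * _]mulr1.
pose F (z : T * R) := q (X z.1) * cos (t * z.2 + th).
have mF : measurable_fun setT F.
  apply: measurable_funM; first by apply: (measurableT_comp (bqX bq).1); exact: measurable_fst.
  by apply: (bounded_measurable_cos_phase t th (V := snd) _).1; exact: measurable_snd.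
have FM z : `|F z| <= M.
  by rewrite normrM (le_trans _ (hM (X z.1)))// ler_piMr// ler_norml cos_geN1 cos_le1.
have [mG i1 i2 ltG] := pdf_integrable c0 mF FM.
rewrite !mulr1; transitivity (\int[leb]_s \int[P]_w (F (w, s) * normal_pdf (precision * X w) (Num.sqrt precision) s)); last first.
  apply: eq_Rintegral => s _; rewrite /marginal mulrC -RintegralZl//.
    by apply: eq_Rintegral => w _; rewrite /F /=; ring.
  apply: bounded_integrable; apply: bounded_measurableM; first exact: bqX.
  split; first exact: (measurableT_comp (pdf_measurable c0) (measurable_pair2 s)).
  exists (normal_peak (Num.sqrt precision)) => w.
  by rewrite ger0_norm ?normal_pdf_ge0// normal_pdf_ub// gt_eqF.
rewrite -(@Rintegral_fubini _ _ _ _ _ P leb _ mG i1 i2 ltG) mulrC -RintegralZl//; last first.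
  apply: bounded_integrable; apply: bounded_measurableM; first exact: bqX.
  by apply: bounded_measurable_cos_phase; exact: measurable_funPT.
apply: eq_Rintegral => w _ /=.
transitivity (q (X w) * \int[leb]_s (cos (t * s + th) * normal_pdf (precision * X w) (Num.sqrt precision) s)).
  rewrite normal_pdf_cos// (sqr_sqrtr (ltW c0)) [t * (precision * X w)]mulrA.
  ring.
rewrite -RintegralZl//; first by apply: eq_Rintegral => s _; rewrite /F /= mulrA.
apply: (integrable_normal_pdf_poly sc0 (C := 1)) => [|x].
  exact: (bounded_measurable_cos_phase t th (@measurable_id _ R setT)).1.
rewrite mul1r (@le_trans _ _ 1)//; last by rewrite lerDl sqr_ge0.
by rewrite ler_norml cos_geN1 cos_le1.
Qed.

Let statistic_law0 q phi : precision = 0 -> bounded_measurable q -> bounded_measurable phi ->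
  \int[P]_w (q (X w) * phi (statistic w)) = (\int[P]_w q (X w)) * phi 0.
Proof.
move=> c0 bq bphi.
have iq := bounded_integrable P (bqX bq).
rewrite (@fourier_uniqueness _ _ _ _ _ P P statistic (fun=> 0) _ (fun w => q (X w)) measurable_statistic (measurable_cst _) iq iq _ phi bphi).
  by rewrite mulrC -RintegralZl//; apply: eq_Rintegral => w _; rewrite mulrC.
move=> t th.
have := lincomb_cos bridge indep (t * precision) th bq (times01_scale (c := t) noise01).
rewrite lincomb_cov_scalel lincomb_covC lincomb_cov_scalel noise_var c0 !mulr0 mul0r oppr0 expR0 mulr1 => E.
transitivity (\int[P]_w (q (X w) * cos (0 * X w + lin (scale_terms t noise) w + th))).
  apply: eq_Rintegral => w _; rewrite lincomb_scale statisticE c0.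
  by congr (_ * cos _); ring.
by rewrite E; apply: eq_Rintegral => w _; rewrite mul0r.
Qed.

(** Given X the statistic is N (c X, c), whose density at s is the weight times a
    factor free of X; this factor cancels in the posterior. *)
Lemma bayes (psi phi : R -> R) : bounded_measurable psi -> bounded_measurable phi ->
  \int[P]_w (psi (X w) * phi (statistic w)) =
  \int[P]_w (posterior psi precision (statistic w) * phi (statistic w)).
Proof.
move=> bpsi bphi.
have bpost := bounded_measurable_posterior bpsi precision_ge0.
have b1 : bounded_measurable (fun _ : R => 1 : R) by exact: bounded_measurable_cst.
have bpp := bounded_measurableM bpost bphi.
transitivity (\int[P]_w (1 * (posterior psi precision (statistic w) * phi (statistic w)))); last first.
  by apply: eq_Rintegral => w _; rewrite mul1r.
have := precision_ge0; rewrite le_eqVlt => /predU1P[/esym c0|c0].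
  rewrite (statistic_law0 (q := fun=> 1) c0 b1 bpp) statistic_law0//.
  by rewrite /posterior c0 eqxx Rintegral_cst_probability mul1r.
rewrite (statistic_law (q := fun=> 1) c0 b1 bpp) statistic_law//.
have sc0 : 0 < Num.sqrt precision by rewrite sqrtr_gt0.
apply: eq_Rintegral => s _; rewrite mulrA; congr (_ * _).
pose k := normal_peak (Num.sqrt precision) * expR (- (s ^+ 2 / (2 * precision))).
have pdfE x : normal_pdf (precision * x) (Num.sqrt precision) s = k * weight precision s x.
  rewrite normal_pdf_expR// /k /weight -mulrA -expRD; congr (_ * expR _).
  rewrite sqr_sqrtr ?ltW// -[_ *+ 2]mulr_natr; field.
  by rewrite gt_eqF.
have margE q : bounded_measurable q -> marginal q s = k * \int[P]_w (q (X w) * weight precision s (X w)).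
  move=> bq; rewrite /marginal -RintegralZl//.
    by apply: eq_Rintegral => w _; rewrite pdfE mulrCA.
  apply: bounded_integrable; apply: bounded_measurableM; first exact: bqX.
  exact: bounded_measurable_weight.
rewrite !margE// /posterior gt_eqF//.
under [X in _ = k * X * _]eq_Rintegral do rewrite mul1r.
have D0 : 0 < \int[P]_w weight precision s (X w).
  by apply: Rintegral_gt0 => [|w]; [exact: bounded_measurable_weight|exact: weight_gt0].
by move: (\int[P]_w weight _ _ _) D0 => D D0; field; rewrite gt_eqF.
Qed.

Let posterior_orthogonal (psi phi : R -> R) s th :
  bounded_measurable psi -> bounded_measurable phi -> times01 s -> K s noise = 0 ->
  \int[P]_w ((psi (X w) - posterior psi precision (statistic w)) *
     (phi (statistic w) * cos (lin s w + th))) = 0.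
Proof.
move=> bpsi bphi s01 ks.
have bpost := bounded_measurable_posterior bpsi precision_ge0.
have bpp := bounded_measurableM bpost bphi.
have b1 : bounded_measurable (fun _ : R => 1 : R) by exact: bounded_measurable_cst.
have bc : bounded_measurable (fun w => cos (lin s w + th)).
  by apply: bounded_measurable_cos; apply: measurable_funD => //; exact: measurable_lincomb.
have bS (f : R -> R) : bounded_measurable f -> bounded_measurable (fun w => f (statistic w)).
  by move=> bf; apply: bounded_measurable_comp => //; exact: measurable_statistic.
transitivity (\int[P]_w (psi (X w) * phi (statistic w) * cos (lin s w + th) -
   1 * (posterior psi precision (statistic w) * phi (statistic w)) * cos (lin s w + th))).
  by apply: eq_Rintegral => w _; ring.
rewrite RintegralB//; last 2 first.
- apply: bounded_integrable; apply: bounded_measurableM => //.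
  by apply: bounded_measurableM; [exact: bqX|exact: bS].
- apply: bounded_integrable; apply: bounded_measurableM => //.
  by apply: bounded_measurableM; [exact: bounded_measurable_cst|exact: (bS _ bpp)].
rewrite residual_independent// (residual_independent (q := fun=> 1) th b1 bpp s01 ks).
rewrite bayes//; under [X in _ - _ * X]eq_Rintegral do rewrite mul1r.
by rewrite subrr.
Qed.

Lemma information_sumE (s : seq ('I_n * R)) (a : 'I_n * R -> R) w :
  \sum_(k <- s) a k * xi k.1 k.2 w = (\sum_(k <- s) a k * k.2) * X w +
    lin [seq (k.1, k.2, a k * sigma k.1) | k <- s] w.
Proof.
rewrite /lincomb big_map mulr_suml -big_split/=; apply: eq_bigr => k _.
by rewrite /information; ring.
Qed.

(** Sufficiency of the statistic. A combination of past observations has signal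
    coefficient kap equal to its covariance with the noise of the statistic, so
    that after subtracting kap / c times the statistic nothing is left that
    depends on X or is correlated with the statistic. *)
Lemma posterior_rectangles (psi : R -> R) (s : seq ('I_n * R)) (B : 'I_n * R -> set R) :
  bounded_measurable psi -> uniq s -> (forall k, k \in s -> 0 <= k.2 <= r k.1) ->
  (forall k, measurable (B k)) ->
  \int[P]_w ((psi (X w) - posterior psi precision (statistic w)) *
     \prod_(k <- s) \1_(B k) (xi k.1 k.2 w)) = 0.
Proof.
move=> bpsi us sr mB.
have bpost := bounded_measurable_posterior bpsi precision_ge0.
have bQ : bounded_measurable (fun w => psi (X w) - posterior psi precision (statistic w)).
  apply: bounded_measurableB; first exact: bqX.
  by apply: bounded_measurable_comp => //; exact: measurable_statistic.
apply: (fourier_rectangles (V := fun k => xi k.1 k.2)) => // [k|a th].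
  exact: measurable_information.
pose H : seq (@term R n) := [seq (k.1, k.2, a k * sigma k.1) | k <- s].
pose kap := \sum_(k <- s) a k * k.2.
have Hobs : observed H by move=> _ /mapP[k /sr ? ->].
have KH : K H noise = kap.
  rewrite noise_cov// big_map; apply: eq_bigr => k _ /=; field.
  exact: s0.
have kapc : kap / precision * precision = kap.
  have [c0|c0] := eqVneq precision 0; last by rewrite divfK.
  rewrite c0 mulr0 /kap big_seq big1// => k ks; have := sr k ks.
  by rewrite precision_eq0// => /le_anti <-; rewrite mulr0.
pose H' := H ++ scale_terms (- (kap / precision)) noise.
have H'01 : times01 H'.
  by apply: times01_cat; [exact: observed01|exact: times01_scale].
have KH' : K H' noise = 0.
  by rewrite lincomb_cov_catl lincomb_cov_scalel KH noise_var mulNr kapc subrr.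
have E w : \sum_(k <- s) a k * xi k.1 k.2 w + th =
    kap / precision * statistic w + (lin H' w + th).
  rewrite information_sumE lincomb_cat lincomb_scale -/H -/kap statisticE.
  by rewrite mulrDr mulrA kapc; ring.
have bcos : bounded_measurable (fun x : R => cos (kap / precision * x)).
  by apply: bounded_measurable_cos; exact: measurable_funM.
have bsin : bounded_measurable (fun x : R => sin (kap / precision * x)).
  by apply: bounded_measurable_sin; exact: measurable_funM.
have bS (f : R -> R) : bounded_measurable f -> bounded_measurable (fun w => f (statistic w)).
  by move=> bf; apply: bounded_measurable_comp => //; exact: measurable_statistic.
have bl c : bounded_measurable (fun w => cos (lin H' w + c)).
  by apply: bounded_measurable_cos; apply: measurable_funD => //; exact: measurable_lincomb.
transitivity (\int[P]_w ((psi (X w) - posterior psi precision (statistic w)) *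
     (cos (kap / precision * statistic w) * cos (lin H' w + th)) -
   (psi (X w) - posterior psi precision (statistic w)) *
     (sin (kap / precision * statistic w) * cos (lin H' w + (th - pi / 2))))).
  by apply: eq_Rintegral => w _; rewrite E [in LHS]cosD [lin H' w + (th - _)]addrA cosBpihalf; ring.
rewrite RintegralB//.
- by rewrite (posterior_orthogonal th bpsi bcos)// (posterior_orthogonal _ bpsi bsin)// subrr.
- apply: bounded_integrable; apply: bounded_measurableM => //.
  by apply: bounded_measurableM => //; exact: (bS _ bcos).
- apply: bounded_integrable; apply: bounded_measurableM => //.
  by apply: bounded_measurableM => //; exact: (bS _ bsin).
Qed.

End observation.

Section activation.
Variables (t : R) (k : {set 'I_n}) (r : 'I_n -> R).
Hypothesis t01 : 0 < t < 1.
Hypothesis rt : forall i, i \in k -> 0 <= r i < t.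

(** Conditional mean and variance of the jump statistic of the coordinates of k
    at time t, given X and the i-th process up to time r i for i in k. *)
Definition jump_mean (w : T) : R := \sum_(i in k)
  (X w * (t - r i) / ((1 - r i) * (1 - t)) + xi i (r i) w / (1 - r i)) / sigma i ^+ 2.

Definition jump_variance : R := \sum_(i in k)
  (t - r i) / (sigma i ^+ 2 * (1 - t) * (1 - r i)).

Definition jump_stat (w : T) : R := \sum_(i in k) xi i t w / (sigma i ^+ 2 * (1 - t)).

(** Noise of the jump statistic minus its best prediction from the values at the
    times r i; it is uncorrelated with the past. *)
Let innovation : seq (@term R n) :=
  [seq (i, t, (sigma i * (1 - t))^-1) | i <- enum k] ++
  [seq (i, r i, - (sigma i * (1 - r i))^-1) | i <- enum k].

Let s0 i : sigma i != 0. Proof. by rewrite gt_eqF. Qed.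
Let t1 : 1 - t != 0. Proof. by rewrite subr_eq0 eq_sym lt_eqF//; case/andP: t01. Qed.
Let r1 i : i \in k -> 1 - r i != 0.
Proof.
move=> ik; rewrite subr_eq0 eq_sym lt_eqF//; have /andP[_ h] := rt ik.
by rewrite (lt_trans h)//; case/andP: t01.
Qed.

Let innovation01 : times01 innovation.
Proof.
have /andP[t0 tl1] := t01.
move=> p; rewrite mem_cat => /orP[] /mapP[i]; rewrite mem_enum => ik -> /=.
  by rewrite !ltW.
have /andP[-> h] := rt ik; by rewrite /= ltW// (lt_trans h).
Qed.

Let jump_statE w : jump_stat w = jump_mean w + lin innovation w.
Proof.
rewrite /jump_stat /jump_mean lincomb_cat /lincomb !big_map !big_enum /= addrA -!big_split/=.
apply: eq_bigr => i ik; rewrite /information; field.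
by rewrite s0 t1 r1.
Qed.

Lemma jump_variance_ge0 : 0 <= jump_variance.
Proof.
apply: sumr_ge0 => i ik; have /andP[h1 h2] := rt ik; have /andP[h3 h4] := t01.
have h5 := lt_trans h2 h4.
have h6 : 0 <= t - r i by rewrite subr_ge0 ltW.
have h7 : 0 <= 1 - t by rewrite subr_ge0 ltW.
have h8 : 0 <= 1 - r i by rewrite subr_ge0 ltW.
by rewrite divr_ge0// mulr_ge0// mulr_ge0// sqr_ge0.
Qed.

Let past (s : seq (@term R n)) := forall p, p \in s ->
  0 <= p.1.2 <= 1 /\ (p.1.1 \in k -> p.1.2 <= r p.1.1).

Let innovation_cov s : past s -> K s innovation = 0.
Proof.
move=> h; rewrite /lincomb_cov big_seq big1// => p ps.
have [/andP[u0 u1] ur] := h p ps.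
rewrite big_cat/= !big_map -big_split/= big_enum_cond/=.
apply: big1 => i /andP[ik _]; rewrite /term_cov /=; case: eqP => [pi|_]; last by rewrite !mulr0 addr0.
rewrite -pi in ik *; have /andP[h1 h2] := rt ik.
rewrite (min_idPl (ur ik)) (min_idPl (le_trans (ur ik) (ltW h2))); field.
by rewrite s0 t1 r1.
Qed.

Let innovation_var : K innovation innovation = jump_variance.
Proof.
rewrite {1}/innovation lincomb_cov_catl addrC.
have -> : K [seq (i, r i, - (sigma i * (1 - r i))^-1) | i <- enum k] innovation = 0.
  apply: innovation_cov => p /mapP[i]; rewrite mem_enum => ik -> /=.
  have /andP[h1 h2] := rt ik; have /andP[h3 h4] := t01.
  by split => //; rewrite h1/= ltW// (lt_trans h2).
rewrite add0r /lincomb_cov big_map big_enum/=; apply: eq_bigr => i ik.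
rewrite big_cat/= !big_map !big_enum/= (bigD1 i)//= [X in _ + X](bigD1 i)//=.
rewrite big1 => [|j /andP[_ ji]]; last by rewrite /term_cov /= eq_sym (negbTE ji) mulr0.
rewrite [X in _ + (_ + X)]big1 => [|j /andP[_ ji]]; last by rewrite /term_cov /= eq_sym (negbTE ji) mulr0.
have /andP[h1 h2] := rt ik.
rewrite /term_cov /= eqxx minxx (min_idPr (ltW h2)) !addr0; field.
by rewrite s0 t1 r1.
Qed.

Lemma measurable_jump_mean : measurable_fun setT jump_mean.
Proof.
rewrite /jump_mean; under eq_fun do rewrite -big_enum.
apply: measurable_sum => i; apply: measurable_funM => //.
apply: measurable_funD; apply: measurable_funM => //; last exact: measurable_information.
by apply: measurable_funM => //; exact: measurable_funPT.
Qed.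

Lemma measurable_jump_stat : measurable_fun setT jump_stat.
Proof.
rewrite /jump_stat; under eq_fun do rewrite -big_enum.
apply: measurable_sum => i; apply: measurable_funM => //; exact: measurable_information.
Qed.

(** Given X and the past, the jump statistic is its predicted mean plus an
    independent innovation, which damps the Fourier transform. *)
Lemma jump_stat_rectangles (q : R -> R) (s : seq ('I_n * R)) (B : 'I_n * R -> set R) (l th : R) :
  bounded_measurable q -> uniq s ->
  (forall p, p \in s -> 0 <= p.2 <= 1 /\ (p.1 \in k -> p.2 <= r p.1)) ->
  (forall p, measurable (B p)) ->
  \int[P]_w (q (X w) * (cos (l * jump_stat w + th) -
      cos (l * jump_mean w + th) * expR (- (l ^+ 2 * jump_variance / 2))) *
     \prod_(p <- s) \1_(B p) (xi p.1 p.2 w)) = 0.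
Proof.
move=> bq us sr mB.
have bqX : bounded_measurable (fun w => q (X w)).
  by apply: bounded_measurable_comp => //; exact: measurable_funPT.
have bc1 := bounded_measurable_cos_phase l th measurable_jump_stat.
have bc2 := bounded_measurable_cos_phase l th measurable_jump_mean.
pose e := expR (- (l ^+ 2 * jump_variance / 2)).
have bQ : bounded_measurable (fun w => q (X w) * (cos (l * jump_stat w + th) -
      cos (l * jump_mean w + th) * e)).
  apply: bounded_measurableM => //; apply: bounded_measurableB => //.
  by apply: bounded_measurableM => //; exact: bounded_measurable_cst.
apply: (fourier_rectangles (V := fun p => xi p.1 p.2)) => // [p|a ph].
  exact: measurable_information.
(* Every linear combination of X and of past values has the same mean cosine
   after adding the innovation, up to the factor e. *)
have key a' c ph' : c ^+ 2 = l ^+ 2 ->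
    \int[P]_w (q (X w) * cos (c * jump_stat w + \sum_(p <- s) a' p * xi p.1 p.2 w + ph')) =
    e * \int[P]_w (q (X w) * cos (c * jump_mean w + \sum_(p <- s) a' p * xi p.1 p.2 w + ph')).
  move=> cl.
  pose kap := \sum_(p <- s) a' p * p.2 +
    \sum_(i in k) c * ((t - r i) / ((1 - r i) * (1 - t)) + r i / (1 - r i)) / sigma i ^+ 2.
  have [H [E Hpast]] : exists H, (forall w, c * jump_mean w +
      \sum_(p <- s) a' p * xi p.1 p.2 w = kap * X w + lin H w) /\ past H.
    exists ([seq (p.1, p.2, a' p * sigma p.1) | p <- s] ++
      [seq (i, r i, c / (1 - r i) / sigma i) | i <- enum k]); split=> [w|p].
      rewrite information_sumE lincomb_cat /kap addrCA mulrDl -addrA; congr (_ + _).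
      rewrite addrC [in RHS]addrCA; congr (_ + _).
      rewrite /lincomb big_map big_enum/= mulr_suml -big_split/= /jump_mean mulr_sumr.
      apply: eq_bigr => i ik; rewrite /information; field.
      by rewrite s0 t1 r1.
    rewrite mem_cat => /orP[/mapP[p' /sr ? ->]//|/mapP[i]].
    rewrite mem_enum => ik -> /=; have /andP[h1 h2] := rt ik; have /andP[h3 h4] := t01.
    by split => //; rewrite h1/= ltW// (lt_trans h2).
  have H01 : times01 H by move=> p /Hpast[].
  transitivity (\int[P]_w (q (X w) * cos (kap * X w + lin (H ++ scale_terms c innovation) w + ph'))).
    apply: eq_Rintegral => w _; congr (_ * cos _).
    rewrite jump_statE lincomb_cat lincomb_scale addrA -E; ring.
  rewrite (lincomb_cos bridge indep)//; last exact: times01_cat H01 (times01_scale innovation01).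
  rewrite lincomb_cov_catl lincomb_cov_scalel [K H _]lincomb_covC [K innovation (_ ++ _)]lincomb_covC.
  rewrite !lincomb_cov_catl !lincomb_cov_scalel [K innovation H]lincomb_covC (innovation_cov Hpast).
  rewrite innovation_var !(mulr0, addr0, add0r) mulrA -expr2 cl.
  transitivity (e * (\int[P]_w (q (X w) * cos (kap * X w + ph')) * expR (- (K H H / 2)))).
    by rewrite mulrDl opprD expRD /e; ring.
  rewrite -(lincomb_cos bridge indep)//; congr (_ * _); apply: eq_Rintegral => w _.
  by rewrite E.
have mS (f : T -> R) c a' ph' : measurable_fun setT f -> bounded_measurable
    (fun w => q (X w) * cos (c * f w + \sum_(p <- s) a' p * xi p.1 p.2 w + ph')).
  move=> mf; apply: bounded_measurableM => //; apply: bounded_measurable_cos.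
  apply: measurable_funD => //; apply: measurable_funD; first exact: measurable_funM.
  apply: measurable_sum => p; apply: measurable_funM => //; exact: measurable_information.
have half (f : T -> R) : measurable_fun setT f ->
    \int[P]_w (q (X w) * cos (l * f w + th) * cos (\sum_(p <- s) a p * xi p.1 p.2 w + ph)) =
    2^-1 * \int[P]_w (q (X w) * cos (l * f w + \sum_(p <- s) a p * xi p.1 p.2 w + (th + ph))) +
    2^-1 * \int[P]_w (q (X w) * cos (- l * f w + \sum_(p <- s) a p * xi p.1 p.2 w + (ph - th))).
  move=> mf.
  rewrite -!RintegralZl//; [|apply: bounded_integrable; exact: mS..].
  rewrite -RintegralD//; [|apply: integrable_EFinZ; apply: bounded_integrable; exact: mS..].
  apply: eq_Rintegral => w _; rewrite -mulrA [cos (l * _ + _) * _]mulrC cosM_phase.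
  rewrite [in RHS](_ : l * f w + _ + (th + ph) = \sum_(p <- s) a p * xi p.1 p.2 w + ph + (l * f w + th)); last by ring.
  rewrite [in RHS](_ : - l * f w + _ + (ph - th) = \sum_(p <- s) a p * xi p.1 p.2 w + ph - (l * f w + th)); last by ring.
  ring.
have bca : bounded_measurable (fun w => cos (\sum_(p <- s) a p * xi p.1 p.2 w + ph)).
  apply: bounded_measurable_cos; apply: measurable_funD => //.
  apply: measurable_sum => p; apply: measurable_funM => //; exact: measurable_information.
transitivity (\int[P]_w (q (X w) * cos (l * jump_stat w + th) * cos (\sum_(p <- s) a p * xi p.1 p.2 w + ph) -
   e * (q (X w) * cos (l * jump_mean w + th) * cos (\sum_(p <- s) a p * xi p.1 p.2 w + ph)))).
  by apply: eq_Rintegral => w _; rewrite -/e; ring.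
have i1 : P.-integrable setT (EFin \o (fun w => q (X w) * cos (l * jump_stat w + th) * cos (\sum_(p <- s) a p * xi p.1 p.2 w + ph))).
  by apply: bounded_integrable; apply: bounded_measurableM => //; exact: bounded_measurableM.
have i2 : P.-integrable setT (EFin \o (fun w => q (X w) * cos (l * jump_mean w + th) * cos (\sum_(p <- s) a p * xi p.1 p.2 w + ph))).
  by apply: bounded_integrable; apply: bounded_measurableM => //; exact: bounded_measurableM.
rewrite RintegralB//; last exact: integrable_EFinZ.
rewrite RintegralZl// (half _ measurable_jump_stat) (half _ measurable_jump_mean).
by rewrite !key ?sqrrN//; ring.
Qed.

End activation.
End static.

(** * Freezing the modulator *)

Section mixture.
Context {d : measure_display} {T : measurableType d} {R : realType}.
Variable P : probability T R.

Lemma prod_indic (I : eqType) (s : seq I) (B : I -> set R) (f : I -> R) :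
  \prod_(i <- s) \1_(B i) (f i) = (`[< forall i, i \in s -> B i (f i) >])%:R :> R.
Proof.
elim: s => [|i s IH].
  by rewrite big_nil asboolT.
rewrite big_cons IH indicE -natrM mulnb; congr ((nat_of_bool _)%:R).
apply/andP/asboolP => [[/set_mem Bi /asboolP h] j|h].
  by rewrite inE => /predU1P[->//|/h].
split; first by apply/mem_set/h; rewrite mem_head.
by apply/asboolP => j js; apply: h; rewrite inE js orbT.
Qed.

(** Averaging over a discrete variable k independent of everything f depends
    on otherwise: it is enough to treat each value of k separately. *)
Lemma independent_mixture (FJ GX : set (set T)) (Y : finType) (k : T -> Y)
    (f : T -> T -> R) :
  independent P FJ <<s GX >> -> FJ `<=` measurable ->
  (forall y, FJ (k @^-1` [set y])) ->
  (forall w w', k w = k w' -> f w = f w') ->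
  (forall w, bounded_measurable (f w)) ->
  (forall w, measurable_fun [set: g_sigma_algebraType GX] (f w)) ->
  (forall w, \int[P]_x f w x = 0) ->
  \int[P]_x f x x = 0.
Proof.
move=> ind FJm FJk fk bf mf f0.
pose F y w : R := if pselect (exists w0, k w0 = y) is left h
  then \1_(k @^-1` [set y]) w * f (projT1 (cid h)) w else 0.
have FE y w0 : k w0 = y -> F y = fun w => \1_(k @^-1` [set y]) w * f w0 w.
  move=> e; rewrite /F; case: pselect => [h|]; last by case; exists w0.
  by apply/funext => w; case: (cid h) => w1 /= e1; rewrite (fk w1 w0)// e1.
have F0 y : ~ (exists w0, k w0 = y) -> F y = fun=> 0.
  by move=> h; apply/funext => w; rewrite /F; case: pselect.
have mk y : measurable (k @^-1` [set y]) by exact/FJm/FJk.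
have bF y : bounded_measurable (F y).
  have [[w0 e]|/F0->] := pselect (exists w0, k w0 = y); last exact: bounded_measurable_cst.
  by rewrite (FE _ _ e); apply: bounded_measurableM => //; exact: bounded_measurable_indic.
transitivity (\int[P]_x (\sum_(y <- enum Y) F y x)).
  apply: eq_Rintegral => w _; rewrite big_enum/= (bigD1 (k w))//= (FE _ w)//.
  rewrite indicE mem_set// mul1r big1 ?addr0// => y yk.
  have [[w0 e]|/F0->//] := pselect (exists w0, k w0 = y).
  by rewrite (FE _ _ e) indicE memNset ?mul0r//= => e'; rewrite e' eqxx in yk.
rewrite (Rintegral_sum_seq _ (fun y => bounded_integrable P (bF y))).2.
apply: big1 => y _.
have [[w0 e]|/F0->] := pselect (exists w0, k w0 = y); last exact: Rintegral_cst_probability.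
rewrite (FE _ _ e).
pose E := k @^-1` [set y].
have bE : bounded_measurable (\1_E : T -> R) by exact: (bounded_measurable_indic (mk y)).
have bc := @bounded_measurable_cst _ T R (fine (P E)).
rewrite (weighted_laws_eq_integrable (bf w0).1 (bf w0).1 (bounded_integrable P bE)
  (bounded_integrable P bc) (phi := idfun))//.
- transitivity (fine (P E) * \int[P]_x f w0 x); last by rewrite f0 mulr0.
  by rewrite -RintegralZl//; exact: bounded_integrable (bf w0).
- move=> B mB; have mfB : measurable (f w0 @^-1` B).
    by rewrite -[X in measurable X]setTI; exact: (bf w0).1.
  have mfB' : <<s GX >> (f w0 @^-1` B) by apply: (sigma_measurableP GX (f w0)).2.
  transitivity (\int[P]_x \1_(E `&` f w0 @^-1` B) x).
    by apply: eq_Rintegral => x _; rewrite indicI; congr (_ * _).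
  rewrite Rintegral_indic; last exact: (measurableI _ _ (mk y) mfB).
  transitivity (fine (P E) * fine (P (f w0 @^-1` B))).
    have f1 := fin_num_measure P _ (mk y); have f2 := fin_num_measure P _ mfB.
    by rewrite -(fineM f1 f2); exact: (f_equal fine (ind _ _ (FJk y) mfB')).
  transitivity (fine (P E) * \int[P]_x \1_(f w0 @^-1` B) x).
    by rewrite Rintegral_indic.
  by rewrite -RintegralZl//; exact: bounded_integrable (bounded_measurable_indic mfB).
- exact: measurable_id.
- exact: bounded_integrable (bounded_measurableM bE (bf w0)).
- exact: bounded_integrable (bounded_measurableM bc (bf w0)).
Qed.

End mixture.

Section modulation.
Context {d : measure_display} {T : measurableType d} {R : realType}.
Variable P : probability T R.
Variables (n : nat) (X : {RV P >-> R}) (sigma : 'I_n -> R)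
  (beta : 'I_n -> R -> {RV P >-> R}) (J : 'I_n -> R -> {RV P >-> bool}).
Hypothesis sigma_gt0 : forall i, 0 < sigma i.
Hypothesis bridge : forall i, brownian_bridge (beta i).
Hypothesis indep : mutually_independent P
  (fun o : option 'I_n => if o is Some i
     then sigma_process `[0, 1] (fun u => beta i u : T -> R)
     else sigma_rv X).
Local Notation xi := (information X sigma beta).
Local Notation sigmaJ := (<<s \bigcup_(i in [set: 'I_n]) sigma_process `[0, 1] (J i) >>).
Local Notation gensX := (sigma_rv X `|`
  \bigcup_(i in [set: 'I_n]) sigma_process `[0, 1] (xi i)).
Hypothesis indepJ : independent P sigmaJ <<s gensX >>.

(** What the observer sees: the information process is hidden while the modulator
    is off. *)
Definition observed i u w : R := (J i u w)%:R * xi i u w.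

(** The constraint on the observed value may depend on the state of the modulator,
    so that one family of sets covers the values of both processes. *)
Definition cylinder (S : seq R) (D : 'I_n -> R -> bool -> set R) : set T :=
  [set w | forall i u, u \in S -> D i u (J i u w) (observed i u w)].

(** The value 0 when the coordinate is never on at a time of S is harmless: the
    information processes vanish at time 0. *)
Definition last_seen (S : seq R) (i : 'I_n) (w : T) : R :=
  \big[Num.max/0]_(u <- S | J i u w) u.

Lemma last_seen_ge S i w u : u \in S -> J i u w -> u <= last_seen S i w.
Proof.
move=> uS Ju; rewrite /last_seen; elim: S uS => // v S IH.
rewrite inE big_cons => /predU1P[<-|/IH {}IH].
  by rewrite Ju le_max lexx.
by case: ifP => // _; rewrite le_max IH orbT.
Qed.

Lemma last_seen_ind (K : R -> Prop) S i w : K 0 ->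
  (forall u, u \in S -> J i u w -> K u) -> K (last_seen S i w).
Proof.
move=> K0 KS; rewrite /last_seen big_seq_cond.
by elim/big_rec: _ => // u x /andP[uS Ju] Kx; rewrite /Num.max; case: ifP => // _; exact: KS.
Qed.

Lemma last_seen_ge0 S i w : 0 <= last_seen S i w.
Proof.
rewrite /last_seen; elim/big_rec: _ => // u x _ x0.
by rewrite le_max x0 orbT.
Qed.

Lemma sigmaJ_measurable : sigmaJ `<=` measurable.
Proof.
apply: smallest_sub; first exact: sigma_algebra_measurable.
move=> A [i _]; apply: smallest_sub; first exact: sigma_algebra_measurable.
by move=> B [u _ [C mC <-]]; exact: measurable_funPT.
Qed.

Lemma sigmaJ_process i u (B : set bool) : 0 <= u <= 1 -> sigmaJ (J i u @^-1` B).
Proof.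
move=> u01; apply: sub_sigma_algebra; exists i => //; apply: sub_sigma_algebra.
exists u; first by rewrite /= in_itv.
by exists B => //; rewrite setTI.
Qed.

Lemma gensX_X : measurable_fun [set: g_sigma_algebraType gensX] (X : T -> R).
Proof.
apply: (sigma_measurableP gensX (X : T -> R)).1 => B mB.
by apply: sub_sigma_algebra; left; exists B => //; rewrite setTI.
Qed.

Lemma gensX_xi i u : 0 <= u <= 1 ->
  measurable_fun [set: g_sigma_algebraType gensX] (xi i u).
Proof.
move=> u01; apply: (sigma_measurableP gensX (xi i u)).1 => B mB.
apply: sub_sigma_algebra; right; exists i => //; apply: sub_sigma_algebra.
exists u; first by rewrite /= in_itv.
by exists B => //; rewrite setTI.
Qed.

Let pairs (S : seq R) : seq ('I_n * R) := [seq (i, u) | i <- enum 'I_n, u <- undup S].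

Let pairs_uniq S : uniq (pairs S).
Proof.
apply: allpairs_uniq; [exact: enum_uniq|exact: undup_uniq|].
by move=> [? ?] [? ?] _ _ [-> ->].
Qed.

Let mem_pairs S i u : ((i, u) \in pairs S) = (u \in S).
Proof.
apply/allpairsP/idP => [[[j v] /= [_ vS [_ ->]]]|uS]; first by rewrite mem_undup in vS.
by exists (i, u); rewrite mem_enum mem_undup.
Qed.

Let live (S : seq R) (w : T) := [seq p <- pairs S | J p.1 p.2 w].

(** A coordinate that is off shows the value 0. *)
Let idle S (D : 'I_n -> R -> bool -> set R) (w : T) : R :=
  \prod_(p <- pairs S | ~~ J p.1 p.2 w) \1_(D p.1 p.2 false) 0.

Let pattern (S : seq R) (w : T) : {ffun 'I_n * 'I_(size S) -> bool} :=
  [ffun p : 'I_n * 'I_(size S) => J p.1 (S`_p.2)%R w].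

Let pattern_eq S w w' : pattern S w = pattern S w' ->
  forall i u, u \in S -> J i u w = J i u w'.
Proof.
move=> /ffunP h i u uS; have jS : (index u S < size S)%N by rewrite index_mem.
by have := h (i, Ordinal jS); rewrite !ffunE /= nth_index.
Qed.

Let sigmaJ_pattern S y : {in S, forall u, 0 <= u <= 1} -> sigmaJ (pattern S @^-1` [set y]).
Proof.
move=> S01.
have -> : pattern S @^-1` [set y] = \bigcap_(p in [set: 'I_n * 'I_(size S)])
    J p.1 (S`_p.2)%R @^-1` [set y p].
  apply/seteqP; split => [w /= <- p _ /=|w h]; first by rewrite ffunE.
  by apply/ffunP => p; rewrite ffunE; exact: (h p I).
apply: (@fin_bigcap_measurable _ (g_sigma_algebraType _)) => // p _.
by apply: sigmaJ_process; apply: S01; rewrite mem_nth.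
Qed.

Let last_seen_eq S w w' : pattern S w = pattern S w' ->
  (fun i => last_seen S i w) = (fun i => last_seen S i w').
Proof.
move=> e; apply/funext => i; rewrite /last_seen big_seq_cond [RHS]big_seq_cond.
by apply: eq_bigl => u; apply: andb_id2l => uS; rewrite (pattern_eq e).
Qed.

Let live_eq S w w' : pattern S w = pattern S w' -> live S w = live S w'.
Proof.
move=> e; apply: eq_in_filter => -[i u]; rewrite mem_pairs => uS.
exact: (pattern_eq e _ uS).
Qed.

Let idle_eq S D w w' : pattern S w = pattern S w' -> idle S D w = idle S D w'.
Proof.
move=> e; rewrite /idle big_seq_cond [RHS]big_seq_cond; apply: eq_bigl => -[i u].
by rewrite mem_pairs; apply: andb_id2l => uS; rewrite (pattern_eq e).
Qed.

Let indic_cylinder S D w : \1_(cylinder S D) w =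
  idle S D w * \prod_(p <- live S w) \1_(D p.1 p.2 true) (xi p.1 p.2 w).
Proof.
transitivity (\prod_(p <- pairs S) \1_(D p.1 p.2 (J p.1 p.2 w)) (observed p.1 p.2 w) : R).
  rewrite (prod_indic (pairs S) (fun p => D p.1 p.2 (J p.1 p.2 w)) (fun p => observed p.1 p.2 w)) indicE.
  congr ((nat_of_bool _)%:R); apply/idP/idP => [/set_mem h|/asboolP h].
    by apply/asboolP => -[i u]; rewrite mem_pairs; exact: h.
  by apply/mem_set => i u uS; apply: (h (i, u)); rewrite mem_pairs.
rewrite (bigID (fun p => J p.1 p.2 w))/= mulrC; congr (_ * _).
  by apply: eq_bigr => p /negbTE Jp; rewrite /observed Jp mul0r.
by rewrite big_filter; apply: eq_bigr => p Jp; rewrite /observed Jp mul1r.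
Qed.

Let bounded_live S D w0 : (forall i u b, measurable (D i u b)) ->
  bounded_measurable (fun w => \prod_(p <- live S w0) \1_(D p.1 p.2 true) (xi p.1 p.2 w) : R).
Proof.
move=> mD; apply: (bounded_measurable_prod _ (f := fun p w => \1_(D p.1 p.2 true) (xi p.1 p.2 w))) => p.
apply: bounded_measurable_comp; first exact: measurable_information.
exact: bounded_measurable_indic.
Qed.

Let gensX_live S D w0 : (forall i u b, measurable (D i u b)) ->
  {in S, forall u, 0 <= u <= 1} ->
  measurable_fun [set: g_sigma_algebraType gensX]
    (fun w => \prod_(p <- live S w0) \1_(D p.1 p.2 true) (xi p.1 p.2 w) : R).
Proof.
move=> mD S01.
have : {subset live S w0 <= pairs S} by move=> p; rewrite mem_filter => /andP[].
elim: (live S w0) => [|[i u] s IH] sub.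
  rewrite (_ : (fun w => _) = fun=> 1); first exact: measurable_cst.
  by apply/funext => w; rewrite big_nil.
have sub' : {subset s <= pairs S} by move=> p ps; apply: sub; rewrite inE ps orbT.
have u01 : 0 <= u <= 1 by apply: S01; rewrite -(mem_pairs S i); apply: sub; rewrite mem_head.
rewrite (_ : (fun w => _) = (fun w => \1_(D i u true) (xi i u w) *
    \prod_(p <- s) \1_(D p.1 p.2 true) (xi p.1 p.2 w))); last first.
  by apply/funext => w; rewrite big_cons.
apply: measurable_funM; last exact: IH.
by apply: (measurableT_comp (measurable_indic (mD i u true))); exact: gensX_xi.
Qed.

(** The modulator being independent of X and of the information processes, it
    may be frozen, which turns a cylinder into a rectangle of observations. *)
Lemma mixture_cylinder (S : seq R) (D : 'I_n -> R -> bool -> set R)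
    (Y : finType) (k : T -> Y) (h : Y -> ('I_n -> R) -> T -> R) :
  {in S, forall u, 0 <= u <= 1} -> (forall i u b, measurable (D i u b)) ->
  (forall y, sigmaJ (k @^-1` [set y])) ->
  (forall w, bounded_measurable (h (k w) (last_seen S ^~ w))) ->
  (forall w, measurable_fun [set: g_sigma_algebraType gensX] (h (k w) (last_seen S ^~ w))) ->
  (forall w s, uniq s -> (forall p, p \in s -> p.2 \in S /\ p.2 <= last_seen S p.1 w) ->
     \int[P]_x (h (k w) (last_seen S ^~ w) x *
       \prod_(p <- s) \1_(D p.1 p.2 true) (xi p.1 p.2 x)) = 0) ->
  \int[P]_w (h (k w) (last_seen S ^~ w) w * \1_(cylinder S D) w) = 0.
Proof.
move=> S01 mD sk bh mh h0.
pose f w0 w := idle S D w0 * (h (k w0) (last_seen S ^~ w0) w *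
  \prod_(p <- live S w0) \1_(D p.1 p.2 true) (xi p.1 p.2 w)).
transitivity (\int[P]_w f w w).
  by apply: eq_Rintegral => w _; rewrite indic_cylinder mulrCA.
apply: (independent_mixture (k := fun w => (k w, pattern S w)) indepJ).
- exact: sigmaJ_measurable.
- move=> [y z]; rewrite (_ : _ @^-1` _ = k @^-1` [set y] `&` pattern S @^-1` [set z]).
    exact: (@measurableI _ (g_sigma_algebraType (\bigcup_(i in [set: 'I_n])
      sigma_process `[0, 1] (J i))) _ _ (sk y) (sigmaJ_pattern _ S01)).
  by apply/seteqP; split => w /= [-> ->].
- move=> w w' [e1 e2]; apply/funext => x; rewrite /f.
  by rewrite (idle_eq _ e2) (live_eq e2) (last_seen_eq e2) e1.
- move=> w; apply: bounded_measurableM; first exact: bounded_measurable_cst.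
  by apply: bounded_measurableM => //; exact: bounded_live.
- move=> w; apply: measurable_funM; first exact: measurable_cst.
  by apply: measurable_funM => //; exact: gensX_live.
- move=> w; rewrite RintegralZl//; last first.
    by apply: bounded_integrable; apply: bounded_measurableM => //; exact: bounded_live.
  rewrite h0 ?mulr0//; first by rewrite filter_uniq.
  move=> [i u]; rewrite mem_filter mem_pairs => /andP[Jp uS]; split => //.
  exact: last_seen_ge.
Qed.

Lemma posterior_cylinder t S D (psi : R -> R) : 0 <= t < 1 ->
  {in S, forall u, 0 <= u <= t} -> (forall i u b, measurable (D i u b)) ->
  bounded_measurable psi ->
  \int[P]_w ((psi (X w) - posterior X psi (precision sigma (last_seen S ^~ w))
     (statistic X sigma beta (last_seen S ^~ w) w)) * \1_(cylinder S D) w) = 0.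
Proof.
move=> /andP[t0 t1] St mD bpsi.
have S01 : {in S, forall u, 0 <= u <= 1}.
  by move=> u /St /andP[-> ut]; rewrite (le_trans ut)// ltW.
have r01 w i : 0 <= last_seen S i w < 1.
  apply/andP; split; first exact: last_seen_ge0.
  apply: (last_seen_ind (K := fun x => x < 1)) => // u /St /andP[_ ut] _.
  exact: le_lt_trans t1.
have bpost w := bounded_measurable_posterior X bpsi (precision_ge0 sigma (r01 w)).
apply: (mixture_cylinder (k := fun=> tt) (h := fun _ r w => psi (X w) -
    posterior X psi (precision sigma r) (statistic X sigma beta r w))) => //.
- move=> y; rewrite (_ : _ @^-1` _ = setT); first exact: (@measurableT _ (g_sigma_algebraType _)).
  by apply/seteqP; split => // w _; case: y.
- move=> w; apply: bounded_measurableB.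
    by apply: bounded_measurable_comp => //; exact: measurable_funPT.
  apply: bounded_measurable_comp => //; exact: measurable_statistic.
- move=> w; apply: measurable_funB.
    by apply: (measurableT_comp bpsi.1); exact: gensX_X.
  apply: (measurableT_comp (bpost w).1).
  apply: measurable_sum => i; apply: measurable_funM; last exact: measurable_cst.
  by apply: gensX_xi; have /andP[-> /ltW] := r01 w i.
- move=> w s us sS; apply: (posterior_rectangles sigma_gt0 bridge indep (r01 w) bpsi us) => //.
  by move=> p /sS[/St /andP[-> _] ->].
Qed.

Lemma jump_stat_cylinder t S D (k : T -> {set 'I_n}) (q : {set 'I_n} -> R -> R) l th :
  0 < t < 1 -> {in S, forall u, 0 <= u < t} ->
  (forall i u b, measurable (D i u b)) -> (forall y, sigmaJ (k @^-1` [set y])) ->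
  (forall y, bounded_measurable (q y)) ->
  \int[P]_w (q (k w) (X w) * (cos (l * jump_stat X sigma beta t (k w) w + th) -
      cos (l * jump_mean X sigma beta t (k w) (last_seen S ^~ w) w + th) *
      expR (- (l ^+ 2 * jump_variance sigma t (k w) (last_seen S ^~ w) / 2)))
    * \1_(cylinder S D) w) = 0.
Proof.
move=> t01 St mD sk bq; have /andP[t0 t1] := t01.
have S01 : {in S, forall u, 0 <= u <= 1}.
  by move=> u /St /andP[-> ut]; rewrite ltW// (lt_trans ut).
have rt w i : 0 <= last_seen S i w < t.
  apply/andP; split; first exact: last_seen_ge0.
  by apply: (last_seen_ind (K := fun x => x < t)) => // u /St /andP[_ ut] _.
apply: (mixture_cylinder (k := k) (h := fun y r w =>
  q y (X w) * (cos (l * jump_stat X sigma beta t y w + th) -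
      cos (l * jump_mean X sigma beta t y r w + th) *
      expR (- (l ^+ 2 * jump_variance sigma t y r / 2))))) => //.
- move=> w; apply: bounded_measurableM.
    by apply: bounded_measurable_comp => //; exact: measurable_funPT.
  apply: bounded_measurableB.
    by apply: bounded_measurable_cos_phase; exact: measurable_jump_stat.
  apply: bounded_measurableM; last exact: bounded_measurable_cst.
  by apply: bounded_measurable_cos_phase; exact: measurable_jump_mean.
- move=> w.
  have mX := gensX_X.
  have mx i u : 0 <= u < t -> measurable_fun [set: g_sigma_algebraType gensX] (xi i u).
    by move=> /andP[u0 ut]; apply: gensX_xi; rewrite u0 ltW// (lt_trans ut).
  apply: measurable_funM; first exact: (measurableT_comp (bq _).1 mX).
  apply: measurable_funB.
    apply: (bounded_measurable_cos_phase l th (V := _ : g_sigma_algebraType gensX -> R) _).1.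
    rewrite (_ : jump_stat _ _ _ _ _ = (fun x => \sum_(i <- enum (k w))
        xi i t x / (sigma i ^+ 2 * (1 - t)))); last first.
      by apply/funext => x; rewrite big_enum.
    apply: measurable_sum => i; apply: measurable_funM; last exact: measurable_cst.
    by apply: gensX_xi; rewrite !ltW.
  apply: measurable_funM; last exact: measurable_cst.
  apply: (bounded_measurable_cos_phase l th (V := _ : g_sigma_algebraType gensX -> R) _).1.
  rewrite (_ : jump_mean _ _ _ _ _ _ = (fun x => \sum_(i <- enum (k w))
      (X x * (t - last_seen S i w) / ((1 - last_seen S i w) * (1 - t)) +
       xi i (last_seen S i w) x / (1 - last_seen S i w)) / sigma i ^+ 2)); last first.
    by apply/funext => x; rewrite big_enum.
  apply: measurable_sum => i; apply: measurable_funM; last exact: measurable_cst.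
  apply: measurable_funD; apply: measurable_funM; try exact: measurable_cst.
    by apply: measurable_funM => //; exact: measurable_cst.
  exact: mx.
- move=> w s us sS; apply: (jump_stat_rectangles sigma_gt0 bridge indep t01 _ _ _ (bq _) us) => //.
  by move=> p /sS[/S01 ? ?].
Qed.

End modulation.

(** * Paths, grids and limits of posterior means *)

Section sequences.
Context {R : realType}.

Lemma cvg_sum_seq (I : Type) (s : seq I) (Q : pred I) (f : I -> nat -> R) (l : I -> R) :
  (forall i, f i @ \oo --> l i) ->
  (fun N => \sum_(i <- s | Q i) f i N) @ \oo --> \sum_(i <- s | Q i) l i.
Proof.
move=> fl; elim: s => [|i s IH].
  by under eq_fun do rewrite big_nil; rewrite big_nil; exact: cvg_cst.
rewrite big_cons; under eq_fun do rewrite big_cons.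
by case: ifP => // _; apply: cvgD.
Qed.

Lemma near_infty_inv (e : R) : 0 < e -> \forall N \near \oo, N.+1%:R^-1 < e.
Proof.
move=> e0; have [n _ hn] := near_infty_natSinv_lt (PosNum e0).
by exists n => // N /hn.
Qed.

Lemma cvg_seqP (f : nat -> R) (l : R) :
  f @ \oo --> l <-> forall e, 0 < e -> \forall N \near \oo, `|l - f N| < e.
Proof. by split=> [/cvgrPdist_lt|h]; last exact/cvgrPdist_lt. Qed.

Definition grid (t : R) (N : nat) : seq R :=
  [seq t * (k%:R / N.+1%:R) | k <- iota 0 N.+1].

Lemma grid_itv t N u : 0 < t -> u \in grid t N -> 0 <= u < t.
Proof.
move=> t0 /mapP[k]; rewrite mem_iota add0n => /andP[_ kN] ->.
rewrite mulr_ge0 ?divr_ge0 ?ler0n ?ltW//=.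
by rewrite -[ltRHS]mulr1 ltr_pM2l// ltr_pdivrMr ?ltr0n// mul1r ltr_nat.
Qed.

Lemma grid_dense t u v : 0 <= u -> u < v -> v <= t ->
  \forall N \near \oo, exists2 s, s \in grid t N & u <= s < v.
Proof.
move=> u0 uv vt; have t0 : 0 < t by rewrite (le_lt_trans u0)// (lt_le_trans uv).
have e0 : 0 < (v - u) / t by rewrite divr_gt0// subr_gt0.
near=> N.
have hN : N.+1%:R^-1 < (v - u) / t by near: N; exact: near_infty_inv.
have N0 : 0 < N.+1%:R :> R by rewrite ltr0n.
pose x := u / t * N.+1%:R.
have x0 : 0 <= x by rewrite mulr_ge0// divr_ge0// ltW.
pose k := (Num.trunc x).+1.
have [k1 k2] : x <= k%:R /\ k%:R <= x + 1.
  have /andP[h1 h2] := truncn_itv x0.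
  by rewrite ltW//; split => //; rewrite /k -natr1 lerD2r.
have [kx|kx] := eqVneq x (Num.trunc x)%:R.
  exists (t * ((Num.trunc x)%:R / N.+1%:R)).
    apply/mapP; exists (Num.trunc x) => //; rewrite mem_iota add0n /=.
    rewrite -(ltr_nat R) -kx /x -[ltRHS]mul1r ltr_pM2r//.
    by rewrite ltr_pdivrMr// mul1r (lt_le_trans uv).
  by rewrite -kx /x mulfK ?gt_eqF// mulrC divfK ?gt_eqF// lexx.
have le1 : u <= t * (k%:R / N.+1%:R).
  rewrite -ler_pdivrMl// mulrC ler_pdivlMr//.
have lt1 : t * (k%:R / N.+1%:R) < v.
  have : k%:R / N.+1%:R <= u / t + N.+1%:R^-1.
    by rewrite ler_pdivrMr// mulrDl mulVf ?gt_eqF.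
  rewrite -ltr_pdivlMl// => h; rewrite (le_lt_trans h)//.
  have -> : t^-1 * v = u / t + (v - u) / t by rewrite mulrBl addrC subrK mulrC.
  by rewrite ltrD2l.
exists (t * (k%:R / N.+1%:R)); last by rewrite le1.
apply/mapP; exists k => //; rewrite mem_iota add0n /= -(ltr_nat R).
have := lt_le_trans lt1 vt; rewrite -[ltRHS]mulr1 ltr_pM2l//.
by rewrite ltr_pdivrMr// mul1r.
Unshelve. all: by end_near. Qed.

End sequences.

Section boolean_paths.
Context {R : realType}.
Implicit Types f : R -> bool.

Lemma cadlag_bool_right f u : cadlag f -> 0 <= u < 1 ->
  exists2 e, 0 < e & forall v, u <= v < u + e -> f v = f u.
Proof.
move=> [h _] u01; have /discrete_cvg := h u u01.
move=> /nbhs_ballP[e /= e0 he]; exists e => // v /andP[uv ve].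
have [->//|vu] := eqVneq v u.
have ltuv : u < v by rewrite lt_neqAle eq_sym vu.
apply: he => //; rewrite /ball/= distrC ger0_norm ?subr_ge0//.
by rewrite ltrBlDl.
Qed.

Lemma cadlag_bool_left f t : cadlag f -> 0 < t <= 1 ->
  exists2 e, 0 < e & forall v, t - e < v < t -> f v = left_limit f t.
Proof.
move=> [_ h] t01; have := h t t01; rewrite /left_limit; have /andP[-> _] := t01.
move=> /discrete_cvg.
move=> /nbhs_ballP[e /= e0 he]; exists e => // v /andP[ve vt].
apply: he => //; rewrite /ball/= ger0_norm ?subr_ge0 ?ltW//.
by rewrite ltrBlDr addrC -ltrBlDr.
Qed.

(** For I = [0, t] this is the latest active time of the modulator, whereas
    I = [0, t[ ignores what happens at t. *)
Definition last_time (I : set R) f : R :=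
  Num.max 0 (sup [set u | I u /\ f u]).

Variables (I : set R) (t : R).
Hypothesis It : forall u, I u -> 0 <= u <= t.

Lemma last_time_ge0 f : 0 <= last_time I f.
Proof. by rewrite le_max lexx. Qed.

Let ubI f : has_ubound [set u | I u /\ f u].
Proof. by exists t => u [/It /andP[]]. Qed.

Lemma last_time_ge f u : I u -> f u -> u <= last_time I f.
Proof. by move=> Iu fu; rewrite le_max (ub_le_sup (ubI f)) ?orbT. Qed.

Lemma last_time_adherent f x : 0 <= x -> x < last_time I f ->
  exists u, [/\ I u, f u & x < u].
Proof.
move=> x0; rewrite lt_max ltNge x0 /= => xs.
have hs : has_sup [set u | I u /\ f u].
  split; last exact: ubI.
  apply/set0P/eqP => e; move: xs; rewrite e sup0 => /(le_lt_trans x0).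
  by rewrite ltxx.
have e0 : 0 < sup [set u | I u /\ f u] - x by rewrite subr_gt0.
have [u [Iu fu]] := sup_adherent e0 hs.
by rewrite opprB addrCA subrr addr0 => xu; exists u.
Qed.

Lemma last_time_ub f x : 0 <= x -> (forall u, I u -> f u -> u <= x) ->
  last_time I f <= x.
Proof.
move=> x0 h; rewrite leNgt; apply/negP => /(last_time_adherent x0)[u [Iu fu]].
by rewrite ltNge h.
Qed.

Lemma last_time_le f : 0 <= t -> last_time I f <= t.
Proof. by move=> t0; apply: last_time_ub => // u /It /andP[]. Qed.

Section sampling.
Context {d : measure_display} {T : measurableType d} {P : probability T R}.
Variables (n : nat) (J : 'I_n -> R -> {RV P >-> bool}) (i : 'I_n) (w : T).
Hypothesis cadJ : cadlag (fun u => J i u w).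
Variable S : nat -> seq R.
Hypotheses (t1 : t <= 1) (SI : forall N u, u \in S N -> I u)
  (S_end : forall u, I u -> u < t \/ forall N, u \in S N)
  (S_dense : forall u v, 0 <= u -> u < v -> v <= t ->
     \forall N \near \oo, exists2 s, s \in S N & u <= s < v).

Lemma last_seen_le_last_time N :
  last_seen J (S N) i w <= last_time I (fun u => J i u w).
Proof.
apply: (last_seen_ind (K := fun x => x <= _)); first exact: last_time_ge0.
move=> u /SI Iu Ju; exact: (last_time_ge Iu Ju).
Qed.

(** Right-continuity of the path makes every time at which it is on visible
    from a fine grid. *)
Lemma last_seen_cvg : last_seen J (S N) i w @[N --> \oo] -->
  last_time I (fun u => J i u w).
Proof.
apply/cvg_seqP => e e0; set l := last_time _ _.
have [l0|l0] := lerP l (e / 2).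
  apply: nearW => N; have h1 := last_seen_le_last_time N.
  have h2 := last_seen_ge0 J (S N) i w.
  rewrite -/l in h1; rewrite ger0_norm ?subr_ge0//.
  apply: (@le_lt_trans _ _ l); first by rewrite gerBl.
  by rewrite (le_lt_trans l0)// ltr_pdivrMr// ltr_pMr// ltr1n.
have [u [Iu Ju lu]] : exists u, [/\ I u, J i u w & l - e / 2 < u].
  apply: (last_time_adherent (f := fun u => J i u w)); first by rewrite subr_ge0 ltW.
  by rewrite -/l gtrBl divr_gt0.
have fin N s : s \in S N -> J i s w -> u <= s -> `|l - last_seen J (S N) i w| < e.
  move=> sS Js us; have h1 := last_seen_le_last_time N; rewrite -/l in h1.
  have h2 := last_seen_ge (u := s) sS Js.
  rewrite ger0_norm ?subr_ge0//.
  have : e / 2 < e by rewrite ltr_pdivrMr// ltr_pMr// ltr1n.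
  lra.
have /andP[u0 ut] := It Iu.
have [ult|uS] := S_end Iu; last by apply: nearW => N; exact: (fin N u).
have u01 : 0 <= u < 1 by rewrite u0 (lt_le_trans ult).
have [e' e'0 he'] := cadlag_bool_right cadJ u01.
have uv : u < Num.min t (u + e') by rewrite lt_min ult ltrDl.
have vt : Num.min t (u + e') <= t by rewrite ge_min lexx.
near=> N.
have [s sS /andP[us sv]] : exists2 s, s \in S N & u <= s < Num.min t (u + e').
  by near: N; exact: S_dense.
apply: (fin N s) => //; rewrite he' ?us//.
by move: sv; rewrite lt_min => /andP[].
Unshelve. all: by end_near. Qed.

End sampling.
End boolean_paths.

Section posterior_limits.
Context {d : measure_display} {T : measurableType d} {R : realType}.
Variables (P : probability T R) (X : {RV P >-> R}).

Lemma cvg_weight (c_ s_ : nat -> R) (c s x : R) : c_ @ \oo --> c -> s_ @ \oo --> s ->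
  weight (c_ N) (s_ N) x @[N --> \oo] --> weight c s x.
Proof.
move=> cc ss; rewrite /weight; apply: (@cvg_comp _ _ _ (fun N => x * s_ N - c_ N * x ^+ 2 / 2) expR _ _ _ _ (@continuous_expR R _)).
apply: cvgB; first exact: cvgMl_tmp.
by apply: cvgMr_tmp; exact: cvgMr_tmp.
Qed.

Lemma weight_ub_near (c s c' s' x : R) : 0 < c -> c / 2 < c' -> `|s'| < `|s| + 1 ->
  weight c' s' x <= expR ((`|s| + 1) ^+ 2 / c).
Proof.
move=> c0 cc ss; have c'0 : 0 < c' by rewrite (lt_trans _ cc)// divr_gt0.
apply: (le_trans (weight_ub _ _ c'0)); rewrite ler_expR.
apply: ler_pM; [exact: sqr_ge0|by rewrite invr_ge0 mulr_ge0// ltW| |].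
  by rewrite -(real_normK (num_real s')) lerXn2r ?nnegrE// ltW.
rewrite lef_pV2 ?posrE ?mulr_gt0//; lra.
Qed.

(** Without observation, c = 0 and s = 0; along the approximations used below,
    c vanishes in the limit only if it vanishes from some point on, so that the
    loss of domination of the weights at c = 0 does no harm. *)
Lemma posterior_cvg (psi : R -> R) (c_ s_ : nat -> R) (c s : R) :
  P.-integrable setT (EFin \o (fun w => psi (X w))) ->
  0 <= c -> c_ @ \oo --> c -> s_ @ \oo --> s ->
  (c = 0 -> \forall N \near \oo, c_ N = 0) ->
  posterior X psi (c_ N) (s_ N) @[N --> \oo] --> posterior X psi c s.
Proof.
move=> ipsi c0 cc ss cN0.
have [ce|cn0] := eqVneq c 0.
  apply: cvg_near_cst; have := cN0 ce; apply: filterS => N e.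
  by rewrite /posterior e ce eqxx.
have {}c0 : 0 < c by rewrite lt_neqAle eq_sym cn0.
have near_c : \forall N \near \oo, c / 2 < c_ N /\ `|s_ N| < `|s| + 1.
  near=> N; split.
    have : `|c - c_ N| < c / 2 by near: N; apply: ((cvg_seqP c_ c).1 cc); rewrite divr_gt0.
    by rewrite ltr_norml => /andP[_]; lra.
  have : `|s - s_ N| < 1 by near: N; exact: (cvg_seqP _ _).1 ss _ ltr01.
  have := ler_normB s (s - s_ N); rewrite opprB addrC subrK; lra.
have [N0 _ hN0] := near_c.
rewrite -(cvg_shiftn N0).
have h N : c / 2 < c_ (N + N0)%N /\ `|s_ (N + N0)%N| < `|s| + 1.
  by apply: hN0; rewrite /= leq_addl.
have cN N : 0 < c_ (N + N0)%N by rewrite (lt_trans _ (h N).1)// divr_gt0.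
have ccs : c_ (N + N0)%N @[N --> \oo] --> c by rewrite (cvg_shiftn N0 c_).
have sss : s_ (N + N0)%N @[N --> \oo] --> s by rewrite (cvg_shiftn N0 s_).
have lim Q : P.-integrable setT (EFin \o Q) ->
    \int[P]_w (Q w * weight (c_ (N + N0)%N) (s_ (N + N0)%N) (X w)) @[N --> \oo] -->
    \int[P]_w (Q w * weight c s (X w)).
  move=> iQ; apply: (weighted_bounded_cvg (M := expR ((`|s| + 1) ^+ 2 / c))) => //.
  - by move=> N; exact: (bounded_measurable_weight X _ (cN N)).1.
  - exact: (bounded_measurable_weight X s c0).1.
  - move=> N w; rewrite gtr0_norm ?weight_gt0//; have [h1 h2] := h N.
    exact: weight_ub_near.
  - by apply: aeW => w; exact: cvg_weight.
rewrite /posterior (negbTE cn0).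
rewrite (_ : (fun N => _) = (fun N =>
  (\int[P]_w (psi (X w) * weight (c_ (N + N0)%N) (s_ (N + N0)%N) (X w))) /
   \int[P]_w weight (c_ (N + N0)%N) (s_ (N + N0)%N) (X w))); last first.
  by apply/funext => N; rewrite gt_eqF.
apply: cvgM; first exact: lim.
apply: cvgV.
  rewrite gt_eqF//; apply: Rintegral_gt0 => [|w]; last exact: weight_gt0.
  exact: bounded_measurable_weight.
have := lim (fun=> 1) (bounded_integrable P (bounded_measurable_cst 1)).
under eq_fun do under eq_Rintegral do rewrite mul1r.
by under eq_Rintegral do rewrite mul1r.
Unshelve. all: by end_near. Qed.

Definition trunc (M : nat) (x : R) : R := Num.max (- M%:R) (Num.min M%:R x).

Lemma bounded_trunc M : bounded_measurable (trunc M).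
Proof.
split.
  by apply: measurable_maxr => //; exact: measurable_minr.
exists M%:R => x; rewrite /trunc ler_norml le_max lexx /= ge_max ge_min lexx /=.
by rewrite andbT ge0_cp.
Qed.

Lemma trunc_norm_le M x : `|trunc M x| <= `|x|.
Proof.
have M0 : 0 <= M%:R :> R by rewrite ler0n.
rewrite /trunc ler_norml le_max ge_max le_min ge_min ler_norm !orbT andbT /=.
have h := lerNnormlW (lexx `|x|); have h0 := normr_ge0 x.
apply/andP; split; last lra.
by apply/orP; right; apply/andP; split; lra.
Qed.

Lemma trunc_cvg x : trunc M x @[M --> \oo] --> x.
Proof.
apply: cvg_near_cst; near=> M.
have : `|x| < M%:R by near: M; exact: nbhs_infty_gtr.
rewrite ltr_norml => /andP[h1 h2]; rewrite /trunc (min_idPr (ltW h2)).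
by rewrite (max_idPr (ltW h1)).
Unshelve. all: by end_near. Qed.

Lemma posterior_trunc_cvg c s : P.-integrable setT (EFin \o (X : T -> R)) -> 0 <= c ->
  posterior X (trunc M) c s @[M --> \oo] --> posterior X idfun c s.
Proof.
move=> iX c0.
have lim (q : T -> R) : bounded_measurable q ->
    \int[P]_w (trunc M (X w) * q w) @[M --> \oo] --> \int[P]_w (X w * q w).
  move=> bq; have [B hB] := bq.2.
  have mX : measurable_fun setT (X : T -> R) by exact: measurable_funPT.
  apply: (proj2 (@dominated_cvg_Rintegral _ _ _ P _ _ (fun w => B * `|X w|) _ _ _ _ _)).
  - move=> M; apply: measurable_funM; last exact: bq.1.
    exact: (measurableT_comp (bounded_trunc M).1 mX).
  - by apply: measurable_funM => //; exact: bq.1.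
  - by apply: aeW => w; apply: cvgMr_tmp; exact: trunc_cvg.
  - exact: (integrable_EFinZ B (integrable_norm iX)).
  - by move=> M w; rewrite normrM mulrC ler_pM// trunc_norm_le.
rewrite /posterior; have [ce|cn0] := eqVneq c 0.
  have := lim _ (bounded_measurable_cst 1).
  under eq_fun do under eq_Rintegral do rewrite mulr1.
  by under eq_Rintegral do rewrite mulr1.
apply: cvgMr_tmp; apply: lim; apply: bounded_measurable_weight.
by rewrite lt_neqAle eq_sym cn0.
Qed.

End posterior_limits.

(** * Completed sigma-algebras and observation windows *)

Section null_sets.
Context {d : measure_display} {T : measurableType d} {R : realType}.
Variable P : probability T R.

Lemma Rintegral_negligible (Q : T -> R) (A : set T) : measurable_fun setT Q ->
  measurable A -> P.-negligible A -> \int[P]_w (Q w * \1_A w) = 0.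
Proof.
move=> mQ mA nA; rewrite /Rintegral (_ : (\int[P]_w _)%E = 0%E)//.
rewrite (ae_eq_integral (cst 0%E))//; first by rewrite integral_cst// mul0e.
- by apply/measurable_EFinP; apply: measurable_funM => //; exact: measurable_indic.
- change (P.-negligible (~` [set x | setT x -> ((Q x * \1_A x)%:E = cst 0 x)%E])).
  apply: negligibleS nA => w /= h; apply: contrapT => nAw; apply: h => _.
  by rewrite indicE memNset// mulr0.
Qed.

(** Dynkin's lemma on a complete probability space: adding the negligible sets
    to a class stable by intersection costs nothing. *)
Lemma weighted_eq_complete (C : set (set T)) (Q1 Q2 : T -> R) :
  null_sets P `<=` measurable -> setI_closed C -> C `<=` measurable -> C setT ->
  P.-integrable setT (EFin \o Q1) -> P.-integrable setT (EFin \o Q2) ->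
  (forall A, C A -> \int[P]_w (Q1 w * \1_A w) = \int[P]_w (Q2 w * \1_A w)) ->
  forall A, <<s C `|` null_sets P >> A ->
    \int[P]_w (Q1 w * \1_A w) = \int[P]_w (Q2 w * \1_A w).
Proof.
move=> null_m CI Cm CT i1 i2 CE; have mid := @measurable_id _ T setT.
apply: (@weighted_laws_eq_dynkin _ _ _ _ _ _ _ P P _ _ _ _ mid mid i1 i2 (C `|` null_sets P)).
- move=> B1 B2 [C1|n1] [C2|n2]; [by left; exact: CI|right..].
  + by apply: negligibleS n2 => w [].
  + by apply: negligibleS n1 => w [].
  + by apply: negligibleS n1 => w [].
- by move=> B [/Cm//|/null_m].
- have := CE _ CT; under eq_Rintegral do rewrite indicT mulr1.
  by under [RHS]eq_Rintegral do rewrite indicT mulr1.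
- move=> B [/CE//|nB]; rewrite !Rintegral_negligible//; [|exact: null_m| |exact: null_m].
    exact: integrable_EFin_measurable i2.
  exact: integrable_EFin_measurable i1.
Qed.

(** In a sigma-algebra containing the negligible sets, an almost sure limit of
    measurable functions is measurable. *)
Lemma measurable_ae_cvg (G : set (set T)) (f_ : nat -> T -> R) (f : T -> R) :
  null_sets P `<=` <<s G >> ->
  (forall N, measurable_fun [set: g_sigma_algebraType G] (f_ N)) ->
  {ae P, forall w, f_ ^~ w @ \oo --> f w} ->
  measurable_fun [set: g_sigma_algebraType G] f.
Proof.
move=> nullG mf aef.
pose N0 := ~` [set w | f_ ^~ w @ \oo --> f w].
have nN0 : P.-negligible N0 by [].
have mN0 : measurable (N0 : set (g_sigma_algebraType G)) by exact: nullG.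
pose h : T -> R := fun w => f w * \1_(~` N0) w.
have mh : measurable_fun [set: g_sigma_algebraType G] h.
  apply: (@measurable_fun_cvg _ (g_sigma_algebraType G) R setT
    (fun N w => f_ N w * \1_(~` N0) w)).
    move=> N; apply: measurable_funM => //; apply: measurable_indic.
    exact: measurableC.
  move=> w _; rewrite /h indicE; case: (boolP (w \in ~` N0)) => [/set_mem h1|_].
    by apply: cvgMr_tmp; apply: contrapT => h2; exact: h1.
  rewrite mulr0; under eq_fun do rewrite mulr0.
  exact: cvg_cst.
apply: (sigma_measurableP G f).1 => B mB.
have -> : f @^-1` B = (h @^-1` B `&` ~` N0) `|` (f @^-1` B `&` N0).
  apply/seteqP; split => [w fB|w [[hB nw]|[]//]].
    have [wN|wN] := pselect (N0 w); [by right|left; split => //].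
    by rewrite /preimage /h /= indicE mem_set// mulr1.
  by move: hB; rewrite /preimage /h /= indicE mem_set// mulr1.
apply: (@measurableU _ (g_sigma_algebraType G)).
  apply: (@measurableI _ (g_sigma_algebraType G)).
    exact: (sigma_measurableP G h).2.
  exact: measurableC.
by apply: nullG; apply: negligibleS nN0 => w [].
Qed.

End null_sets.

Section regular_paths.
Context {d : measure_display} {T : measurableType d} {R : realType}.
Variable P : probability T R.
Variables (n : nat) (X : {RV P >-> R}) (sigma : 'I_n -> R)
  (beta : 'I_n -> R -> {RV P >-> R}).
Hypothesis sigma_gt0 : forall i, 0 < sigma i.
Hypothesis bridge : forall i, brownian_bridge (beta i).
Local Notation xi := (information X sigma beta).

Definition regular (w : T) := forall i,
  {within `[0, 1], continuous (fun t => beta i t w)} /\ beta i 0 w = 0.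

(** The bridge starts at 0 because its variance at time 0 is 0. *)
Lemma regular_ae : {ae P, forall w, regular w}.
Proof.
have h i : {ae P, forall w,
    {within `[0, 1], continuous (fun t => beta i t w)} /\ beta i 0 w = 0}.
  have [_ _ _ cont] := bridge i.
  have zero : {ae P, forall w, beta i 0 w = 0}.
    have e0 : 0 <= (0 : R) <= 1 by rewrite lexx ler01.
    have iq := integrable_sqr_beta bridge i e0.
    have z := expectation_beta_mul bridge i e0 e0; rewrite minxx mul0r subr0 in z.
    apply: filterS (Rintegral_eq0_ae iq (fun w => sqr_ge0 _) z) => w /eqP.
    by rewrite sqrf_eq0 => /eqP.
  by apply: filterS2 cont zero => w.
have := ae_foralln (mu := P) (P := fun k w => forall i : 'I_n, val i = k ->
  {within `[0, 1], continuous (fun t => beta i t w)} /\ beta i 0 w = 0).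
move=> /(_ _)/filterS; apply => [w hw i|k]; first exact: (hw (val i)).
have [kn|kn] := ltnP k n; last first.
  by apply: aeW => w i e; move: (ltn_ord i); rewrite e ltnNge kn.
apply: filterS (h (Ordinal kn)) => w hw i e.
by have -> : i = Ordinal kn by apply: val_inj.
Qed.

Lemma information_cvg w i (u_ : nat -> R) (u : R) : regular w ->
  (forall N, 0 <= u_ N <= 1) -> 0 <= u <= 1 -> u_ @ \oo --> u ->
  xi i (u_ N) w @[N --> \oo] --> xi i u w.
Proof.
move=> /(_ i)[/subspace_continuousP cont _] u_01 u01 cu; rewrite /information.
apply: cvgD; first exact: cvgMr_tmp.
apply: cvgMl_tmp.
have := cont u; rewrite /= in_itv /= => /(_ u01) cb.
apply: (@cvg_comp _ _ _ u_ (fun t => beta i t w) _ _ _ _ cb).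
move=> A /= [e /= e0 he].
have /cvg_seqP/(_ e e0) := cu.
apply: filterS => N hN; apply: he => //.
by rewrite /= in_itv /=.
Qed.

Lemma information0 w i : regular w -> xi i 0 w = 0.
Proof. by move=> /(_ i)[_ b0]; rewrite /information mul0r b0 mulr0 addr0. Qed.

Lemma precision_cvg (r_ : nat -> 'I_n -> R) (r : 'I_n -> R) :
  (forall i, r i < 1) -> (forall i, r_ ^~ i @ \oo --> r i) ->
  precision sigma (r_ N) @[N --> \oo] --> precision sigma r.
Proof.
move=> r1 rr; apply: cvg_sum_seq => i.
have s0 : sigma i != 0 by rewrite gt_eqF.
apply: cvgM => //; apply: cvgV.
  by rewrite mulf_neq0 ?expf_neq0// subr_eq0 gt_eqF.
by apply: cvgMl_tmp; apply: cvgB => //; exact: cvg_cst.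
Qed.

Lemma statistic_cvg w (r_ : nat -> 'I_n -> R) (r : 'I_n -> R) : regular w ->
  (forall N i, 0 <= r_ N i <= 1) -> (forall i, 0 <= r i < 1) ->
  (forall i, r_ ^~ i @ \oo --> r i) ->
  statistic X sigma beta (r_ N) w @[N --> \oo] --> statistic X sigma beta r w.
Proof.
move=> rw r_01 r1 rr; apply: cvg_sum_seq => i.
have s0 : sigma i != 0 by rewrite gt_eqF.
have /andP[ri0 ri1] := r1 i.
apply: cvgM; first by apply: information_cvg => //; rewrite ri0 ltW.
apply: cvgV.
  by rewrite mulf_neq0 ?expf_neq0// subr_eq0 gt_eqF.
by apply: cvgMl_tmp; apply: cvgB => //; exact: cvg_cst.
Qed.

End regular_paths.

(** The latest active time takes finitely many values, so that evaluating a
    process at it is measurable. *)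
Section latest_value.
Context {d : measure_display} {T : measurableType d} {R : realType}.
Variables (A : R -> T -> bool) (V : R -> T -> R) (S : seq R).
Local Notation last := (fun w => \big[Num.max/0]_(u <- S | A u w) u).
Hypotheses (mA : forall u, u \in S -> measurable_fun setT (A u))
  (mV : forall u, u \in 0 :: S -> measurable_fun setT (V u)).

Lemma measurable_bigmax_on : measurable_fun setT last.
Proof.
elim: S mA => [_|u s IH mA'].
  rewrite (_ : (fun w => _) = cst 0); first exact: measurable_cst.
  by apply/funext => w; rewrite big_nil.
have IHs := IH (fun v vs => mA' v (mem_behead (s := u :: s) vs)).
rewrite (_ : (fun w => _) = fun w => if A u w then
    Num.max u (\big[Num.max/0]_(v <- s | A v w) v) else \big[Num.max/0]_(v <- s | A v w) v); last first.
  by apply/funext => w; rewrite big_cons.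
apply: measurable_fun_ifT => //; first by apply: mA'; rewrite mem_head.
exact: measurable_maxr.
Qed.

Lemma measurable_at_bigmax_on : measurable_fun setT (fun w => V (last w) w).
Proof.
pose vs := undup (0 :: S).
have mem w : last w \in vs.
  rewrite /vs mem_undup; clear; elim: S => [|u s IH]; first by rewrite big_nil mem_head.
  move: IH; rewrite big_cons !inE => /orP IH; case: ifP => _; last first.
    by case: IH => ->; rewrite ?orbT.
  by rewrite /Num.max; case: ifP => _; rewrite ?eqxx ?orbT//; case: IH => ->; rewrite ?orbT.
rewrite (_ : (fun w => _) = fun w => \sum_(v <- vs)
    (if v \in vs then \1_[set v] (last w) * V v w else 0)).
  apply: measurable_sum => v; have [|_] := boolP (v \in vs); last exact: measurable_cst.
  rewrite mem_undup => vS; apply: measurable_funM; last exact: mV.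
  apply: (measurableT_comp (measurable_indic (measurable_set1 v))).
  exact: measurable_bigmax_on.
apply/funext => w; transitivity (\sum_(v <- vs) \1_[set v] (last w) * V v w); last first.
  by apply: eq_big_seq => v ->.
rewrite (bigD1_seq _ (mem w))/=; last exact: undup_uniq.
rewrite indicE mem_set// mul1r big1 ?addr0// => v vl.
by rewrite indicE memNset ?mul0r//= => e; rewrite e eqxx in vl.
Qed.

End latest_value.

(** Observation of the modulated information at the times of I, the sets of G
    being those known to the observer. *)
Section observation_window.
Context {d : measure_display} {T : measurableType d} {R : realType}.
Variable P : probability T R.
Variables (n : nat) (X : {RV P >-> R}) (sigma : 'I_n -> R)
  (beta : 'I_n -> R -> {RV P >-> R}) (J : 'I_n -> R -> {RV P >-> bool}).
Hypothesis bridge : forall i, brownian_bridge (beta i).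
Local Notation xi := (information X sigma beta).
Local Notation obs := (observed X sigma beta J).
Variables (I : set R) (t : R) (S : nat -> seq R).
Hypotheses (It : forall u, I u -> 0 <= u <= t) (I0 : I 0) (t1 : t <= 1)
  (SI : forall N u, u \in S N -> I u)
  (S_end : forall u, I u -> u < t \/ forall N, u \in S N)
  (S_dense : forall u v, 0 <= u -> u < v -> v <= t ->
     \forall N \near \oo, exists2 s, s \in S N & u <= s < v).
Hypothesis cadJ : forall i w, cadlag (fun u => J i u w).
Local Notation last i := (fun w => last_time I (fun u => J i u w)).

Lemma last_seen_cvgE i w : last_seen J (S N) i w @[N --> \oo] --> last i w.
Proof. exact: (last_seen_cvg It (cadJ i w) t1 SI S_end S_dense). Qed.

Lemma last_seen_leE N i w : last_seen J (S N) i w <= last i w.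
Proof. exact: (last_seen_le_last_time It J i w SI). Qed.

Lemma last_seen01 N i w : 0 <= last_seen J (S N) i w <= 1.
Proof.
rewrite last_seen_ge0 (le_trans (last_seen_leE _ _ _))// (le_trans _ t1)//.
by apply: (last_time_le It); have /andP[] := It I0.
Qed.

Lemma last01 i w : 0 <= last i w <= 1.
Proof.
rewrite last_time_ge0/= (le_trans _ t1)//.
by apply: (last_time_le It); have /andP[] := It I0.
Qed.

Variable G : set (set T).
Hypotheses (nullG : null_sets P `<=` <<s G >>)
  (GJ : forall i u, I u -> measurable_fun [set: g_sigma_algebraType G] (J i u : T -> bool))
  (Gobs : forall i u, I u -> measurable_fun [set: g_sigma_algebraType G] (obs i u)).

Lemma measurable_last i : measurable_fun [set: g_sigma_algebraType G] (last i).
Proof.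
apply: (measurable_ae_cvg nullG (f_ := fun N => last_seen J (S N) i)).
  by move=> N; apply: measurable_bigmax_on => u /SI; exact: GJ.
by apply: aeW => w; exact: last_seen_cvgE.
Qed.

(** The information process itself is not observable at a random time, but its
    observed version coincides with it when the coordinate is on and, almost
    surely, at time 0, where both vanish. *)
Lemma measurable_information_last i :
  measurable_fun [set: g_sigma_algebraType G] (fun w => xi i (last i w) w).
Proof.
pose f N w := obs i (last_seen J (S N) i w) w.
apply: (measurable_ae_cvg nullG (f_ := f)) => [N|].
  rewrite /f; apply: (measurable_at_bigmax_on (T := g_sigma_algebraType G)
    (A := fun u w => J i u w) (V := fun v => obs i v)) => [u /SI /GJ//|u].
  by rewrite inE => /predU1P[->|/SI]; exact: Gobs.
apply: filterS (regular_ae bridge) => w rw.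
rewrite (_ : (fun N => _) = fun N => xi i (last_seen J (S N) i w) w).
  apply: information_cvg => //; first by move=> N; exact: last_seen01.
    exact: last01.
  exact: last_seen_cvgE.
apply/funext => N; rewrite /f /observed.
apply: (last_seen_ind (K := fun u => (J i u w)%:R * xi i u w = xi i u w)).
  by rewrite information0// mulr0.
by move=> u _ ->; rewrite mul1r.
Qed.

Lemma measurable_precision_last :
  measurable_fun [set: g_sigma_algebraType G] (fun w => precision sigma (fun i => last i w)).
Proof.
apply: measurable_sum => i; have mi := measurable_last i.
apply: measurable_funM => //; apply: measurable_funV.
by apply: measurable_funM => //; apply: measurable_funB.
Qed.

Lemma measurable_statistic_last : measurable_fun [set: g_sigma_algebraType G]
  (fun w => statistic X sigma beta (fun i => last i w) w).
Proof.
apply: measurable_sum => i; have mi := measurable_last i.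
apply: measurable_funM; first exact: measurable_information_last.
apply: measurable_funV.
by apply: measurable_funM => //; apply: measurable_funB.
Qed.

End observation_window.

(** * Conditional expectation given the modulated information *)

Section cylinders.
Context {d : measure_display} {T : measurableType d} {R : realType}.
Variable P : probability T R.
Variables (n : nat) (X : {RV P >-> R}) (sigma : 'I_n -> R)
  (beta : 'I_n -> R -> {RV P >-> R}) (J : 'I_n -> R -> {RV P >-> bool}).
Local Notation cyl := (cylinder X sigma beta J).
Local Notation obs := (observed X sigma beta J).

(** Extension of a family of constraints by vacuous ones, so that cylinders may be
    based on a common finite set of times. *)
Definition restrict (S : seq R) (D : 'I_n -> R -> bool -> set R) i u b : set R :=
  if u \in S then D i u b else setT.

Lemma measurable_restrict S (D : 'I_n -> R -> bool -> set R) :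
  (forall i u b, measurable (D i u b)) -> forall i u b, measurable (restrict S D i u b).
Proof. by move=> mD i u b; rewrite /restrict; case: ifP. Qed.

Lemma cylinder_restrict S S' D : {subset S <= S'} -> cyl S D = cyl S' (restrict S D).
Proof.
move=> SS'; apply/seteqP; split => w h i u uS.
  by rewrite /restrict; case: ifPn => // /h.
by have := h i u (SS' u uS); rewrite /restrict uS.
Qed.

Lemma cylinderI S D S' D' : cyl S D `&` cyl S' D' =
  cyl (S ++ S') (fun i u b => restrict S D i u b `&` restrict S' D' i u b).
Proof.
rewrite (cylinder_restrict D (S' := S ++ S')); last by move=> u; rewrite mem_cat => ->.
rewrite (cylinder_restrict D' (S' := S ++ S')); last by move=> u; rewrite mem_cat => ->; rewrite orbT.
apply/seteqP; split => [w [h h'] i u uS|w h]; first by split; [exact: h|exact: h'].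
by split => i u uS; have [] := h i u uS.
Qed.

Lemma measurable_observed i u : measurable_fun setT (obs i u).
Proof.
apply: measurable_funM; last exact: measurable_information.
rewrite (_ : (fun w => _) = fun w => if J i u w then 1 else 0); last first.
  by apply/funext => w; case: (J i u w).
by apply: measurable_fun_ifT => //; exact: measurable_funPT.
Qed.

Lemma measurable_cylinder S D : (forall i u b, measurable (D i u b)) -> measurable (cyl S D).
Proof.
move=> mD.
have -> : cyl S D = \bigcap_(i in [set: 'I_n]) \bigcap_(u in [set` S])
    \bigcup_(b in [set: bool]) (J i u @^-1` [set b] `&` obs i u @^-1` D i u b).
  apply/seteqP; split => [w h i _ u uS|w h i u uS].
    by exists (J i u w) => //; split => //; exact: h.
  by have [b _ [/= <-]] := h i I u uS.
apply: fin_bigcap_measurable => // i _; apply: fin_bigcap_measurable => // u _.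
apply: fin_bigcup_measurable => // b _; apply: measurableI.
  by rewrite -[X in measurable X]setTI; exact: measurable_funPT.
by rewrite -[X in measurable X]setTI; exact: measurable_observed.
Qed.

Definition one_time i u (E : bool -> set R) (j : 'I_n) (v : R) (b : bool) : set R :=
  if (j == i) && (v == u) then E b else setT.

Lemma cylinder_one_time i u E :
  cyl [:: u] (one_time i u E) = [set w | E (J i u w) (obs i u w)].
Proof.
apply/seteqP; split => [w /(_ i u (mem_head _ _))|w h j v].
  by rewrite /one_time !eqxx.
rewrite inE => /eqP ->; rewrite /one_time eqxx andbT.
by case: eqP => // ->.
Qed.

Lemma measurable_one_time i u E : (forall b, measurable (E b)) ->
  forall j v b, measurable (one_time i u E j v b).
Proof. by move=> mE j v b; rewrite /one_time; case: ifP. Qed.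

End cylinders.

Section filtering.
Context {d : measure_display} {T : measurableType d} {R : realType}.
Variable P : probability T R.
Variables (n : nat) (X : {RV P >-> R}) (sigma : 'I_n -> R)
  (beta : 'I_n -> R -> {RV P >-> R}) (J : 'I_n -> R -> {RV P >-> bool}).
Hypothesis sigma_gt0 : forall i, 0 < sigma i.
Hypothesis bridge : forall i, brownian_bridge (beta i).
Hypothesis indep : mutually_independent P
  (fun o : option 'I_n => if o is Some i
     then sigma_process `[0, 1] (fun u => beta i u : T -> R)
     else sigma_rv X).
Local Notation xi := (information X sigma beta).
Hypothesis indepJ : independent P
  <<s \bigcup_(i in [set: 'I_n]) sigma_process `[0, 1] (J i) >>
  <<s sigma_rv X `|` \bigcup_(i in [set: 'I_n]) sigma_process `[0, 1] (xi i) >>.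
Hypothesis null_measurable : null_sets P `<=` measurable.
Hypothesis cadJ : forall i w, cadlag (fun u => J i u w).
Local Notation obs := (observed X sigma beta J).
Local Notation cyl := (cylinder X sigma beta J).
Local Notation F := (modulated_filtration P X J xi).

Definition filtration_gens (t : R) : set (set T) :=
  (\bigcup_(i in [set: 'I_n]) (sigma_process `[0, t] (obs i) `|` sigma_process `[0, t] (J i)))
  `|` sigma_rv (fun w => X w * (t == 1)%:R) `|` null_sets P.

(** The conditional expectation of psi X given the modulated information up to t,
    as the results below show. *)
Definition estimate (psi : R -> R) (t : R) (w : T) : R :=
  posterior X psi (precision sigma (fun i => last_active J i t w))
    (statistic X sigma beta (fun i => last_active J i t w) w).

Lemma filtration_null t : null_sets P `<=` <<s filtration_gens t >>.
Proof. by move=> A nA; apply: sub_sigma_algebra; right. Qed.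

Lemma filtration_J t i u : 0 <= u <= t ->
  measurable_fun [set: g_sigma_algebraType (filtration_gens t)] (J i u : T -> bool).
Proof.
move=> ut; apply: (sigma_measurableP (filtration_gens t) (J i u : T -> bool)).1 => B mB.
apply: sub_sigma_algebra; left; left; exists i => //; right; apply: sub_sigma_algebra.
by exists u; [rewrite /= in_itv|exists B => //; rewrite setTI].
Qed.

Lemma filtration_observed t i u : 0 <= u <= t ->
  measurable_fun [set: g_sigma_algebraType (filtration_gens t)] (obs i u).
Proof.
move=> ut; apply: (sigma_measurableP (filtration_gens t) (obs i u)).1 => B mB.
apply: sub_sigma_algebra; left; left; exists i => //; left; apply: sub_sigma_algebra.
by exists u; [rewrite /= in_itv|exists B => //; rewrite setTI].
Qed.

(** Before time 1 the generator that reveals X is trivial. *)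
Lemma filtration_sub (C : set (set T)) t : t < 1 -> sigma_algebra setT C ->
  null_sets P `<=` C ->
  (forall i u E, 0 <= u <= t -> (forall b, measurable (E b)) ->
     C [set w | E (J i u w) (obs i u w)]) ->
  F t `<=` C.
Proof.
move=> t1 sC nC cC; apply: smallest_sub => // A [[]|/nC//].
  move=> [i _ [|]]; apply: smallest_sub => // B [u]; rewrite /= in_itv /= => ut [D mD <-].
    by rewrite setTI; exact: (cC i u (fun=> D) ut (fun=> mD)).
  rewrite setTI; apply: (cC i u (fun b => [set x | D b]) ut) => b.
  have [Db|Db] := pselect (D b).
    by rewrite (_ : [set _ | _] = setT)//; apply/seteqP; split.
  by rewrite (_ : [set _ | _] = set0)//; apply/seteqP; split.
move=> [D mD <-]; rewrite (lt_eqF t1) setTI.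
have [h|h] := pselect (D 0).
  rewrite (_ : _ @^-1` D = setT); first by rewrite -(setC0); case: sC => C0 CC _; rewrite -setTD; exact: CC.
  by apply/seteqP; split => // w _ /=; rewrite mulr0.
rewrite (_ : _ @^-1` D = set0); first by case: sC.
by apply/seteqP; split => // w /=; rewrite mulr0.
Qed.

Lemma filtration_measurable t : t < 1 -> F t `<=` measurable.
Proof.
move=> t1; apply: filtration_sub => //; first exact: sigma_algebra_measurable.
move=> i u E ut mE; rewrite -(cylinder_one_time X sigma beta J).
by apply: measurable_cylinder; exact: measurable_one_time.
Qed.

Section fixed_time.
Variable t : R.
Hypothesis t01 : 0 <= t < 1.

Let t0 : 0 <= t. Proof. by case/andP: t01. Qed.
Let t1 : t < 1. Proof. by case/andP: t01. Qed.

Definition samples (S0 : seq R) (N : nat) : seq R := t :: S0 ++ grid t N.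

Let window := [set u : R | 0 <= u <= t].

Let samples_window S0 : {in S0, forall u, 0 <= u <= t} ->
  forall N u, u \in samples S0 N -> window u.
Proof.
move=> S0t N u; rewrite inE mem_cat => /predU1P[->|/orP[/S0t//|]].
  by rewrite /window /= t0 lexx.
move: (t0); rewrite le_eqVlt => /predU1P[<-|tp].
  by move=> /mapP[k _ ->]; rewrite /window /= mul0r lexx.
by move/(grid_itv tp) => /andP[u0 /ltW ut]; rewrite /window /= u0.
Qed.

Let samples_end S0 u : window u -> u < t \/ forall N, u \in samples S0 N.
Proof.
move=> /andP[_]; rewrite le_eqVlt => /predU1P[->|]; last by left.
by right => N; rewrite mem_head.
Qed.

Let samples_dense S0 u v : 0 <= u -> u < v -> v <= t ->
  \forall N \near \oo, exists2 s, s \in samples S0 N & u <= s < v.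
Proof.
move=> u0 uv vt; apply: filterS (grid_dense u0 uv vt) => N [s sN su].
by exists s => //; rewrite inE mem_cat sN !orbT.
Qed.

Let window_itv u : window u -> 0 <= u <= t. Proof. by []. Qed.
Let window0 : window 0. Proof. by rewrite /window /= lexx. Qed.
Let no_sample : {in [::], forall u : R, 0 <= u <= t}. Proof. by []. Qed.

Let last_active01 i w : 0 <= last_active J i t w < 1.
Proof.
apply/andP; split; first exact: (last_time_ge0 window (fun u => J i u w)).
by apply: le_lt_trans t1; exact: (last_time_le window_itv (fun u => J i u w) t0).
Qed.

Lemma measurable_estimate psi : measurable_fun setT psi ->
  measurable_fun [set: g_sigma_algebraType (filtration_gens t)] (estimate psi t).
Proof.
move=> mpsi; apply: measurable_posterior => //.
- exact: (measurable_precision_last sigma window_itv (ltW t1) (samples_window no_sample)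
    (@samples_end [::]) (samples_dense [::]) cadJ (@filtration_null t) (@filtration_J t)).
- exact: (measurable_statistic_last bridge window_itv window0 (ltW t1) (samples_window no_sample)
    (@samples_end [::]) (samples_dense [::]) cadJ (@filtration_null t) (@filtration_J t) (@filtration_observed t)).
Qed.

Lemma measurable_estimateT psi : measurable_fun setT psi -> measurable_fun setT (estimate psi t).
Proof.
move=> /measurable_estimate me _ B mB; rewrite setTI.
by apply: (filtration_measurable t1); exact: (sigma_measurableP (filtration_gens t) (estimate psi t)).2.
Qed.

Let precision_last_active_ge0 w : 0 <= precision sigma (fun i => last_active J i t w).
Proof. by apply: precision_ge0 => i; exact: last_active01. Qed.

Lemma bounded_estimate psi : bounded_measurable psi -> bounded_measurable (estimate psi t).
Proof.
move=> [mpsi [M hM]]; split; first exact: measurable_estimateT.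
by exists M => w; exact: posterior_le.
Qed.

Let rough psi S w := posterior X psi (precision sigma (last_seen J S ^~ w))
  (statistic X sigma beta (last_seen J S ^~ w) w).

Let rough_cvg S0 psi w : {in S0, forall u, 0 <= u <= t} -> bounded_measurable psi ->
  regular beta w -> rough psi (samples S0 N) w @[N --> \oo] --> estimate psi t w.
Proof.
move=> S0t bpsi rw.
have cvl i : last_seen J (samples S0 N) i w @[N --> \oo] --> last_active J i t w.
  exact: (last_seen_cvgE window_itv (ltW t1) (samples_window S0t)
    (@samples_end S0) (samples_dense S0) cadJ).
have lel N i := last_seen_leE J window_itv (samples_window S0t) N i w.
apply: posterior_cvg => //.
- by apply: bounded_integrable; apply: bounded_measurable_comp => //; exact: measurable_funPT.
- by apply: (precision_cvg sigma_gt0) => // i; case/andP: (last_active01 i w).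
- refine (statistic_cvg sigma_gt0 (X := X) (r_ := fun N i => last_seen J (samples S0 N) i w)
    (r := fun i => last_active J i t w) rw _ _ cvl) => // N i.
  rewrite last_seen_ge0 (le_trans (lel N i))//.
  by case/andP: (last_active01 i w) => _ /ltW.
move=> c0; apply: nearW => N; rewrite /precision big1// => i _.
have := precision_eq0 sigma_gt0 (last_active01 ^~ w) c0 i => li0.
have h := lel N i; rewrite [X in _ <= X]li0 in h.
have -> : last_seen J (samples S0 N) i w = 0 by apply/le_anti; rewrite h last_seen_ge0.
by rewrite mul0r.
Qed.

Lemma measurable_rough psi S : measurable_fun setT psi -> measurable_fun setT (rough psi S).
Proof.
move=> mpsi.
have ml i : measurable_fun setT (last_seen J S i).
  by apply: measurable_bigmax_on => u _; exact: measurable_funPT.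
apply: measurable_posterior => //; apply: measurable_sum => i; apply: measurable_funM => //.
- by apply: measurable_funV; apply: measurable_funM => //; apply: measurable_funB.
- apply: (measurable_at_bigmax_on (V := xi i)) => u _; first exact: measurable_funPT.
  exact: measurable_information.
- by apply: measurable_funV; apply: measurable_funM => //; apply: measurable_funB.
Qed.

(** Limit along finer and finer grids of the identity for finitely many times. *)
Lemma estimate_cylinder S0 D psi : {in S0, forall u, 0 <= u <= t} ->
  (forall i u b, measurable (D i u b)) -> bounded_measurable psi ->
  \int[P]_w ((psi (X w) - estimate psi t w) * \1_(cyl S0 D) w) = 0.
Proof.
move=> S0t mD bpsi; have [mpsi [M hM]] := bpsi.
have mpX : measurable_fun setT (fun w => psi (X w)).
  by apply: (measurableT_comp mpsi); exact: measurable_funPT.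
have bc := @bounded_measurable_indic _ _ R _ (measurable_cylinder X sigma beta J S0 mD).
have lim : \int[P]_w (\1_(cyl S0 D) w * (psi (X w) - rough psi (samples S0 N) w)) @[N --> \oo]
    --> \int[P]_w (\1_(cyl S0 D) w * (psi (X w) - estimate psi t w)).
  apply: (weighted_bounded_cvg (M := M + M) (bounded_integrable P bc)).
  - by move=> N; apply: measurable_funB => //; exact: measurable_rough.
  - by apply: measurable_funB => //; exact: measurable_estimateT.
  - move=> N w; rewrite (le_trans (ler_normB _ _))// lerD//.
    apply: posterior_le => //; apply: precision_ge0 => i.
    rewrite last_seen_ge0 (le_lt_trans (last_seen_leE J window_itv (samples_window S0t) N i w))//.
    by case/andP: (last_active01 i w).
  - apply: filterS (regular_ae bridge) => w rw; apply: cvgB; first exact: cvg_cst.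
    exact: rough_cvg.
transitivity (\int[P]_w (\1_(cyl S0 D) w * (psi (X w) - estimate psi t w))).
  by apply: eq_Rintegral => w _; rewrite mulrC.
rewrite -[LHS](cvg_lim _ lim)//; apply/cvg_lim => //; apply: cvg_near_cst.
apply: nearW => N.
have sub : {subset S0 <= samples S0 N} by move=> u uS; rewrite inE mem_cat uS orbT.
have := posterior_cylinder sigma_gt0 bridge indep indepJ t01 (samples_window S0t (N := N))
  (measurable_restrict S0 mD) bpsi.
rewrite -cylinder_restrict// => <-.
by apply: eq_Rintegral => w _; rewrite mulrC.
Qed.

Lemma estimate_integral psi A : bounded_measurable psi -> F t A ->
  \int[P]_w (psi (X w) * \1_A w) = \int[P]_w (estimate psi t w * \1_A w).
Proof.
move=> bpsi FA; have be := bounded_estimate bpsi.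
have bX : bounded_measurable (fun w => psi (X w)).
  by apply: bounded_measurable_comp => //; exact: measurable_funPT.
pose C : set (set T) := [set A | exists S D,
  [/\ {in S, forall u, 0 <= u <= t}, forall i u b, measurable (D i u b) & A = cyl S D]].
apply: (weighted_eq_complete (C := C)) => //; try exact: bounded_integrable.
- move=> _ _ [S1 [D1 [S1t mD1 ->]]] [S2 [D2 [S2t mD2 ->]]].
  exists (S1 ++ S2), (fun i u b => restrict S1 D1 i u b `&` restrict S2 D2 i u b).
  split; last exact: cylinderI.
    by move=> u; rewrite mem_cat => /orP[/S1t|/S2t].
  by move=> i u b; apply: measurableI; exact: measurable_restrict.
- by move=> _ [S [D [St mD ->]]]; exact: measurable_cylinder.
- by exists [::], (fun _ _ _ => setT); split => //; apply/seteqP; split.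
- move=> _ [S [D [St mD ->]]].
  have bc := @bounded_measurable_indic _ _ R _ (measurable_cylinder X sigma beta J S mD).
  apply/eqP; rewrite -subr_eq0; apply/eqP.
  rewrite -RintegralB//; [|exact: bounded_integrable (bounded_measurableM _ bc)..].
  rewrite -[RHS](estimate_cylinder St mD bpsi).
  by apply: eq_Rintegral => w _; rewrite mulrBl.
move: A FA; apply: filtration_sub => //.
  by move=> B nB; apply: sub_sigma_algebra; right.
move=> i u E ut mE; rewrite -(cylinder_one_time X sigma beta J).
apply: sub_sigma_algebra; left; exists [:: u], (one_time i u E); split => //.
  by move=> v; rewrite inE => /eqP ->.
exact: measurable_one_time.
Qed.

Hypothesis iX : P.-integrable setT (EFin \o (X : T -> R)).

(** The estimates of the truncations of X converge to Y in mean, conditional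
    expectation being a contraction, and to the estimate of X pointwise. *)
Lemma cond_expectation_estimate Y : is_cond_expectation P (F t) X Y ->
  {ae P, forall w, Y w = estimate idfun t w}.
Proof.
move=> [FY iY eY].
have mY : measurable_fun setT Y by exact: integrable_EFin_measurable iY.
pose tr M := estimate (trunc M) t.
have btr M : bounded_measurable (tr M) by apply: bounded_estimate; exact: bounded_trunc.
have itr M := bounded_integrable P (btr M).
have bX M : bounded_measurable (fun w => trunc M (X w)).
  by apply: bounded_measurable_comp; [exact: measurable_funPT|exact: bounded_trunc].
have iTX M := bounded_integrable P (bX M).
have Y_int A : F t A -> \int[P]_w (Y w * \1_A w) = \int[P]_w (X w * \1_A w).
  move=> FA; by rewrite !Rintegral_mul_indic /Rintegral eY.
have L1 M : \int[P]_w `|tr M w - Y w| <= \int[P]_w `|trunc M (X w) - X w|.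
  pose A := [set w | Y w < tr M w].
  have FA : F t A.
    have mtr : measurable_fun [set: g_sigma_algebraType (filtration_gens t)] (tr M).
      by apply: measurable_estimate; exact: (bounded_trunc M).1.
    have mYF : measurable_fun [set: g_sigma_algebraType (filtration_gens t)] Y.
      exact: (sigma_measurableP (filtration_gens t) Y).1.
    have mtrue : measurable [set true] by [].
    have := measurable_fun_ltr mYF mtr measurableT mtrue.
    by rewrite setTI.
  have FAC : F t (~` A) by rewrite -setTD; case: (smallest_sigma_algebra setT (filtration_gens t)) => _ + _; apply.
  have part B : F t B -> \int[P]_w ((tr M w - Y w) * \1_B w) =
      \int[P]_w ((trunc M (X w) - X w) * \1_B w).
    move=> FB; have bB := @bounded_measurable_indic _ _ R _ (filtration_measurable t1 FB).
    have e1 (f g : T -> R) : P.-integrable setT (EFin \o f) -> P.-integrable setT (EFin \o g) ->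
        \int[P]_w ((f w - g w) * \1_B w) = \int[P]_w (f w * \1_B w) - \int[P]_w (g w * \1_B w).
      move=> hf hg; rewrite -RintegralB//; [|exact: integrable_mul_bounded..].
      by apply: eq_Rintegral => w _; rewrite mulrBl.
    rewrite !e1// Y_int//; congr (_ - _).
    by rewrite -estimate_integral//; exact: bounded_trunc.
  have bA := @bounded_measurable_indic _ _ R _ (filtration_measurable t1 FA).
  have bAC := @bounded_measurable_indic _ _ R _ (filtration_measurable t1 FAC).
  have iD := integrable_EFinB (itr M) iY.
  have iD' := integrable_EFinB (iTX M) iX.
  have -> : \int[P]_w `|tr M w - Y w| =
      \int[P]_w ((tr M w - Y w) * \1_A w) - \int[P]_w ((tr M w - Y w) * \1_(~` A) w).
    rewrite -RintegralB//; [|exact: integrable_mul_bounded..].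
    apply: eq_Rintegral => w _; rewrite !indicE in_setC.
    have [/set_mem h|] := boolP (w \in A); first by rewrite mulr1 mulr0 subr0 gtr0_norm ?subr_gt0.
    rewrite notin_setE => h; rewrite mulr0 mulr1 sub0r ler0_norm// subr_le0 leNgt.
    exact/negP.
  rewrite !part// -RintegralB//; [|exact: integrable_mul_bounded..].
  apply: le_Rintegral => //.
  - by apply: integrable_EFinB; exact: integrable_mul_bounded.
  - exact: integrable_norm iD'.
  - move=> w _; rewrite !indicE in_setC.
    case: (w \in A); rewrite /= ?mulr1 ?mulr0 ?subr0 ?sub0r ?ler_norm//.
    by rewrite -normrN ler_norm.
have L1_0 : \int[P]_w `|trunc M (X w) - X w| @[M --> \oo] --> (0 : R).
  have mX : measurable_fun setT (X : T -> R) by exact: measurable_funPT.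
  have := proj2 (@dominated_cvg_Rintegral _ _ _ P (fun M w => `|trunc M (X w) - X w|)
    (fun=> 0) (fun w => `|X w| + `|X w|) _ _ _ _ _).
  rewrite Rintegral_cst_probability; apply => //.
  - by move=> M; apply: measurableT_comp => //; apply: measurable_funB => //; exact: (bX M).1.
  - apply: aeW => w; rewrite -[X in _ --> X](normr0 R) -(subrr (X w)).
    by apply: cvg_norm; apply: cvgB; [exact: trunc_cvg|exact: cvg_cst].
  - by apply: integrable_EFinD; exact: integrable_norm iX.
  - by move=> M w; rewrite normr_id (le_trans (ler_normB _ _))// lerD2r trunc_norm_le.
pose m M w := Num.min 1 `|tr M w - Y w|.
pose m0 w := Num.min 1 `|estimate idfun t w - Y w|.
have mm M : measurable_fun setT (m M).
  apply: measurable_minr => //; apply: measurableT_comp => //.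
  by apply: measurable_funB => //; exact: (btr M).1.
have mm0 : measurable_fun setT m0.
  apply: measurable_minr => //; apply: measurableT_comp => //.
  by apply: measurable_funB => //; apply: measurable_estimateT; exact: measurable_id.
have m01 (x : R) : `|Num.min 1 (Num.norm x)| <= 1.
  by rewrite ger0_norm ?ge_min ?lexx// le_min ler01 normr_ge0.
have min_lip (a b : R) : `|Num.min 1 a - Num.min 1 b| <= `|a - b|.
  have h1 := ler_norm (a - b); have h2 := ler_norm (b - a); rewrite distrC in h2.
  by rewrite ler_norml; case: (leP 1 a) => ?; case: (leP 1 b) => ?; apply/andP; split; lra.
have cm : \int[P]_w (1 * m M w) @[M --> \oo] --> \int[P]_w (1 * m0 w).
  apply: (weighted_bounded_cvg (M := 1) (bounded_integrable P (bounded_measurable_cst 1))) => //.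
  - by move=> M w; exact: m01.
  - apply: aeW => w.
    have /cvg_seqP c : `|tr M w - Y w| @[M --> \oo] --> `|estimate idfun t w - Y w|.
      apply: cvg_norm; apply: cvgB; last exact: cvg_cst.
      exact: posterior_trunc_cvg.
    by apply/cvg_seqP => e /c; apply: filterS => M h; exact: le_lt_trans (min_lip _ _) h.
have bm0 : bounded_measurable m0 by split => //; exists 1 => w; exact: m01.
have z : \int[P]_w m0 w = 0.
  have <- : \int[P]_w (1 * m0 w) = \int[P]_w m0 w by under eq_Rintegral do rewrite mul1r.
  rewrite -(cvg_lim _ cm)//; apply/cvg_lim => //.
  apply: (squeeze_cvgr _ (cvg_cst 0) L1_0); apply: nearW => M.
  rewrite Rintegral_ge0 => [|w _]; last by rewrite mul1r le_min ler01 normr_ge0.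
  apply: le_trans (L1 M); apply: le_Rintegral => //.
  - apply: bounded_integrable; apply: bounded_measurableM; first exact: bounded_measurable_cst.
    by split => //; exists 1 => w; exact: m01.
  - exact: integrable_norm (integrable_EFinB (itr M) iY).
  - by move=> w _; rewrite mul1r ge_min lexx orbT.
have m0_ge0 w : 0 <= m0 w by rewrite le_min ler01 normr_ge0.
apply: filterS (Rintegral_eq0_ae (bounded_integrable P bm0) m0_ge0 z) => w.
rewrite /m0 /Num.min; case: ifP => [_ /eqP|_ /eqP]; first by rewrite oner_eq0.
by rewrite normr_eq0 subr_eq0 => /eqP ->.
Qed.

End fixed_time.
End filtering.

(** * The jump function and simultaneous times *)

Section change_of_variables.
Context {d : measure_display} {T : measurableType d} {R : realType}.
Variables (P : probability T R) (X : {RV P >-> R}) (XX : set R).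
Hypotheses (mXX : measurable XX) (X_in_XX : forall w, XX (X w)).
Variable f : R -> R.
Hypotheses (mf : measurable_fun setT f)
  (iX : P.-integrable setT (EFin \o (fun w => f (X w)))).

Let preimageXX : (X : T -> R) @^-1` XX = setT.
Proof. by apply/seteqP; split => // w _; exact: X_in_XX. Qed.

Let mX : measurable_fun setT (X : T -> R). Proof. exact: measurable_funPT. Qed.

Let mEf : measurable_fun setT (EFin \o f). Proof. exact/measurable_EFinP. Qed.

Lemma integrable_law : (distribution P X).-integrable XX (fun x => (f x)%:E).
Proof.
by apply: (integrable_pushforward mX mEf) => //; rewrite preimageXX.
Qed.

Lemma Rintegral_law : \int[distribution P X]_(x in XX) f x = \int[P]_w f (X w).
Proof.
rewrite /Rintegral; congr fine.
rewrite (integral_pushforward mX mEf)//; first by rewrite preimageXX.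
by rewrite preimageXX.
Qed.

End change_of_variables.

Section jumps.
Context {d : measure_display} {T : measurableType d} {R : realType}.
Variable P : probability T R.
Variables (n : nat) (X : {RV P >-> R}) (sigma : 'I_n -> R)
  (beta : 'I_n -> R -> {RV P >-> R}) (J : 'I_n -> R -> {RV P >-> bool}) (XX : set R).
Hypothesis sigma_gt0 : forall i, 0 < sigma i.
Hypotheses (mXX : measurable XX) (X_in_XX : forall w, XX (X w)).
Hypothesis iX : P.-integrable setT (EFin \o (X : T -> R)).
Local Notation xi := (information X sigma beta).
Local Notation nu := (distribution P X).
Local Notation last t w := (fun i => last_active J i t w).

Lemma in_activated i t w : i \in activated J t w -> J i t w /\ 0 < t.
Proof.
rewrite /activated /active /active_left !inE /left_limit => /andP[nl Jt]; split => //.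
by move: nl; case: ifP => //; rewrite Jt.
Qed.

Section fixed_outcome.
Variables (t : R) (w : T).
Hypotheses (t01 : 0 <= t < 1) (rw : regular beta w).

Lemma last_active01 i : 0 <= last_active J i t w < 1.
Proof.
have /andP[t0 t1] := t01.
apply/andP; split; first exact: (last_time_ge0 [set u | 0 <= u <= t] (fun u => J i u w)).
apply: le_lt_trans t1.
by apply: (@last_time_le _ [set u | 0 <= u <= t] t _ (fun u => J i u w)).
Qed.

Lemma last_active_on i : J i t w -> last_active J i t w = t.
Proof.
have /andP[t0 t1] := t01.
move=> Jt; apply/le_anti/andP; split.
  by apply: (@last_time_le _ [set u | 0 <= u <= t] t _ (fun u => J i u w)).
by apply: (@last_time_ge _ [set u | 0 <= u <= t] t _ (fun u => J i u w)) => //=; rewrite t0 lexx.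
Qed.

Let s0 i : sigma i != 0. Proof. by rewrite gt_eqF. Qed.
Let t1 : 1 - t != 0. Proof. by rewrite subr_eq0 eq_sym lt_eqF//; case/andP: t01. Qed.
Let l1 i : 1 - last_active J i t w != 0.
Proof. by rewrite subr_eq0 eq_sym lt_eqF//; case/andP: (last_active01 i). Qed.

Definition inactive_statistic : R := \sum_(i | i \notin activated J t w)
  xi i (last_active J i t w) w / (sigma i ^+ 2 * (1 - last_active J i t w)).

(** A coordinate activated at t has t as its latest active time, so that both
    products in the weight have the same shape. *)
Lemma jump_weightE z x : jump_weight J xi sigma t w z x =
  weight (precision sigma (last t w)) (z + inactive_statistic) x.
Proof.
rewrite /jump_weight /weight -!expR_sum -!expRD; congr expR.
rewrite /precision [\sum_(i < n) _](bigID (fun i => i \in activated J t w))/= /inactive_statistic.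
set a := \sum_(i in activated J t w) last_active J i t w / _.
have -> : \sum_(i in activated J t w) - t * x ^+ 2 / (2 * sigma i ^+ 2 * (1 - t)) = - (a * x ^+ 2 / 2).
  rewrite /a !mulr_suml -sumrN; apply: eq_bigr => i /in_activated[/last_active_on -> _].
  by field; rewrite s0 t1.
set b := \sum_(i | i \notin _) last_active J i t w / _.
set s := \sum_(i | _) xi i _ w / _.
suff -> : \sum_(i | i \notin activated J t w) (x * xi i (last_active J i t w) w -
    last_active J i t w * x ^+ 2 / 2) / (sigma i ^+ 2 * (1 - last_active J i t w)) =
    x * s - b * x ^+ 2 / 2 by ring.
rewrite /s /b mulr_sumr !mulr_suml -sumrB; apply: eq_bigr => i _.
by field; rewrite s0 l1.
Qed.

Lemma jump_Z_statistic : jump_Z J xi sigma t w + inactive_statistic =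
  statistic X sigma beta (last t w) w.
Proof.
rewrite /statistic (bigID (fun i => i \in activated J t w))/=; congr (_ + _).
by apply: eq_bigr => i /in_activated[/last_active_on -> _].
Qed.

Lemma precision_activated : (0 < #|activated J t w|)%N -> 0 < precision sigma (last t w).
Proof.
move=> /card_gt0P[i iK]; rewrite lt_neqAle eq_sym precision_ge0//; last exact: last_active01.
rewrite andbT; apply/eqP => c0.
have := precision_eq0 sigma_gt0 last_active01 c0 i.
have [Jt t0] := in_activated iK; rewrite last_active_on// => e.
by rewrite e ltxx in t0.
Qed.

Lemma statistic_precision0 : precision sigma (last t w) = 0 ->
  statistic X sigma beta (last t w) w = 0.
Proof.
move=> c0; rewrite /statistic big1// => i _.
by rewrite (precision_eq0 sigma_gt0 last_active01 c0) information0// mul0r.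
Qed.

Let proper (c s : R) := 0 < c \/ (c = 0 /\ s = 0).

Let bounded_weight c s : proper c s -> bounded_measurable (weight c s : R -> R).
Proof.
move=> [c0|[-> ->]]; last first.
  rewrite (_ : weight 0 0 = fun=> 1); first exact: bounded_measurable_cst.
  by apply/funext => x; rewrite /weight mulr0 !mul0r subr0 expR0.
split; last first.
  exists (expR (s ^+ 2 / (2 * c))) => x; rewrite gtr0_norm ?weight_gt0//.
  exact: weight_ub.
apply: measurableT_comp => //; apply: measurable_funB; first exact: measurable_funM.
by apply: measurable_funM => //; apply: measurable_funM => //; exact: measurable_funX.
Qed.

(** The integrals may fail to converge for c = 0 unless s = 0, a case in which the
    weight is constant. *)
Lemma jump_gE z : let c := precision sigma (last t w) in let s := z + inactive_statistic in
  0 < c \/ (c = 0 /\ s = 0) ->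
  jump_g_defined J xi sigma nu XX t w z /\ jump_g J xi sigma nu XX t w z = posterior X idfun c s.
Proof.
move=> c s cs; have bw := bounded_weight cs.
have wE : jump_weight J xi sigma t w z = weight c s.
  by apply/funext => x; exact: jump_weightE.
have bwX : bounded_measurable (fun w => weight c s (X w)).
  by apply: bounded_measurable_comp => //; exact: measurable_funPT.
have iwX := bounded_integrable P bwX.
have mxw : measurable_fun setT (fun x : R => x * weight c s x) by apply: measurable_funM => //; exact: bw.1.
have ixwX : P.-integrable setT (EFin \o (fun w => X w * weight c s (X w))).
  exact: integrable_mul_bounded.
have num : jump_num J xi sigma nu XX t w z = \int[P]_w (X w * weight c s (X w)).
  rewrite /jump_num wE.
  exact: (Rintegral_law mXX X_in_XX mxw ixwX).
have den : jump_den J xi sigma nu XX t w z = \int[P]_w weight c s (X w).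
  by rewrite /jump_den wE; exact: (Rintegral_law mXX X_in_XX bw.1 iwX).
split.
  split.
  - by rewrite wE; exact: (integrable_law mXX X_in_XX mxw ixwX).
  - by rewrite wE; exact: (integrable_law mXX X_in_XX bw.1 iwX).
  - by rewrite den; apply: Rintegral_gt0 => // w'; exact: weight_gt0.
rewrite /jump_g num den /posterior; case: eqVneq => // c0.
case: cs => [|[_ s0']]; first by rewrite c0 ltxx.
have w1 x : weight c s x = 1 by rewrite /weight c0 s0' mulr0 !mul0r subr0 expR0.
under eq_Rintegral do rewrite w1 mulr1.
under [X in _ / X]eq_Rintegral do rewrite w1.
by rewrite Rintegral_cst_probability divr1.
Qed.

Lemma jump_g_estimate : jump_g J xi sigma nu XX t w (jump_Z J xi sigma t w) =
  estimate X sigma beta J idfun t w.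
Proof.
rewrite (jump_gE _).2 ?jump_Z_statistic//.
have := precision_ge0 sigma last_active01; rewrite le_eqVlt => /predU1P[e|]; last by left.
by right; split => //; exact: statistic_precision0.
Qed.

Lemma jump_g_definedP z : (0 < #|activated J t w|)%N \/ z = jump_Z J xi sigma t w ->
  jump_g_defined J xi sigma nu XX t w z.
Proof.
move=> h; apply: (jump_gE _).1; case: h => [/precision_activated|->]; first by left.
rewrite jump_Z_statistic.
have := precision_ge0 sigma last_active01; rewrite le_eqVlt => /predU1P[e|]; last by left.
by right; split => //; exact: statistic_precision0.
Qed.

End fixed_outcome.

Hypothesis cadJ : forall i w, cadlag (fun u => J i u w).

Section right_continuity.
Variables (t : R) (w : T) (q : nat -> R).
Hypotheses (t01 : 0 < t < 1) (q01 : forall N, t < q N < 1) (qt : q @ \oo --> t).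

Let t0 : 0 < t. Proof. by case/andP: t01. Qed.
Let t1 : t < 1. Proof. by case/andP: t01. Qed.
Let tq N : t < q N. Proof. by case/andP: (q01 N). Qed.
Let q1 N : q N < 1. Proof. by case/andP: (q01 N). Qed.
Let t01' : 0 <= t < 1. Proof. by rewrite ltW. Qed.
Let q01' N : 0 <= q N < 1. Proof. by rewrite q1 ltW// (lt_trans t0). Qed.

(** While the coordinate stays off to the right of t, its latest active time does
    not move. *)
Let last_off i : ~~ J i t w ->
  \forall N \near \oo, last_active J i (q N) w = last_active J i t w.
Proof.
move=> nJ; have [e e0 he] := cadlag_bool_right (cadJ i w) t01'.
have qe : \forall N \near \oo, q N < t + e.
  have /cvg_seqP/(_ e e0) := qt; apply: filterS => N.
  by rewrite distrC ger0_norm ?subr_ge0 1?ltW// ltrBlDl.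
apply: filterS qe => N qN; apply/le_anti/andP; split.
  apply: (@last_time_ub _ [set u | 0 <= u <= q N] (q N)) => //.
    by have /andP[] := last_active01 w t01' i.
  move=> u /= /andP[u0 uq] Ju; have [tu|ut] := leP t u.
    by move: nJ; rewrite -(he u) ?Ju// tu (le_lt_trans uq).
  by apply: (@last_time_ge _ [set u | 0 <= u <= t] t _ (fun u => J i u w)) => //=; rewrite u0 ltW.
apply: (@last_time_ub _ [set u | 0 <= u <= t] t) => //.
  by have /andP[] := last_active01 w (q01' N) i.
move=> u /= /andP[u0 ut] Ju.
by apply: (@last_time_ge _ [set u | 0 <= u <= q N] (q N) _ (fun u => J i u w)) => //=; rewrite u0 (le_trans ut)// ltW.
Qed.

Let last_cvg i : last_active J i (q N) w @[N --> \oo] --> last_active J i t w.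
Proof.
have [Jt|nJ] := boolP (J i t w); last by apply: cvg_near_cst; exact: last_off.
rewrite (last_active_on t01' Jt).
apply: (squeeze_cvgr _ (cvg_cst t) qt); apply: nearW => N.
have le_t : 0 <= t <= q N by rewrite !ltW.
apply/andP; split.
  exact: (@last_time_ge _ [set u | 0 <= u <= q N] (q N) _ (fun u => J i u w)).
apply: (@last_time_le _ [set u | 0 <= u <= q N] (q N) _ (fun u => J i u w)) => //.
by rewrite ltW// (lt_trans t0).
Qed.

(** If the precision vanishes at t > 0, no coordinate is on at t, and the precision
    remains 0 for a while. *)
Lemma estimate_right_cvg : regular beta w ->
  estimate X sigma beta J idfun (q N) w @[N --> \oo] --> estimate X sigma beta J idfun t w.
Proof.
move=> rw; apply: posterior_cvg => //.
- by apply: precision_ge0; exact: last_active01.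
- refine (precision_cvg sigma_gt0 (r_ := fun N => last (q N) w) (r := last t w) _ last_cvg) => i.
  by case/andP: (last_active01 w t01' i).
- refine (statistic_cvg sigma_gt0 (X := X) (r_ := fun N => last (q N) w)
    (r := last t w) rw _ _ last_cvg); last exact: last_active01.
  by move=> N i; case/andP: (last_active01 w (q01' N) i) => -> /ltW.
move=> c0; have li0 i : last_active J i t w = 0.
  exact: (precision_eq0 sigma_gt0 (last_active01 w t01') c0).
have off i : ~~ J i t w.
  apply/negP => /(last_active_on t01'); rewrite li0 => e.
  by move: t0; rewrite -e ltxx.
have : \forall N \near \oo, forall i, last_active J i (q N) w = 0.
  apply: filter_forall => i; apply: filterS (last_off (off i)) => N ->.
  exact: li0.
by apply: filterS => N h; rewrite /precision big1// => i _; rewrite h mul0r.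
Qed.

End right_continuity.

(** Right-continuity of both sides reduces the statement for all times to the
    rational ones. *)
Lemma estimate_all_times (Xt : R -> T -> R) : {ae P, forall w, regular beta w} ->
  {ae P, forall w, cadlag (fun t => Xt t w)} ->
  (forall t, 0 <= t < 1 -> {ae P, forall w, Xt t w = estimate X sigma beta J idfun t w}) ->
  {ae P, forall w, forall t, 0 <= t < 1 -> Xt t w = estimate X sigma beta J idfun t w}.
Proof.
move=> aer aec aeX.
have aeq : {ae P, forall w, forall q : rat, 0 <= (ratr q : R) < 1 ->
    Xt (ratr q) w = estimate X sigma beta J idfun (ratr q) w}.
  have := ae_foralln (mu := P) (P := fun k w => if @unpickle rat k is Some q then
    0 <= (ratr q : R) < 1 -> Xt (ratr q) w = estimate X sigma beta J idfun (ratr q) w else True).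
  move=> /(_ _)/filterS; apply => [w hw q|k]; first by have := hw (pickle q); rewrite pickleK.
  case: (unpickle k) => [q|]; last exact: aeW.
  have [h|h] := pselect (0 <= (ratr q : R) < 1); first by apply: filterS (aeX _ h).
  exact: aeW.
apply: filterS3 aer aec aeq => w rw [cad _] eqq t t01.
have /andP[t0 t1] := t01.
move: t0; rewrite le_eqVlt => /predU1P[e|t0].
  by have := eqq 0; rewrite rmorph0 lexx ltr01 -e => /(_ isT).
have exq N : exists q : rat, t < ratr q /\ ratr q < Num.min 1 (t + N.+1%:R^-1) :> R.
  have : t < Num.min 1 (t + N.+1%:R^-1) by rewrite lt_min t1 ltrDl invr_gt0 ltr0n.
  by move=> /rat_in_itvoo[q]; rewrite in_itv /= => /andP[]; exists q.
pose q N := ratr (projT1 (cid (exq N))) : R.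
have q_ N : t < q N < 1 /\ q N < t + N.+1%:R^-1.
  rewrite /q; case: (cid _) => r /= [h1]; rewrite lt_min => /andP[h2 h3].
  by rewrite h1 h2.
have q01 N := (q_ N).1.
have qt : q @ \oo --> t.
  apply/cvg_seqP => e e0; apply: filterS (near_infty_inv e0) => N hN.
  have [/andP[h1 _] h2] := q_ N; rewrite distrC ger0_norm ?subr_ge0 1?ltW//.
  by rewrite ltrBlDl (lt_trans h2)// ltrD2l.
have tt : 0 < t < 1 by rewrite t0.
have c1 := estimate_right_cvg tt q01 qt rw.
have c2 : Xt (q N) w @[N --> \oo] --> Xt t w.
  apply/cvg_seqP => e e0; have /cvgrPdist_lt/(_ e e0) := cad t t01.
  move=> /nbhs_ballP[r /= r0 hr]; have /cvg_seqP/(_ r r0) := qt.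
  apply: filterS => N hN; apply: hr => //.
  by have [/andP[]] := q_ N.
have c3 : Xt (q N) w @[N --> \oo] --> estimate X sigma beta J idfun t w.
  rewrite (_ : (fun N => _) = fun N => estimate X sigma beta J idfun (q N) w)//.
  apply/funext => N; apply: eqq; have /andP[h1 h2] := q01 N.
  by rewrite h2 ltW// (lt_trans t0).
by rewrite -(cvg_lim _ c2)//; apply/cvg_lim.
Qed.

End jumps.

(** * Gaussian mixtures *)

Section gaussian_mixtures.
Context {R : realType}.
Local Notation N01 := (normal_prob (0 : R) 1).

Definition product_law {d1 d2 : measure_display} {T1 : measurableType d1}
    {T2 : measurableType d2} (P1 : probability T1 R) (P2 : probability T2 R) :
  probability (T1 * T2)%type R := (P1 \x P2)%E.

Lemma measurable_sqrt : measurable_fun setT (Num.sqrt : R -> R).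
Proof. by apply: continuous_measurable_fun; exact: sqrt_continuous. Qed.

Lemma Rintegral_product {d1 d2 : measure_display} {T1 : measurableType d1}
    {T2 : measurableType d2} (P1 : probability T1 R) (P2 : probability T2 R)
    (F : T1 * T2 -> R) : bounded_measurable F ->
  \int[product_law P1 P2]_z F z = \int[P1]_x \int[P2]_y F (x, y).
Proof.
move=> bF; have iF : (P1 \x P2)%E.-integrable setT (EFin \o F).
  exact: (bounded_integrable (product_law P1 P2) bF).
rewrite /Rintegral -(integral12_prod_meas1 iF); congr fine.
apply: eq_integral => x _; rewrite /fubini_F fineK//.
apply: (integrable_fin_num measurableT).
have [mF [M hM]] := bF.
have b2 : bounded_measurable (fun y => F (x, y)).
  by apply: bounded_measurable_comp; [exact: measurable_pair1|split => //; exists M].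
exact: (bounded_integrable P2 b2).
Qed.

Lemma normal_prob_cos (m v t th : R) : 0 < v ->
  \int[normal_prob m (Num.sqrt v)]_x cos (t * x + th) =
  cos (t * m + th) * expR (- (t ^+ 2 * v / 2)).
Proof.
move=> v0; have mid : measurable_fun setT (fun x : R => x) by exact: measurable_id.
have law C : measurable C -> normal_prob m (Num.sqrt v) ((fun x : R => x) @^-1` C) = gaussian_law m v C.
  by move=> _; rewrite /gaussian_law gt_eqF.
exact: (@gaussian_law_cos _ _ _ (normal_prob m (Num.sqrt v)) _ _ _ mid (ltW v0) law).
Qed.

Lemma standard_normal_cos (t th : R) :
  \int[N01]_x cos (t * x + th) = cos th * expR (- (t ^+ 2 / 2)).
Proof. by have := normal_prob_cos 0 t th (@ltr01 R); rewrite sqrtr1 mulr0 add0r mulr1. Qed.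

(** A normal variable of mean m and variance v is m plus the standard deviation
    times a standard one; this form also covers v = 0. *)
Lemma gaussian_law_affine (m v : R) (B : set R) : 0 <= v -> measurable B ->
  fine (gaussian_law m v B) = \int[N01]_x \1_B (m + Num.sqrt v * x).
Proof.
move=> v0 mB; move: (v0); rewrite le_eqVlt => /predU1P[<-|vp].
  rewrite /gaussian_law eqxx.
  transitivity (\int[N01]_x (\1_B m : R)).
    by rewrite Rintegral_cst_probability diracE indicE.
  by apply: eq_Rintegral => x _; rewrite sqrtr0 mul0r addr0.
have mid : measurable_fun setT (fun x : R => x) by exact: measurable_id.
have mV : measurable_fun setT (fun x : R => m + Num.sqrt v * x).
  by apply: measurable_funD => //; exact: measurable_funM.
have b1 := @bounded_measurable_cst _ R R 1.
have i1 := bounded_integrable N01 b1.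
have i2 := bounded_integrable (normal_prob m (Num.sqrt v)) b1.
have := @fourier_uniqueness _ _ _ _ _ N01 (normal_prob m (Num.sqrt v)) _ _ _ _ mV mid i1 i2 _
  (\1_B) (bounded_measurable_indic mB).
move=> h.
transitivity (\int[N01]_x (1 * \1_B (m + Num.sqrt v * x))); last first.
  by apply: eq_Rintegral => x _; rewrite mul1r.
rewrite h => [|t th].
  under eq_Rintegral do rewrite mul1r.
  have -> : gaussian_law m v B = normal_prob m (Num.sqrt v) B.
    by rewrite /gaussian_law gt_eqF.
  exact: esym (Rintegral_indic (normal_prob m (Num.sqrt v)) mB).
under eq_Rintegral do rewrite mul1r.
under [RHS]eq_Rintegral do rewrite mul1r.
rewrite (normal_prob_cos m t th vp).
rewrite (_ : (\int[_]_x _) = \int[N01]_x cos ((t * Num.sqrt v) * x + (t * m + th))); last first.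
  by apply: eq_Rintegral => x _; congr cos; ring.
by rewrite standard_normal_cos exprMn sqr_sqrtr.
Qed.

Lemma measurable_gaussian_law {d' : measure_display} {T' : measurableType d'}
    (M V : T' -> R) (B : set R) : measurable_fun setT M -> measurable_fun setT V ->
  (forall w, 0 <= V w) -> measurable B ->
  measurable_fun setT (fun w => fine (gaussian_law (M w) (V w) B)).
Proof.
move=> mM mV V0 mB.
rewrite (_ : (fun w => _) = fun w => \int[N01]_x \1_B (M w + Num.sqrt (V w) * x)); last first.
  by apply/funext => w; rewrite gaussian_law_affine.
apply: (@measurable_Rintegral_section _ _ _ _ _ N01
  (fun z => \1_B (M z.1 + Num.sqrt (V z.1) * z.2))).
apply: (measurableT_comp (measurable_indic mB)); apply: measurable_funD.
  exact: measurableT_comp mM measurable_fst.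
apply: measurable_funM => //.
apply: (measurableT_comp (measurable_sqrt)); exact: measurableT_comp mV measurable_fst.
Qed.

Lemma gaussian_law01 (m v : R) (B : set R) : 0 <= v -> measurable B ->
  0 <= fine (gaussian_law m v B) <= 1.
Proof.
move=> v0 mB; rewrite gaussian_law_affine//.
have b : bounded_measurable (fun x : R => \1_B (m + Num.sqrt v * x) : R).
  apply: bounded_measurable_comp; last exact: bounded_measurable_indic.
  by apply: measurable_funD => //; exact: measurable_funM.
apply/andP; split; first by apply: Rintegral_ge0 => x _; rewrite indicE.
rewrite -[leRHS](Rintegral_cst_probability N01); apply: le_Rintegral => //.
- exact: (bounded_integrable N01 b).
- exact: (bounded_integrable N01 (bounded_measurable_cst 1)).
Qed.

(** The pair of the outcome and an independent standard normal variable realises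
    the mixture of the laws N (M, V); its Fourier transform is compared with that
    of Z on the event A. *)
Lemma cond_gaussian_cos {d : measure_display} {T : measurableType d}
    (P : probability T R) (A : set T) (Z M V : T -> R) (B : set R) :
  measurable A -> measurable_fun setT Z -> measurable_fun setT M ->
  measurable_fun setT V -> (forall w, 0 <= V w) -> measurable B ->
  (forall l th, \int[P]_w (\1_A w * cos (l * Z w + th)) =
     \int[P]_w (\1_A w * (cos (l * M w + th) * expR (- (l ^+ 2 * V w / 2))))) ->
  \int[P]_w (\1_A w * \1_B (Z w)) = \int[P]_w (\1_A w * fine (gaussian_law (M w) (V w) B)).
Proof.
move=> mA mZ mM mV V0 mB H.
have bA := @bounded_measurable_indic _ _ R _ mA.
pose W (z : T * R) := M z.1 + Num.sqrt (V z.1) * z.2.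
pose m2 := product_law P N01.
have mid : measurable_fun setT (fun x : R => x) by exact: measurable_id.
have mW : measurable_fun setT W.
  apply: measurable_funD; first exact: measurableT_comp mM measurable_fst.
  apply: measurable_funM => //.
  apply: (measurableT_comp (measurable_sqrt)); exact: measurableT_comp mV measurable_fst.
have bA2 : bounded_measurable (fun z : T * R => \1_A z.1 : R).
  by apply: (bounded_measurable_comp _ bA); exact: measurable_fst.
have inner phi : bounded_measurable phi ->
    \int[m2]_z (\1_A z.1 * phi (W z)) = \int[P]_w (\1_A w * \int[N01]_x phi (W (w, x))).
  move=> bphi.
  have bp : bounded_measurable (fun z : T * R => \1_A z.1 * phi (W z)).
    by apply: bounded_measurableM => //; exact: bounded_measurable_comp.
  transitivity (\int[P]_w \int[N01]_x (\1_A w * phi (W (w, x)))).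
    exact: (Rintegral_product P N01 bp).
  apply: eq_Rintegral => w _ /=.
  rewrite RintegralZl//; apply: bounded_integrable.
  apply: bounded_measurable_comp bphi; exact: measurableT_comp mW (measurable_pair1 w).
rewrite (@fourier_uniqueness _ _ _ _ _ P m2 Z W _ (fun z => \1_A z.1) mZ mW
  (bounded_integrable P bA) (bounded_integrable m2 bA2) _ (\1_B))//.
- rewrite inner; last exact: bounded_measurable_indic.
  by apply: eq_Rintegral => w _; rewrite gaussian_law_affine.
- move=> l th; rewrite H.
  have bc : bounded_measurable (fun x : R => cos (l * x + th)).
    exact: (bounded_measurable_cos_phase l th mid).
  rewrite (inner _ bc).
  apply: eq_Rintegral => w _; congr (_ * _).
  rewrite (_ : (\int[_]_x _) = \int[N01]_x cos ((l * Num.sqrt (V w)) * x + (l * M w + th))); last first.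
    by apply: eq_Rintegral => x _; congr cos; rewrite /W /=; ring.
  by rewrite standard_normal_cos exprMn sqr_sqrtr.
- exact: bounded_measurable_indic.
Qed.

End gaussian_mixtures.

(** * Conditional law of the jump statistic *)

Section activation_sets.
Context {d : measure_display} {T : measurableType d} {R : realType} {n : nat}.

Lemma measurable_set_valued (k : T -> {set 'I_n}) :
  (forall i, measurable_fun setT (fun w => i \in k w)) ->
  forall Y : pred {set 'I_n}, measurable [set w | Y (k w)].
Proof.
move=> mk Y.
have mk1 y : measurable (k @^-1` [set y]).
  rewrite (_ : _ @^-1` _ = \bigcap_(i in [set: 'I_n]) ((fun w => i \in k w) @^-1` [set i \in y])).
    apply: fin_bigcap_measurable => // i _.
    by rewrite -[X in measurable X]setTI; exact: mk.
  apply/seteqP; split => [w /= <- i _ //|w h].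
  by apply/setP => i; exact: (h i I).
rewrite (_ : [set w | _] = \bigcup_(y in [set: {set 'I_n}]) (if Y y then k @^-1` [set y] else set0)).
  by apply: fin_bigcup_measurable => // y _; case: ifP.
apply/seteqP; split => [w Yw|w [y _]]; first by exists (k w) => //; rewrite Yw.
by case: ifP => // Yy /= ->.
Qed.

Lemma measurable_sum_in (k : T -> {set 'I_n}) (f : 'I_n -> T -> R) :
  (forall i, measurable_fun setT (fun w => i \in k w)) ->
  (forall i, measurable_fun setT (f i)) ->
  measurable_fun setT (fun w => \sum_(i in k w) f i w).
Proof.
move=> mk mf.
rewrite (_ : (fun w => _) = fun w => \sum_i (if i \in k w then f i w else 0)).
  by apply: measurable_sum => i; exact: measurable_fun_ifT.
by apply/funext => w; rewrite big_mkcond.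
Qed.

End activation_sets.

Lemma cond_gaussian_cst {d : measure_display} {T : measurableType d} {R : realType}
    (P : probability T R) (G : set (set T)) (Z : T -> R) (c : R) :
  (forall w, Z w = c) -> cond_gaussian P <<s G >> Z (fun=> c) (fun=> 0).
Proof.
move=> Zc.
have mcst (a : R) B : measurable B -> <<s G >> ((fun _ : T => a) @^-1` B).
  by apply: (sigma_measurableP G (fun=> a)).2; exact: measurable_cst.
split => [B mB|B mB|//|B mB]; [exact: mcst|exact: mcst|].
have -> : \1_(Z @^-1` B) = (fun=> fine (gaussian_law c 0 B)) :> (T -> R).
  apply/funext => w; rewrite /gaussian_law eqxx diracE indicE.
  by congr (nat_of_bool _)%:R; rewrite -(Zc w); apply/idP/idP => /set_mem h; exact/mem_set.
split => [C mC||A _ //]; first exact: mcst.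
exact: bounded_integrable (bounded_measurable_cst _).
Qed.

Section conditional_jump.
Context {d : measure_display} {T : measurableType d} {R : realType}.
Variable P : probability T R.
Variables (n : nat) (X : {RV P >-> R}) (sigma : 'I_n -> R)
  (beta : 'I_n -> R -> {RV P >-> R}) (J : 'I_n -> R -> {RV P >-> bool}).
Hypothesis sigma_gt0 : forall i, 0 < sigma i.
Hypothesis bridge : forall i, brownian_bridge (beta i).
Hypothesis indep : mutually_independent P
  (fun o : option 'I_n => if o is Some i
     then sigma_process `[0, 1] (fun u => beta i u : T -> R)
     else sigma_rv X).
Local Notation xi := (information X sigma beta).
Hypothesis indepJ : independent P
  <<s \bigcup_(i in [set: 'I_n]) sigma_process `[0, 1] (J i) >>
  <<s sigma_rv X `|` \bigcup_(i in [set: 'I_n]) sigma_process `[0, 1] (xi i) >>.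
Hypothesis null_measurable : null_sets P `<=` measurable.
Hypothesis cadJ : forall i w, cadlag (fun u => J i u w).
Local Notation obs := (observed X sigma beta J).
Local Notation cyl := (cylinder X sigma beta J).
Local Notation F := (modulated_filtration P X J xi).
Variable t : R.
Hypothesis t01 : 0 < t < 1.

Let t0 : 0 < t. Proof. by case/andP: t01. Qed.
Let t1 : t < 1. Proof. by case/andP: t01. Qed.

Local Notation K := (activated J t).
Local Notation before := [set u : R | 0 <= u < t].
Local Notation last i := (fun w => last_time before (fun u => J i u w)).

Let before_itv u : before u -> 0 <= u <= t.
Proof. by move=> /andP[-> /ltW]. Qed.
Let before0 : before 0. Proof. by rewrite /= lexx. Qed.

Let samples S0 (N : nat) : seq R := S0 ++ grid t N.

Let samples_before S0 : {in S0, forall u, 0 <= u < t} ->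
  forall N u, u \in samples S0 N -> before u.
Proof. by move=> S0t N u; rewrite mem_cat => /orP[/S0t//|/(grid_itv t0)]. Qed.

Let samples_end S0 u : before u -> u < t \/ forall N, u \in samples S0 N.
Proof. by move=> /andP[_ ut]; left. Qed.

Let samples_dense S0 u v : 0 <= u -> u < v -> v <= t ->
  \forall N \near \oo, exists2 s, s \in samples S0 N & u <= s < v.
Proof.
move=> u0 uv vt; apply: filterS (grid_dense u0 uv vt) => N [s sN su].
by exists s => //; rewrite mem_cat sN orbT.
Qed.

Lemma activatedE i w : (i \in K w) = ~~ left_limit (fun u => J i u w) t && J i t w.
Proof. by rewrite !inE. Qed.

(** A coordinate activated at t was off just before t. *)
Lemma last_lt i w : i \in K w -> 0 <= last i w < t.
Proof.
rewrite activatedE => /andP[nl _].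
have t01' : 0 < t <= 1 by rewrite t0 ltW.
rewrite last_time_ge0/=; have [e e0 he] := cadlag_bool_left (cadJ i w) t01'.
apply: (@le_lt_trans _ _ (Num.max 0 (t - e))); last by rewrite gt_max t0 gtrBl.
apply: (last_time_ub before_itv); first by rewrite le_max lexx.
move=> u /andP[u0 ut] Ju; rewrite le_max; apply/orP; right; rewrite leNgt.
by apply/negP => tu; move: nl; rewrite -(he u) ?tu// Ju.
Qed.

Section known_modulator.
Variable G : set (set T).
Hypothesis GJ : forall i u, 0 <= u <= t ->
  measurable_fun [set: g_sigma_algebraType G] (J i u : T -> bool).

(** The left limit is the limit along one sequence increasing to t. *)
Lemma measurable_left_limit i : measurable_fun [set: g_sigma_algebraType G]
  (fun w => left_limit (fun u => J i u w) t : bool).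
Proof.
pose u N := t - t * N.+1%:R^-1.
have u_t N : 0 <= u N < t.
  rewrite /u subr_ge0 gtrBl mulr_gt0 ?invr_gt0 ?ltr0n// andbT.
  by rewrite -[leRHS]mulr1 ler_pM2l// invf_le1 ?ltr0n// ler1n.
have mr b : measurable_fun [set: g_sigma_algebraType G] (b : T -> bool) ->
    measurable_fun [set: g_sigma_algebraType G] (fun w => (b w)%:R : R).
  move=> mb; rewrite (_ : (fun w => _) = fun w => if b w then 1 else 0).
    exact: measurable_fun_ifT.
  by apply/funext => w; case: (b w).
have ml : measurable_fun [set: g_sigma_algebraType G]
    (fun w => (left_limit (fun u => J i u w) t : bool)%:R : R).
  apply: (@measurable_fun_cvg _ (g_sigma_algebraType G) R setT (fun N w => (J i (u N) w)%:R)).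
    by move=> N; apply: mr; apply: GJ; have /andP[-> /ltW] := u_t N.
  move=> w _; apply: cvg_near_cst.
  have t01' : 0 < t <= 1 by rewrite t0 ltW.
  have [e e0 he] := cadlag_bool_left (cadJ i w) t01'.
  have et : 0 < e / t by rewrite divr_gt0.
  apply: filterS (near_infty_inv et) => N hN; rewrite he//.
  have /andP[_ ->] := u_t N; rewrite andbT /u ltrD2l ltrN2.
  by rewrite mulrC -ltr_pdivlMr.
apply: (@measurable_fun_bool _ (g_sigma_algebraType G) setT _ true).
have := ml measurableT [set 1] (measurable_set1 1).
rewrite (_ : _ @^-1` [set 1] = (fun w => left_limit (fun u => J i u w) t : bool) @^-1` [set true])//.
apply/seteqP; split => w /=; last by move=> ->.
by case: (left_limit _ _) => //= /eqP; rewrite eq_sym oner_eq0.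
Qed.

Lemma measurable_activated i :
  measurable_fun [set: g_sigma_algebraType G] (fun w => i \in K w).
Proof.
rewrite (_ : (fun w => _) = fun w => if left_limit (fun u => J i u w) t : bool then false else J i t w).
  apply: measurable_fun_ifT => //; first exact: measurable_left_limit.
  by apply: GJ; rewrite lexx ltW.
by apply/funext => w; rewrite activatedE; case: (left_limit _ _).
Qed.

End known_modulator.

Let gensJ := \bigcup_(i in [set: 'I_n]) sigma_process `[0, 1] (fun u => J i u : T -> bool).

Let gensJ_J i u : 0 <= u <= t -> measurable_fun [set: g_sigma_algebraType gensJ] (J i u : T -> bool).
Proof.
move=> /andP[u0 ut]; apply: (sigma_measurableP gensJ (J i u : T -> bool)).1 => B _.
by apply: sigmaJ_process; rewrite u0 (le_trans ut)// ltW.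
Qed.

Lemma sigmaJ_activated (y : {set 'I_n}) :
  <<s \bigcup_(i in [set: 'I_n]) sigma_process `[0, 1] (J i) >> (K @^-1` [set y]).
Proof.
have := @measurable_set_valued _ (g_sigma_algebraType gensJ) n K (measurable_activated gensJ_J) (pred1 y).
rewrite (_ : [set w | _] = K @^-1` [set y])//.
by apply/seteqP; split => w /= /eqP.
Qed.

Let measurable_activatedT i : measurable_fun setT (fun w => i \in K w).
Proof.
move=> _ B mB; rewrite setTI; apply: (@sigmaJ_measurable _ _ _ _ _ J).
exact: (sigma_measurableP gensJ (fun w => i \in K w)).2 (measurable_activated gensJ_J i) B mB.
Qed.

(** Conditional mean and variance of the jump statistic, given X, the values
    observed before t and the set of activated coordinates. *)
Definition cond_mean (w : T) : R :=
  jump_mean X sigma beta t (K w) (fun i => last i w) w.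

Definition cond_variance (w : T) : R :=
  jump_variance sigma t (K w) (fun i => last i w).

Lemma cond_variance_ge0 w : 0 <= cond_variance w.
Proof. by apply: jump_variance_ge0 => // i /last_lt. Qed.

Lemma cond_variance_gt0 w : (0 < #|K w|)%N -> 0 < cond_variance w.
Proof.
move=> /card_gt0P[i iK].
have pos j : j \in K w -> 0 < (t - last j w) / (sigma j ^+ 2 * (1 - t) * (1 - last j w)).
  move=> /last_lt /andP[l0 lt]; rewrite divr_gt0 ?subr_gt0// !mulr_gt0 ?exprn_gt0 ?subr_gt0//.
  exact: lt_trans t1.
rewrite /cond_variance /jump_variance (bigD1 i)//=.
apply: ltr_pwDl; first exact: pos.
by apply: sumr_ge0 => j /andP[/pos /ltW].
Qed.

Section measurability.
Context {d' : measure_display} {T' : measurableType d'}.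
Variables (k : T' -> {set 'I_n}) (r y : 'I_n -> T' -> R) (x : T' -> R).
Hypotheses (mk : forall i, measurable_fun setT (fun w => i \in k w))
  (mr : forall i, measurable_fun setT (r i)).

Lemma measurable_mean_of : measurable_fun setT x -> (forall i, measurable_fun setT (y i)) ->
  measurable_fun setT (fun w => \sum_(i in k w) (x w * (t - r i w) / ((1 - r i w) * (1 - t)) +
    y i w / (1 - r i w)) / sigma i ^+ 2).
Proof.
move=> mx my; apply: (measurable_sum_in (f := fun i w =>
  (x w * (t - r i w) / ((1 - r i w) * (1 - t)) + y i w / (1 - r i w)) / sigma i ^+ 2)) => // i.
have m1r : measurable_fun setT (fun w => 1 - r i w) by exact: measurable_funB.
apply: measurable_funM => //; apply: measurable_funD; apply: measurable_funM => //.
- by apply: measurable_funM => //; exact: measurable_funB.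
- by apply: measurable_funV; exact: measurable_funM.
- exact: measurable_funV.
Qed.

Lemma measurable_variance_of :
  measurable_fun setT (fun w => \sum_(i in k w)
    (t - r i w) / (sigma i ^+ 2 * (1 - t) * (1 - r i w))).
Proof.
apply: (measurable_sum_in (f := fun i w => (t - r i w) / (sigma i ^+ 2 * (1 - t) * (1 - r i w)))) => // i.
have m1r : measurable_fun setT (fun w => 1 - r i w) by exact: measurable_funB.
apply: measurable_funM; first exact: measurable_funB.
by apply: measurable_funV; exact: measurable_funM.
Qed.

End measurability.

Definition pre_jump_gens : set (set T) := left_sigma F t `|` sigma_rv X
  `|` [set A | exists i, A = [set w | i \in activated J t w]].

Lemma pre_jump_filtration s : 0 <= s < t -> F s `<=` <<s pre_jump_gens >>.
Proof.
move=> st A FA; apply: sub_sigma_algebra; left; left; rewrite /left_sigma t0.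
by apply: sub_sigma_algebra; exists s; [rewrite /= in_itv|].
Qed.

Lemma pre_jump_null : null_sets P `<=` <<s pre_jump_gens >>.
Proof.
move=> A nA; apply: (@pre_jump_filtration 0); first by rewrite lexx.
by apply: sub_sigma_algebra; right.
Qed.

Lemma pre_jump_J i u : 0 <= u < t ->
  measurable_fun [set: g_sigma_algebraType pre_jump_gens] (J i u : T -> bool).
Proof.
move=> ut; apply: (sigma_measurableP pre_jump_gens (J i u : T -> bool)).1 => B mB.
apply: (pre_jump_filtration ut).
apply: (sigma_measurableP (filtration_gens X sigma beta J u) (J i u : T -> bool)).2 mB.
by apply: filtration_J; have /andP[-> _] := ut; rewrite lexx.
Qed.

Lemma pre_jump_observed i u : 0 <= u < t ->
  measurable_fun [set: g_sigma_algebraType pre_jump_gens] (obs i u).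
Proof.
move=> ut; apply: (sigma_measurableP pre_jump_gens (obs i u)).1 => B mB.
apply: (pre_jump_filtration ut).
apply: (sigma_measurableP (filtration_gens X sigma beta J u) (obs i u)).2 mB.
by apply: filtration_observed; have /andP[-> _] := ut; rewrite lexx.
Qed.

Lemma pre_jump_X : measurable_fun [set: g_sigma_algebraType pre_jump_gens] (X : T -> R).
Proof.
apply: (sigma_measurableP pre_jump_gens (X : T -> R)).1 => B mB.
by apply: sub_sigma_algebra; left; right; exists B => //; rewrite setTI.
Qed.

Lemma pre_jump_activated i :
  measurable_fun [set: g_sigma_algebraType pre_jump_gens] (fun w => i \in K w).
Proof.
apply: (@measurable_fun_bool _ (g_sigma_algebraType pre_jump_gens) setT _ true).
by rewrite setTI; apply: sub_sigma_algebra; right; exists i.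
Qed.

Let no_sample : {in [::], forall u : R, 0 <= u < t}. Proof. by []. Qed.

Let last_pre_jump i : measurable_fun [set: g_sigma_algebraType pre_jump_gens] (last i).
Proof.
exact: (measurable_last before_itv (ltW t1) (samples_before no_sample)
  (@samples_end [::]) (samples_dense [::]) cadJ pre_jump_null pre_jump_J).
Qed.

Lemma measurable_cond_mean :
  measurable_fun [set: g_sigma_algebraType pre_jump_gens] cond_mean.
Proof.
apply: (@measurable_mean_of _ (g_sigma_algebraType pre_jump_gens) K
  (fun i w => last i w) (fun i w => xi i (last i w) w) X).
- exact: pre_jump_activated.
- exact: last_pre_jump.
- exact: pre_jump_X.
- move=> i; exact: (measurable_information_last bridge before_itv before0 (ltW t1) (samples_before no_sample)
  (@samples_end [::]) (samples_dense [::]) cadJ pre_jump_null pre_jump_J pre_jump_observed).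
Qed.

Lemma measurable_cond_variance :
  measurable_fun [set: g_sigma_algebraType pre_jump_gens] cond_variance.
Proof.
apply: (@measurable_variance_of _ (g_sigma_algebraType pre_jump_gens) K (fun i w => last i w)).
- exact: pre_jump_activated.
- exact: last_pre_jump.
Qed.

(** These events form a class stable by intersection that generates, up to
    negligible sets, the information preceding the jump. *)
Definition event S D (C : set R) (Y : pred {set 'I_n}) : set T :=
  cyl S D `&` (X : T -> R) @^-1` C `&` [set w | Y (K w)].

Lemma measurable_event S D C Y : (forall i u b, measurable (D i u b)) -> measurable C ->
  measurable (event S D C Y).
Proof.
move=> mD mC; apply: measurableI; first apply: measurableI.
- exact: measurable_cylinder.
- by rewrite -[X in measurable X]setTI; exact: measurable_funPT.
- exact: (measurable_set_valued measurable_activatedT).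
Qed.

Lemma pre_jump_sub (C : set (set T)) : sigma_algebra setT C -> null_sets P `<=` C ->
  (forall S D B Y, {in S, forall u, 0 <= u < t} -> (forall i u b, measurable (D i u b)) ->
     measurable B -> C (event S D B Y)) ->
  <<s pre_jump_gens >> `<=` C.
Proof.
move=> sC nC eC.
have all w : cyl [::] (fun _ _ _ => setT) w by [].
apply: smallest_sub => // A [[|]|].
- rewrite /left_sigma t0; apply: smallest_sub => // B [s]; rewrite /= in_itv /= => /andP[s0 st].
  apply: filtration_sub => //; first exact: lt_trans t1.
  move=> i u E /andP[u0 us] mE; rewrite -(cylinder_one_time X sigma beta J).
  rewrite (_ : cyl _ _ = event [:: u] (one_time i u E) setT predT).
    apply: eC => //; last exact: measurable_one_time.
    by move=> v; rewrite inE => /eqP ->; rewrite u0 (le_lt_trans us).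
  by apply/seteqP; split => [w h|w [[]]].
- move=> [B mB <-]; rewrite setTI.
  rewrite (_ : _ @^-1` B = event [::] (fun _ _ _ => setT) B predT).
    exact: eC.
  by apply/seteqP; split => [w h|w [[]]].
- move=> [i ->].
  rewrite (_ : [set w | _] = event [::] (fun _ _ _ => setT) setT (fun y => i \in y)).
    exact: eC.
  by apply/seteqP; split => [w h|w []].
Qed.

Lemma pre_jump_measurable : <<s pre_jump_gens >> `<=` measurable.
Proof.
apply: pre_jump_sub => //; first exact: sigma_algebra_measurable.
by move=> S D B Y _ mD mB; exact: measurable_event.
Qed.

Let sub_measurable (f : T -> R) :
  measurable_fun [set: g_sigma_algebraType pre_jump_gens] f -> measurable_fun setT f.
Proof.
move=> mf _ B mB; rewrite setTI.
by apply: pre_jump_measurable; exact: (sigma_measurableP pre_jump_gens f).2.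
Qed.

Let Z := jump_Z J xi sigma t.

Let measurable_Z : measurable_fun setT Z.
Proof.
apply: (measurable_sum_in measurable_activatedT (f := fun i w => xi i t w / (sigma i ^+ 2 * (1 - t)))) => // i.
by apply: measurable_funM => //; exact: measurable_information.
Qed.

Let bounded_damping l (f : T -> R) : measurable_fun setT f -> (forall w, 0 <= f w) ->
  bounded_measurable (fun w => expR (- (l ^+ 2 * f w / 2)) : R).
Proof.
move=> mf f0; apply: bounded_measurable_expRN => [|w].
  by apply: measurable_funM => //; exact: measurable_funM.
by rewrite divr_ge0// mulr_ge0 ?sqr_ge0.
Qed.

(** Limit along grids of the identity for the past known at finitely many times. *)
Lemma jump_cos_event S0 D C Y l th : {in S0, forall u, 0 <= u < t} ->
  (forall i u b, measurable (D i u b)) -> measurable C ->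
  \int[P]_w (cos (l * Z w + th) * \1_(event S0 D C Y) w) =
  \int[P]_w (cos (l * cond_mean w + th) * expR (- (l ^+ 2 * cond_variance w / 2)) *
    \1_(event S0 D C Y) w).
Proof.
move=> S0t mD mC; set A := event S0 D C Y.
have bA := @bounded_measurable_indic _ _ R _ (measurable_event S0 Y mD mC).
pose S := samples S0.
pose r N i w := last_seen J (S N) i w.
pose M_ N w := jump_mean X sigma beta t (K w) (fun i => r N i w) w.
pose V_ N w := jump_variance sigma t (K w) (fun i => r N i w).
have rl N i w : r N i w <= last i w by exact: (last_seen_leE J before_itv (samples_before S0t)).
have r0 N i w : 0 <= r N i w by exact: last_seen_ge0.
have mr N i : measurable_fun setT (r N i).
  by apply: measurable_bigmax_on => u _; exact: measurable_funPT.
have mM N : measurable_fun setT (M_ N).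
  apply: (@measurable_mean_of _ _ K (r N) (fun i w => xi i (r N i w) w) X measurable_activatedT (mr N)) => // i.
  apply: (measurable_at_bigmax_on (V := xi i)) => u _; first exact: measurable_funPT.
  exact: measurable_information.
have mV N : measurable_fun setT (V_ N) by exact: (@measurable_variance_of _ _ K (r N) measurable_activatedT (mr N)).
have V0 N w : 0 <= V_ N w.
  apply: jump_variance_ge0 => // i /last_lt /andP[_ lt].
  by rewrite r0 (le_lt_trans (rl _ _ _)).
have bcos (f g : T -> R) : measurable_fun setT f -> measurable_fun setT g -> (forall w, 0 <= g w) ->
    bounded_measurable (fun w => cos (l * f w + th) * expR (- (l ^+ 2 * g w / 2))).
  move=> mf mg g0; apply: bounded_measurableM; first exact: bounded_measurable_cos_phase.
  exact: bounded_damping.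
have lim : \int[P]_w (\1_A w * (cos (l * M_ N w + th) * expR (- (l ^+ 2 * V_ N w / 2)))) @[N --> \oo] -->
    \int[P]_w (\1_A w * (cos (l * cond_mean w + th) * expR (- (l ^+ 2 * cond_variance w / 2)))).
  apply: (weighted_bounded_cvg (M := 1) (bounded_integrable P bA)).
  - by move=> N; exact: (bcos _ _ (mM N) (mV N) (V0 N)).1.
  - exact: (bcos _ _ (sub_measurable measurable_cond_mean) (sub_measurable measurable_cond_variance) cond_variance_ge0).1.
  - move=> N w; rewrite normrM -[leRHS]mulr1; apply: ler_pM => //.
      by rewrite ler_norml cos_geN1 cos_le1.
    by rewrite gtr0_norm ?expR_gt0// -[leRHS]expR0 ler_expR oppr_le0 divr_ge0// mulr_ge0 ?sqr_ge0.
  - apply: filterS (regular_ae bridge) => w rw.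
    have cr i : r N i w @[N --> \oo] --> last i w.
      exact: (last_seen_cvgE before_itv (ltW t1) (samples_before S0t)
        (@samples_end S0) (samples_dense S0) cadJ).
    have l01 i : 0 <= last i w <= 1.
      rewrite last_time_ge0/= (le_trans (last_time_le before_itv _ (ltW t0)))//.
      exact: ltW.
    have c1r i : i \in K w -> (1 - r N i w)^-1 @[N --> \oo] --> (1 - last i w)^-1.
      move=> /last_lt /andP[_ lt]; apply: cvgV.
        by rewrite subr_eq0 gt_eqF// (lt_trans lt).
      by apply: cvgB => //; exact: cvg_cst.
    have t1' : 1 - t != 0 by rewrite subr_eq0 gt_eqF.
    have cM : M_ N w @[N --> \oo] --> cond_mean w.
      rewrite /M_ /cond_mean /jump_mean.
      rewrite (_ : (fun N => _) = fun N => \sum_(i in K w) if i \in K w then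
        (X w * (t - r N i w) / ((1 - r N i w) * (1 - t)) + xi i (r N i w) w / (1 - r N i w)) / sigma i ^+ 2 else 0); last first.
        by apply/funext => N; apply: eq_bigr => i ->.
      rewrite (_ : \sum_(i in K w) _ = \sum_(i in K w) if i \in K w then
        (X w * (t - last i w) / ((1 - last i w) * (1 - t)) + xi i (last i w) w / (1 - last i w)) / sigma i ^+ 2 else 0); last first.
        by apply: eq_bigr => i ->.
      apply: (cvg_sum_seq (f := fun i N => if i \in K w then
        (X w * (t - r N i w) / ((1 - r N i w) * (1 - t)) + xi i (r N i w) w / (1 - r N i w)) / sigma i ^+ 2 else 0)) => i.
      case: ifPn => iK; last exact: cvg_cst.
      apply: cvgMr_tmp; apply: cvgD.
        apply: cvgM; first by apply: cvgMl_tmp; apply: cvgB => //; exact: cvg_cst.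
        under eq_fun do rewrite invfM; rewrite invfM.
        by apply: cvgMr_tmp; exact: c1r.
      apply: cvgM; last exact: c1r.
      apply: information_cvg => // N; rewrite r0 (le_trans (rl _ _ _))//.
      by case/andP: (l01 i).
    have cV : V_ N w @[N --> \oo] --> cond_variance w.
      rewrite /V_ /cond_variance /jump_variance.
      rewrite (_ : (fun N => _) = fun N => \sum_(i in K w) if i \in K w then
        (t - r N i w) / (sigma i ^+ 2 * (1 - t) * (1 - r N i w)) else 0); last first.
        by apply/funext => N; apply: eq_bigr => i ->.
      rewrite (_ : \sum_(i in K w) _ = \sum_(i in K w) if i \in K w then
        (t - last i w) / (sigma i ^+ 2 * (1 - t) * (1 - last i w)) else 0); last first.
        by apply: eq_bigr => i ->.
      apply: (cvg_sum_seq (f := fun i N => if i \in K w then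
        (t - r N i w) / (sigma i ^+ 2 * (1 - t) * (1 - r N i w)) else 0)) => i.
      case: ifPn => iK; last exact: cvg_cst.
      apply: cvgM; first by apply: cvgB => //; exact: cvg_cst.
      under eq_fun do rewrite invfM; rewrite invfM.
      by apply: cvgMl_tmp; exact: c1r.
    apply: cvgM.
      apply: (@cvg_comp _ _ _ (fun N => l * M_ N w + th) cos _ _ _ _ (@continuous_cos R _)).
      by apply: cvgD; [exact: cvgMl_tmp|exact: cvg_cst].
    apply: (@cvg_comp _ _ _ (fun N => - (l ^+ 2 * V_ N w / 2)) expR _ _ _ _ (@continuous_expR R _)).
    by apply: cvgN; apply: cvgMr_tmp; exact: cvgMl_tmp.
transitivity (\int[P]_w (\1_A w * (cos (l * cond_mean w + th) * expR (- (l ^+ 2 * cond_variance w / 2))))); last first.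
  by apply: eq_Rintegral => w _; rewrite mulrC.
rewrite -[RHS](cvg_lim _ lim)//; apply/esym/cvg_lim => //; apply: cvg_near_cst.
apply: nearW => N; apply/esym/eqP; rewrite -subr_eq0; apply/eqP.
have b1 : bounded_measurable (fun w => cos (l * Z w + th) * \1_A w).
  by apply: bounded_measurableM => //; exact: (bounded_measurable_cos_phase l th measurable_Z).
have b2 : bounded_measurable (fun w => \1_A w * (cos (l * M_ N w + th) * expR (- (l ^+ 2 * V_ N w / 2)))).
  by apply: bounded_measurableM => //; exact: bcos.
rewrite -RintegralB//; [|exact: bounded_integrable..].
pose q (y : {set 'I_n}) (x : R) : R := \1_C x * (Y y)%:R.
have bq y : bounded_measurable (q y).
  apply: bounded_measurableM; first exact: bounded_measurable_indic.
  exact: bounded_measurable_cst.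
have SN : {subset S0 <= S N} by move=> u uS; rewrite mem_cat uS.
have := jump_stat_cylinder sigma_gt0 bridge indep indepJ l th t01 (samples_before S0t (N := N))
  (measurable_restrict S0 mD) sigmaJ_activated bq.
rewrite -cylinder_restrict// => h; rewrite -[RHS]h; apply: eq_Rintegral => w _.
have e1 : \1_((X : T -> R) @^-1` C) w = \1_C (X w) :> R by [].
have e2 : \1_[set w | Y (K w)] w = (Y (K w))%:R :> R.
  by rewrite indicE; congr ((nat_of_bool _)%:R); apply/idP/idP => [/set_mem//|h']; exact/mem_set.
rewrite /A /event !indicI /= e1 e2 /q.
by rewrite -[jump_stat X sigma beta t (K w) w]/(Z w) /M_ /V_ /r /S; ring.
Qed.

Let gens_cos l th A : <<s pre_jump_gens >> A ->
  \int[P]_w (cos (l * Z w + th) * \1_A w) =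
  \int[P]_w (cos (l * cond_mean w + th) * expR (- (l ^+ 2 * cond_variance w / 2)) * \1_A w).
Proof.
move=> HA.
pose C : set (set T) := [set A | exists S D B Y, [/\ {in S, forall u, 0 <= u < t},
  forall i u b, measurable (D i u b), measurable B & A = event S D B Y]].
apply: (weighted_eq_complete (C := C)) => //.
- move=> _ _ [S1 [D1 [E1 [Y1 [S1t mD1 mE1 ->]]]]] [S2 [D2 [E2 [Y2 [S2t mD2 mE2 ->]]]]].
  exists (S1 ++ S2), (fun i u b => restrict S1 D1 i u b `&` restrict S2 D2 i u b),
    (E1 `&` E2), (predI Y1 Y2); split.
  + by move=> u; rewrite mem_cat => /orP[/S1t|/S2t].
  + by move=> i u b; apply: measurableI; exact: measurable_restrict.
  + exact: measurableI.
  + rewrite /event -cylinderI; apply/seteqP; split => [w /= [[[c1 x1] y1] [[c2 x2] y2]]|w /= [[[c1 c2] [x1 x2]] /andP[y1 y2]]].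
      by split; [split|apply/andP].
    by split; split.
- by move=> _ [S [D [E [Y [St mD mE ->]]]]]; exact: measurable_event.
- by exists [::], (fun _ _ _ => setT), setT, predT; split => //; apply/seteqP; split.
- by apply: bounded_integrable; exact: (bounded_measurable_cos_phase l th measurable_Z).
- apply: bounded_integrable; apply: bounded_measurableM.
    exact: (bounded_measurable_cos_phase l th (sub_measurable measurable_cond_mean)).
  exact: bounded_damping (sub_measurable measurable_cond_variance) cond_variance_ge0.
- by move=> _ [S [D [E [Y [St mD mE ->]]]]]; exact: jump_cos_event.
move: A HA; apply: pre_jump_sub => //.
  by move=> B nB; apply: sub_sigma_algebra; right.
by move=> S D B Y St mD mB; apply: sub_sigma_algebra; left; exists S, D, B, Y.
Qed.

Lemma cond_gaussian_jump :
  cond_gaussian P (pre_jump_sigma P X J xi t) Z cond_mean cond_variance.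
Proof.
have mM := sub_measurable measurable_cond_mean; have mV := sub_measurable measurable_cond_variance.
split.
- by move=> B; exact: (sigma_measurableP pre_jump_gens cond_mean).2 measurable_cond_mean B.
- by move=> B; exact: (sigma_measurableP pre_jump_gens cond_variance).2 measurable_cond_variance B.
- exact: cond_variance_ge0.
move=> B mB; pose f w := fine (gaussian_law (cond_mean w) (cond_variance w) B).
have mfH : measurable_fun [set: g_sigma_algebraType pre_jump_gens] f.
  apply: measurable_gaussian_law => //; [exact: measurable_cond_mean|exact: measurable_cond_variance|].
  exact: cond_variance_ge0.
have bf : bounded_measurable f.
  split; first exact: sub_measurable.
  exists 1 => w; have /andP[f0 f1] := gaussian_law01 (cond_mean w) (cond_variance_ge0 w) mB.
  by rewrite ger0_norm.
have mZB : measurable (Z @^-1` B) by rewrite -[X in measurable X]setTI; exact: measurable_Z.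
have bZ := @bounded_measurable_indic _ _ R _ mZB.
split.
- exact: (sigma_measurableP pre_jump_gens f).2 mfH.
- exact: bounded_integrable.
move=> A HA; have mA := pre_jump_measurable HA.
have conv g : bounded_measurable g ->
    (\int[P]_(w in A) (g w)%:E)%E = (\int[P]_w (\1_A w * g w))%:E.
  move=> bg; have ig := integrableS measurableT mA (@subsetT _ A) (bounded_integrable P bg).
  rewrite -(fineK (integrable_fin_num mA ig)); congr EFin.
  under [RHS]eq_Rintegral do rewrite mulrC.
  by rewrite Rintegral_mul_indic.
rewrite (conv f bf) (conv _ bZ); congr EFin.
rewrite -(cond_gaussian_cos mA measurable_Z mM mV cond_variance_ge0 mB); first by [].
move=> l th; transitivity (\int[P]_w (cos (l * Z w + th) * \1_A w)).
  by apply: eq_Rintegral => w _; rewrite mulrC.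
rewrite (gens_cos _ _ HA); apply: eq_Rintegral => w _; exact: mulrC.
Qed.

End conditional_jump.

(** * Jump sizes *)

Unset Implicit Arguments.
Set Strict Implicit.
Set Printing Implicit Defensive.

Theorem proposition2p17 (R : realType) (d : measure_display)
    (T : measurableType d) (P : probability T R)
    (G : R -> set (set T))
    (G_filtration : filtration `[0, +oo[ G)
    (G_right_continuous : right_continuous_filtration `[0, +oo[ G)
    (G_complete : complete_filtration P `[0, +oo[ G)
    (XX : set R) (mXX : measurable XX)
    (X : {RV P >-> R}) (X_in_XX : forall w, XX (X w))
    (X_L2 : (X : T -> R) \in Lfun P 2%:E)
    (n : nat) (sigma : 'I_n -> R) (sigma_gt0 : forall i, 0 < sigma i)
    (beta : 'I_n -> R -> {RV P >-> R})
    (beta_bridge : forall i, brownian_bridge (beta i))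
    (X_beta_independent : mutually_independent P
       (fun o : option 'I_n => if o is Some i
          then sigma_process `[0, 1] (fun u => beta i u : T -> R)
          else sigma_rv X))
    (zeta : R.-ker T ~> (n.-tuple R)) (zeta_field : point_field zeta)
    (J : 'I_n -> R -> {RV P >-> bool}) (J_modulator : modulator zeta J) :
  let xi := information X sigma beta in
  let F := modulated_filtration P X J xi in
  let K := activated J in
  let Z := jump_Z J xi sigma in
  let g := jump_g J xi sigma (distribution P X) XX in
  independent P
    <<s \bigcup_(i in [set: 'I_n]) sigma_process `[0, 1] (J i) >>
    <<s sigma_rv X `|`
        \bigcup_(i in [set: 'I_n]) sigma_process `[0, 1] (xi i) >> ->
  right_continuous_filtration `[0, 1] F ->
  forall Xt : R -> T -> R,
  (forall t, 0 <= t <= 1 -> is_cond_expectation P (F t) X (Xt t)) ->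
  {ae P, forall w, cadlag (fun t => Xt t w)} ->
  {ae P, forall w, forall t, 0 <= t < 1 ->
     (forall z, (0 < #|K t w|)%N \/ z = Z t w ->
        jump_g_defined J xi sigma (distribution P X) XX t w z) /\
     Xt t w - left_limit (fun u => Xt u w) t =
       g t w (Z t w) - left_limit (fun u => Xt u w) t} /\
  (forall t, 0 <= t < 1 ->
     exists M V : T -> R,
       cond_gaussian P (pre_jump_sigma P X J xi t) (Z t) M V /\
       (forall w, (0 < #|K t w|)%N -> 0 < V w)).
Proof.
move=> xi F K Z g indepJ rcF Xt condXt cadXt.
have null_measurable : null_sets P `<=` measurable.
  have h0 : `[0, +oo[%classic (0 : R) by rewrite /= in_itv /= lexx.
  have [GG _] := G_filtration.
  by move=> A nA; apply: (GG 0 h0).2; exact: G_complete nA.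
have cadJ i w : cadlag (fun u => J i u w) by have [] := J_modulator w i.
have iX : P.-integrable setT (EFin \o (X : T -> R)).
  by apply/Lfun1_integrable; apply: Lfun_subset12 => //; rewrite fin_num_measure.
have le01 (t : R) : 0 <= t < 1 -> 0 <= t <= 1 by move=> /andP[-> /ltW].
have reg := regular_ae beta_bridge.
split.
  have est := estimate_all_times sigma_gt0 iX cadJ reg cadXt
    (fun t t01 => cond_expectation_estimate sigma_gt0 beta_bridge X_beta_independent indepJ
      null_measurable cadJ t01 iX (condXt t (le01 t t01))).
  apply: filterS2 reg est => w rw estw t t01; split.
    by move=> z hz; exact: (jump_g_definedP sigma_gt0 mXX X_in_XX iX t01 rw).
  by rewrite (estw t t01) /g /Z (jump_g_estimate J sigma_gt0 mXX X_in_XX iX t01 rw).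
move=> t /andP[]; rewrite le_eqVlt => /predU1P[<-|t0] t1.
  exists (fun=> 0), (fun=> 0).
  have K0 w : K 0 w = finset.set0.
    apply/eqP/set0Pn => -[i /in_activated[_]]; by rewrite ltxx.
  split; last by move=> w; rewrite K0 cards0.
  by apply: cond_gaussian_cst => w; rewrite /Z /jump_Z -/K K0 big_set0.
have t01 : 0 < t < 1 by rewrite t0.
exists (cond_mean X sigma beta J t), (cond_variance sigma J t); split.
  exact: cond_gaussian_jump.
by move=> w; exact: cond_variance_gt0.
Qed.
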